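(* Let $d\ge1$ and $k,n\in\mathbb N_0$. For $0\le l\le d$ the maps \[ \pi_{n,k}^l:H\Lambda^l(\Omega)\to V_{n,k}^l,\qquad \pi_{n,k}^l\omega=P_{\mathcal Z_{n,k}^l}\omega+R_{n,k}^{l+1}P_{\mathcal B_{n,k}^{l+1}}\mathrm d\omega, \] are projections onto $V_{n,k}^l$ (that is, $\pi_{n,k}^lv_h=v_h$ for all $v_h\in V_{n,k}^l$) and satisfy \[ \mathrm d\,\pi_{n,k}^l=\pi_{n,k}^{l+1}\,\mathrm d,\qquad 0\le l<d, \] \[ \|\pi_{n,k}^l\omega\|_{H(\mathrm d)}\le\sqrt{1+\pi^{-2}}\,\|\omega\|_{H(\mathrm d)},\qquad \omega\in H\Lambda^l(\Omega),\ 0\le l\le d, \] where $\pi$ in $\sqrt{1+\pi^{-2}}$ is the usual circle constant.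
   Context: $\Omega=(0,1)^d$, $[d]=\{1,\dots,d\}$, $\mathbb N_0=\{0,1,2,\dots\}$. For $I=\{i_1<\dots<i_l\}\subseteq[d]$ put $\mathrm dx_I=\mathrm dx_{i_1}\wedge\cdots\wedge\mathrm dx_{i_l}$. $L^2\Lambda^l(\Omega)$ is the space of $l$-forms $\omega=\sum_{|I|=l}u_I\,\mathrm dx_I$ with $u_I\in L^2(\Omega)$, with $\|\omega\|_{L^2}^2=\sum_{|I|=l}\|u_I\|_{L^2(\Omega)}^2$ and the corresponding inner product. The (weak) exterior derivative is $\mathrm d\omega=\sum_{|I|=l}\sum_{j\notin I}\partial_{x_j}u_I\,\mathrm dx_j\wedge\mathrm dx_I$ ($\mathrm d=0$ on $d$-forms). $H\Lambda^l(\Omega)=\{\omega\in L^2\Lambda^l(\Omega):\mathrm d\omega\in L^2\Lambda^{l+1}(\Omega)\}$ with $\|\omega\|_{H(\mathrm d)}^2=\|\omega\|_{L^2}^2+\|\mathrm d\omega\|_{L^2}^2$. One-dimensional spaces. $\mathbb P_r(K)$: polynomials of degree at most $r$ on the interval $K$. $\mathcal T_m$: uniform partition of $(0,1)$ into $2^m$ cells. $S_m^{k+1}=\{v\in C^0([0,1]):v|_K\in\mathbb P_{k+1}(K)\ \forall K\in\mathcal T_m\}$, $Q_m^k=\{q\in L^2(0,1):q|_K\in\mathbb P_k(K)\ \forall K\in\mathcal T_m\}$. $Z_0^k=Q_0^k$, and for $m\ge1$, $Z_m^k$ is the $L^2(0,1)$-orthogonal complement of $Q_{m-1}^k$ in $Q_m^k$.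 One has $Z_m^k=\bigoplus_{K\in\mathcal T_{m-1}}Z_K^k$, where $Z_K^k$ consists of functions supported on $K$ that are polynomials of degree at most $k$ on each of the two halves of $K$ and are $L^2(K)$-orthogonal to $\mathbb P_k(K)$; let $\{\psi_{m,K,r}^k\}_{r=0}^k$ be an $L^2$-orthonormal basis of $Z_K^k$. For $K=[a_K,b_K]\in\mathcal T_{m-1}$ set $\theta_{m,K,r}^{k+1}(x)=\int_{a_K}^x\psi_{m,K,r}^k(s)\,\mathrm ds$ for $x\in K$ and $0$ for $x\notin K$. $Y_0^{k+1}=S_0^{k+1}$, and for $m\ge1$, $Y_m^{k+1}=\operatorname{span}\{\theta_{m,K,r}^{k+1}:K\in\mathcal T_{m-1},0\le r\le k\}$. Sparse spaces. $\mathcal M_n=\{\boldsymbol m\in\mathbb N_0^d:m_1+\dots+m_d\le n+d-1\}$, $W_{\boldsymbol m}^{I,k}=\big(\bigotimes_{i\in I}Z_{m_i}^k(x_i)\big)\otimes\big(\bigotimes_{j\notin I}Y_{m_j}^{k+1}(x_j)\big)$, and $V_{n,k}^l=\bigoplus_{|I|=l}\bigoplus_{\boldsymbol m\in\mathcal M_n}W_{\boldsymbol m}^{I,k}\,\mathrm dx_I$; one has $\mathrm dV_{n,k}^l\subseteq V_{n,k}^{l+1}$. $\mathcal Z_{n,k}^l=\ker(\mathrm d|_{V_{n,k}^l})$, $\mathcal B_{n,k}^l=\mathrm dV_{n,k}^{l-1}$, and $\mathcal Z_{n,k}^{l,\perp}$ is the $L^2$-orthogonal complement of $\mathcal Z_{n,k}^l$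 in $V_{n,k}^l$. Spaces and operators with superscript $-1$ or $d+1$ are zero. $P_X$ is the $L^2$-orthogonal projection onto a discrete subspace $X$. The restriction $\mathrm d|_{\mathcal Z_{n,k}^{l,\perp}}:\mathcal Z_{n,k}^{l,\perp}\to\mathcal B_{n,k}^{l+1}$ is a bijection, and $R_{n,k}^{l+1}:=(\mathrm d|_{\mathcal Z_{n,k}^{l,\perp}})^{-1}$. *)

(* Defs.v *)
From HB Require Import structures.
From mathcomp Require Import all_boot all_order all_algebra.
From mathcomp Require Import all_classical all_reals all_analysis.

Set Implicit Arguments.
Unset Strict Implicit.
Unset Printing Implicit Defensive.

Import Order.TTheory GRing.Theory Num.Theory.
Import numFieldNormedType.Exports.

Local Open Scope classical_set_scope.
Local Open Scope ring_scope.
(* Lebesgue measure on (0,1), as a probability on R. *)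
Section lebesgue01.
Variable R : realType.

Definition lebesgue01 : set (measurableTypeR R) -> \bar R :=
  mrestr (@lebesgue_measure R) (measurable_itv `]0, 1[).

HB.instance Definition _ := Measure.on lebesgue01.

Let lebesgue01_setT : lebesgue01 setT = 1%E.
Proof.
rewrite /lebesgue01 /mrestr setTI lebesgue_measure_itv/= lte_fin ltr01.
by rewrite sube0.
Qed.

HB.instance Definition _ :=
  Measure_isProbability.Build _ _ _ lebesgue01 lebesgue01_setT.

End lebesgue01.

(* Lebesgue measure on (0,1)^d, as a probability on R^d: the d-fold product of
   lebesgue01, along R^(n.+1) = R * R^n. *)
Section lebesgue_cube.
Variable R : realType.
Local Notation RT := (measurableTypeR R).

Definition tcons n (x : RT * n.-tuple RT) : n.+1.-tuple RT :=
  [tuple of x.1 :: x.2].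

Lemma measurable_tcons n : measurable_fun setT (@tcons n).
Proof. exact: measurable_cons. Qed.

HB.instance Definition _ n :=
  isMeasurableFun.Build _ _ _ _ (@tcons n) (@measurable_tcons n).

Fixpoint lebesgue_cube n : probability (n.-tuple RT) R :=
  match n with
  | 0 => \d_ [tuple]
  | n'.+1 => distribution (@lebesgue01 R \x lebesgue_cube n')%E (@tcons n')
  end.

Lemma lebesgue_cube_box n (A : 'I_n -> set RT) :
  (forall i, measurable (A i)) ->
  lebesgue_cube n [set x | forall i, A i (tnth x i)] =
  (\prod_(i < n) lebesgue01 (A i))%E.
Proof.
elim: n A => [|n IH] A mA /=.
  rewrite big_ord0 diracE mem_set//; by case.
rewrite big_ord_recl -IH//= /distribution /pushforward /=.
rewrite -product_measure1E//.
  congr (product_measure1 _ _ _); apply/seteqP; split => [[x t]|[x t] [/= Ax At]] /=.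
    move=> H; split; first exact: (H ord0).
    by move=> i; have := H (lift ord0 i); rewrite tnthS.
  by move=> i; have [j ->|->] := unliftP ord0 i; rewrite ?tnthS.
rewrite [X in measurable X](_ : _ = \bigcap_(i in [set: 'I_n]) ((@tnth n RT)^~ i @^-1` A (lift ord0 i))).
  apply: fin_bigcap_measurable => // i _.
  by rewrite -[X in measurable X]setTI; exact: measurable_tnth.
apply/seteqP; split => [t H i _|t H i]; [exact: H|exact: H].
Qed.
End lebesgue_cube.

(* Elements of L^2 are represented by functions; equality in L^2 is equality
   almost everywhere for lebesgue01, respectively lebesgue_cube. *)
Section OneDimensional.
Variable R : realType.
Local Notation RT := (measurableTypeR R).
Local Notation mu1 := (@lebesgue01 R).

Definition lspan (T : Type) (S : set (T -> R)) : set (T -> R) :=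
  [set f | exists (N : nat) (c : 'I_N -> R) (g : 'I_N -> T -> R),
     (forall i, S (g i)) /\ f = (fun x => \sum_(i < N) c i * g i x)].

Definition node (m j : nat) : R := j%:R / (2 ^ m)%:R.

(* The cells of the uniform partition T_m are cell m j for j < 2 ^ m. *)
Definition cell (m j : nat) : set R := `[node m j, node m j.+1].

Definition polyle (r : nat) : set {poly R} := [set p | (size p <= r.+1)%N].

Definition Sspace (r m : nat) : set (R -> R) :=
  [set v : R -> R | {within `[0, 1], continuous v} /\
     forall j, (j < 2 ^ m)%N -> exists2 p, polyle r p &
       forall x, cell m j x -> v x = p.[x]].

Definition Qspace (k m : nat) : set (RT -> R) :=
  [set q | q \in Lfun mu1 2%:E /\
     forall j, (j < 2 ^ m)%N -> exists2 p, polyle k p &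
       {ae mu1, forall x, cell m j x -> q x = p.[x]}].

Definition Zspace (k m : nat) : set (RT -> R) :=
  match m with
  | 0 => Qspace k 0
  | m'.+1 => [set q | Qspace k m'.+1 q /\
      forall g, Qspace k m' g -> \int[mu1]_x (q x * g x) = 0]
  end.

(* Z_K^k for K = cell m j; the halves of K are cell m.+1 (2 * j) and
   cell m.+1 (2 * j).+1. *)
Definition ZKspace (k m j : nat) : set (RT -> R) :=
  [set q | [/\ q \in Lfun mu1 2%:E,
     {ae mu1, forall x, ~ cell m j x -> q x = 0},
     forall i, i \in [:: (2 * j)%N; (2 * j).+1] -> exists2 p, polyle k p &
       {ae mu1, forall x, cell m.+1 i x -> q x = p.[x]} &
     forall p, polyle k p -> \int[mu1]_(x in cell m j) (q x * p.[x]) = 0]].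

(* psi m j r, with m >= 1, j < 2 ^ m.-1 and r <= k, is psi_{m,K,r}^k for
   K = cell m.-1 j. *)
Definition is_orthonormal_wavelets (k : nat)
    (psi : nat -> nat -> nat -> RT -> R) :=
  forall m j, (0 < m)%N -> (j < 2 ^ m.-1)%N ->
  [/\ forall r, (r <= k)%N -> ZKspace k m.-1 j (psi m j r),
      forall r s, (r <= k)%N -> (s <= k)%N ->
        \int[mu1]_x (psi m j r x * psi m j s x) = (r == s)%:R &
      forall q, ZKspace k m.-1 j q -> exists c : nat -> R,
        q = (fun x => \sum_(r < k.+1) c r * psi m j r x) %[ae mu1]].

Variable psi : nat -> nat -> nat -> RT -> R.

Definition theta (m j r : nat) (x : R) : R :=
  if x \in cell m.-1 j then
    \int[@lebesgue_measure R]_(s in `[node m.-1 j, x]) psi m j r s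
  else 0.

(* Y_m^{k+1} *)
Definition Yspace (k m : nat) : set (R -> R) :=
  match m with
  | 0 => Sspace k.+1 0
  | m'.+1 => lspan [set f | exists j r,
      [/\ (j < 2 ^ m')%N, (r <= k)%N & f = theta m'.+1 j r]]
  end.

End OneDimensional.

Section Forms.
Variables (R : realType) (d : nat).
Local Notation RT := (measurableTypeR R).
Local Notation X := (d.-tuple RT).
Local Notation mu := (@lebesgue_cube R d).

(* An l-form sum_{|I| = l} u_I dx_I is the family of its coefficients; only the
   u_I with |I| = l are relevant, the other ones are ignored. *)
Definition dform := {set 'I_d} -> X -> R.
HB.instance Definition _ := Pointed.on dform.
HB.instance Definition _ := GRing.Zmodule.on dform.

Definition form_ae_eq (l : nat) (w h : dform) :=
  forall I : {set 'I_d}, #|I| = l -> w I = h I %[ae mu].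

Definition L2form (l : nat) : set dform :=
  [set w | forall I : {set 'I_d}, #|I| = l -> w I \in Lfun mu 2%:E].

Definition inner (l : nat) (w h : dform) : R :=
  \sum_(I : {set 'I_d} | #|I| == l) \int[mu]_x (w I x * h I x).

Definition L2norm (l : nat) (w : dform) : R := Num.sqrt (inner l w w).

(* C_c^oo(Omega), with Omega = (0,1)^d seen in 'rV[R]_d. *)
Definition Omega : set 'rV[R]_d := [set x | forall i, 0 < x ord0 i < 1].

Definition partial (i : 'I_d) (f : 'rV[R]_d -> R) : 'rV[R]_d -> R :=
  'D_(delta_mx ord0 i) f.

Definition smooth (f : 'rV[R]_d -> R) :=
  forall s : seq 'I_d, let g := foldr partial f s in
    continuous g /\ forall i x, derivable g x (delta_mx ord0 i).

Definition test_function (f : 'rV[R]_d -> R) :=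
  let supp := closure [set x | f x != 0] in
  [/\ smooth f, compact supp & supp `<=` Omega].

Definition to_rV (x : X) : 'rV[R]_d := \row_i tnth x i.

(* dx_j /\ dx_I = dsign j I * dx_(j |: I) for j \notin I. *)
Definition dsign (j : 'I_d) (I : {set 'I_d}) : R :=
  (-1) ^+ #|[set i in I | (i < j)%N]|.

(* h is the weak exterior derivative of the l-form w: its coefficient h_J is
   sum_{j in J} dsign j (J \ j) * d_j w_(J \ j) in the sense of distributions
   on Omega. *)
Definition weak_ext_deriv (l : nat) (w h : dform) :=
  forall J : {set 'I_d}, #|J| = l.+1 -> forall phi, test_function phi ->
    \int[mu]_x (h J x * phi (to_rV x)) =
    - \sum_(j in J) dsign j (J :\ j) *
        \int[mu]_x (w (J :\ j) x * partial j phi (to_rV x)).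

Definition Hform (l : nat) : set dform :=
  [set w | L2form l w /\ exists2 h, L2form l.+1 h & weak_ext_deriv l w h].

(* Operators are given by choice of a representative, and are meaningful where
   the specification is satisfiable: ext_d l on Hform l, Rop l on Bimg l.+1. *)
Definition ext_d (l : nat) (w : dform) : dform :=
  get [set h | L2form l.+1 h /\ weak_ext_deriv l w h].

Definition Hnorm (l : nat) (w : dform) : R :=
  Num.sqrt (L2norm l w ^+ 2 + L2norm l.+1 (ext_d l w) ^+ 2).

(* P_E, for a space E of l-forms. *)
Definition L2proj (l : nat) (E : set dform) (w : dform) : dform :=
  get [set p | E p /\ forall v, E v -> inner l (w - p) v = 0].

Variables (k n : nat) (psi : nat -> nat -> nat -> RT -> R).

Definition Mset : set ('I_d -> nat) :=
  [set m | (\sum_(i < d) m i <= n + d - 1)%N].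

Definition Wspace (m : 'I_d -> nat) (I : {set 'I_d}) : set (X -> R) :=
  lspan [set f | exists v : 'I_d -> RT -> R,
    [/\ forall i, i \in I -> Zspace k (m i) (v i),
        forall j, j \notin I -> Yspace psi k (m j) (v j) &
        f = (fun x => \prod_(i < d) v i (tnth x i))]].

(* The sum over m in M_n of the subspaces W_m^I is the span of their union. *)
Definition Vspace (l : nat) : set dform :=
  [set w | L2form l w /\ forall I : {set 'I_d}, #|I| = l ->
    exists2 f, lspan (\bigcup_(m in Mset) Wspace m I) f & w I = f %[ae mu]].

Definition Zker (l : nat) : set dform :=
  [set v | Vspace l v /\ form_ae_eq l.+1 (ext_d l v) 0].

Definition Bimg (l : nat) : set dform :=
  match l with
  | 0 => [set h | L2form 0 h /\ form_ae_eq 0 h 0]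
  | l'.+1 => [set h | L2form l'.+1 h /\
      exists2 v, Vspace l' v & form_ae_eq l'.+1 h (ext_d l' v)]
  end.

Definition Zperp (l : nat) : set dform :=
  [set v | Vspace l v /\ forall z, Zker l z -> inner l v z = 0].

(* Rop l is R_{n,k}^{l+1}, from (l+1)-forms to l-forms. *)
Definition Rop (l : nat) (h : dform) : dform :=
  get [set z | Zperp l z /\ form_ae_eq l.+1 (ext_d l z) h].

Definition pi_proj (l : nat) (w : dform) : dform :=
  L2proj l (Zker l) w + Rop l (L2proj l.+1 (Bimg l.+1) (ext_d l w)).

End Forms.

(* Main.v *)
(* Every coefficient of a form in V_{n,k}^l is a combination of products of
   one-dimensional factors, and, up to null sets, Y_m^{k+1} consists of the
   primitives of Z_m^k (plus the constants when m = 0).  Taking the mean-free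
   primitive in x_i of the coefficient of dx_i /\ dx_I, and the mean in the
   variables before x_i, therefore maps sparse forms to sparse forms; summing over
   i < min I gives an operator K with d K h = h for every closed sparse h, by
   telescoping the successive means.  Its summands are L^2-orthogonal, and each of
   them satisfies the one-dimensional bound pi * |u| <= |u'| for mean-free u, so
   that pi * |K h| <= |h|.  Hence the sparse complex is exact, ker d = im d in
   positive degree, and |R h| <= |h| / pi because R h has minimal norm among the
   potentials of h.  The bound on pi_{n,k}^l follows from
   |P w|^2 + |R P dw|^2 + |P dw|^2 <= |w|^2 + (1 + 1/pi^2) |dw|^2. *)
Require Import Defs.
From HB Require Import structures.
From mathcomp Require Import all_boot all_order all_algebra.
From mathcomp Require Import all_classical all_reals all_analysis.
From mathcomp Require Import measurable_realfun.
From mathcomp Require Import ring lra.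

Set Implicit Arguments.
Unset Strict Implicit.
Unset Printing Implicit Defensive.
Import Order.TTheory GRing.Theory Num.Theory.
Import numFieldNormedType.Exports.
Local Open Scope classical_set_scope.
Local Open Scope ring_scope.

(** * Square-integrable functions *)

(** Forms are functions and their equality is almost everywhere, so a mean or a primitive along a
    coordinate line makes no sense for a general coefficient. The operators are therefore studied on
    genuine finite sums of products of L^2 factors ([tens2]), all of whose slices are in L^2; that
    they respect almost-everywhere equality is deduced afterwards from their norm bound. The
    condition i < min I does two jobs. The variables averaged before x_i carry Y factors, and their
    means are constants, which lie in Y_0; levels thus only decrease, and the index set is stable
    under decrease. Moreover dx_i stands first, so no sign enters. The orthogonality of the summands
    also comes from the averaging: for i < j the j-th one does not depend on x_i, while the i-th one
    has zero mean in x_i. Two facts about test functions carry the weak derivative: an L^2 function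
    orthogonal to all of them vanishes, so the weak d is single valued, and their mixed partials
    commute, so d d = 0. *)

Section SquareIntegrable.
Context d (T : measurableType d) (R : realType) (P : probability T R).
Implicit Types f g h : T -> R.
Local Notation L2 := (Lfun P 2%:E).
Local Notation integ f := (P.-integrable setT (EFin \o f)).

Definition ip f g : R := \int[P]_x (f x * g x).

Lemma L2_measurable f : f \in L2 -> measurable_fun setT f.
Proof. by rewrite inE => /andP[/[!inE]/= mf _]. Qed.

Lemma L2_sqr f : measurable_fun setT f -> integ (fun x => f x ^+ 2) -> f \in L2.
Proof.
move=> mf /integrableP[_ h]; rewrite inE; apply/andP; split; rewrite inE//=.
rewrite /finite_norm unlock /Lnorm poweR_lty//; apply: le_lt_trans h.
rewrite ge0_le_integral//.
- by move=> x _; rewrite lee_fin powR_ge0.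
- apply/measurable_EFinP/(@measurableT_comp _ _ _ _ _ _ (fun x : R => x `^ 2)) => //.
  exact/measurableT_comp.
- apply: measurableT_comp => //; apply/measurable_EFinP; exact: measurable_funX.
- by move=> t _ /=; rewrite lee_fin normrX powR_mulrn.
Qed.

Lemma L2M_integrable f g : f \in L2 -> g \in L2 -> integ (fun x => f x * g x).
Proof. by move=> hf hg; apply/Lfun1_integrable/(Lfun2_mul_Lfun1 hf hg). Qed.

Lemma L2_cst (c : R) : (fun _ => c) \in L2.
Proof. exact: Lfun_cst. Qed.

Lemma L2_integrable f : f \in L2 -> integ f.
Proof.
move=> hf; have := L2M_integrable hf (L2_cst 1).
by apply: eq_integrable => // x _ /=; rewrite mulr1.
Qed.

Lemma L2Z c f : f \in L2 -> (fun x => c * f x) \in L2.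
Proof.
move=> hf; have h : c \o* f \in L2 by apply: Lfun_scale => //; rewrite ler1n.
by rewrite (_ : (fun x => _) = c \o* f) ?h//; apply/funext => x /=; rewrite mulrC.
Qed.

Let p1 : (1 <= 2%:E :> \bar R)%E. Proof. by rewrite lee_fin ler1n. Qed.

Lemma L2D f g : f \in L2 -> g \in L2 -> (fun x => f x + g x) \in L2.
Proof. by move=> hf hg; have [_] := Lfun_addr_closed P p1; apply. Qed.

Lemma L2B f g : f \in L2 -> g \in L2 -> (fun x => f x - g x) \in L2.
Proof.
move=> hf /(L2Z (-1)) hg; have := L2D hf hg.
by rewrite (_ : (fun x => _) = (fun x => f x - g x))//; apply/funext => x; rewrite mulN1r.
Qed.

Lemma L2_sum (I : Type) (s : seq I) (Q : pred I) (F : I -> T -> R) :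
  (forall i, Q i -> F i \in L2) -> (fun x => \sum_(i <- s | Q i) F i x) \in L2.
Proof.
move=> h; elim: s => [|a s IH].
  by rewrite (_ : (fun x => _) = fun _ => 0) ?L2_cst//; apply/funext => x; rewrite big_nil.
case: (boolP (Q a)) => qa.
  rewrite (_ : (fun x => _) = fun x => F a x + \sum_(i <- s | Q i) F i x); last first.
    by apply/funext => x; rewrite big_cons qa.
  by apply: L2D => //; exact: h.
rewrite (_ : (fun x => _) = fun x => \sum_(i <- s | Q i) F i x)//.
by apply/funext => x; rewrite big_cons (negbTE qa).
Qed.

Lemma L2_le f g : g \in L2 -> measurable_fun setT f ->
  (forall x, `|f x| <= `|g x|) -> f \in L2.
Proof.
move=> hg mf h; apply: L2_sqr => //.
apply: le_integrable (Lfun2_integrable_sqr hg) => //.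
  by apply/measurable_EFinP; exact: measurable_funX.
move=> x _ /=; rewrite lee_fin !normrX; exact: lerXn2r.
Qed.

Lemma L2_bounded f (M : R) : measurable_fun setT f -> (forall x, `|f x| <= M) -> f \in L2.
Proof.
move=> mf h; apply: L2_le (L2_cst M) mf _ => x.
by rewrite (le_trans (h x))// ler_norm.
Qed.

Lemma L2_mul_bounded f g (M : R) : f \in L2 -> measurable_fun setT g ->
  (forall x, `|g x| <= M) -> (fun x => f x * g x) \in L2.
Proof.
move=> hf mg h; apply: L2_le (L2Z M hf) _ _.
  by apply: measurable_funM => //; exact: L2_measurable.
move=> x; rewrite !normrM [leRHS]mulrC ler_wpM2l//.
by rewrite (le_trans (h x))// ler_norm.
Qed.

(** Measurability of [f] is assumed separately: the sigma-algebra need not be complete, so it does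
    not pass along almost-everywhere equality. *)
Lemma L2_ae f g : measurable_fun setT f -> g \in L2 -> f = g %[ae P] -> f \in L2.
Proof.
move=> mf hg fg; apply: L2_sqr => //.
have mf2 : measurable_fun setT (EFin \o (fun x => f x ^+ 2)).
  by apply/measurable_EFinP; exact: measurable_funX.
have [mg hg2] := integrableP _ _ _ (Lfun2_integrable_sqr hg).
apply/integrableP; split => //; apply: le_lt_trans hg2.
rewrite [leLHS](ae_eq_integral (fun x => `|(EFin \o (fun x => g x ^+ 2)%R) x|)%E)//.
all: try exact: measurableT_comp.
by apply: filterS fg => x /= fg _; rewrite fg.
Qed.

Lemma ipC f g : ip f g = ip g f.
Proof. by rewrite /ip; apply: eq_Rintegral => x _; rewrite mulrC. Qed.

Lemma ipDl f g h : f \in L2 -> g \in L2 -> h \in L2 ->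
  ip (fun x => f x + g x) h = ip f h + ip g h.
Proof.
move=> hf hg hh; rewrite /ip -RintegralD//; last 2 first.
- exact: L2M_integrable.
- exact: L2M_integrable.
by apply: eq_Rintegral => x _; rewrite mulrDl.
Qed.

Lemma ipZl c f h : f \in L2 -> h \in L2 -> ip (fun x => c * f x) h = c * ip f h.
Proof.
move=> hf hh; rewrite /ip -RintegralZl//; last exact: L2M_integrable.
by apply: eq_Rintegral => x _; rewrite mulrA.
Qed.

Lemma ipZr c f h : f \in L2 -> h \in L2 -> ip h (fun x => c * f x) = c * ip h f.
Proof. by move=> *; rewrite ipC ipZl// (ipC h). Qed.

Lemma ipBl f g h : f \in L2 -> g \in L2 -> h \in L2 ->
  ip (fun x => f x - g x) h = ip f h - ip g h.
Proof.
move=> hf hg hh; rewrite /ip -RintegralB//; last 2 first.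
- exact: L2M_integrable.
- exact: L2M_integrable.
by apply: eq_Rintegral => x _; rewrite mulrBl.
Qed.

Lemma ipBr f g h : f \in L2 -> g \in L2 -> h \in L2 ->
  ip h (fun x => f x - g x) = ip h f - ip h g.
Proof. by move=> *; rewrite ipC ipBl// (ipC h) (ipC h). Qed.

Lemma Rintegral_prob_cst (c : R) : \int[P]_x c = c.
Proof.
rewrite Rintegral_cst// -[RHS]mulr1; congr (_ * _).
exact: (congr1 fine (probability_setT P)).
Qed.

Lemma ip0l h : ip (fun _ => 0) h = 0.
Proof.
rewrite /ip (_ : (fun x => _) = fun _ => 0) ?Rintegral_cst ?mul0r//.
by apply/funext => x; rewrite mul0r.
Qed.

Lemma ip_suml (I : Type) (s : seq I) (Q : pred I) (F : I -> T -> R) h :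
  (forall i, Q i -> F i \in L2) -> h \in L2 ->
  ip (fun x => \sum_(i <- s | Q i) F i x) h = \sum_(i <- s | Q i) ip (F i) h.
Proof.
move=> hF hh; elim: s => [|a s IH].
  by rewrite big_nil -[RHS](ip0l h); congr ip; apply/funext => x; rewrite big_nil.
rewrite big_cons; case: (boolP (Q a)) => qa.
  rewrite -IH -ipDl//; [|exact: hF|exact: L2_sum].
  by congr ip; apply/funext => x; rewrite big_cons qa.
by rewrite -IH; congr ip; apply/funext => x; rewrite big_cons (negbTE qa).
Qed.

Lemma ip_ge0 f : 0 <= ip f f.
Proof. by apply: Rintegral_ge0 => x _; rewrite -expr2 sqr_ge0. Qed.

Lemma Rintegral_ae (D : set T) f g : measurable D -> measurable_fun D f -> measurable_fun D g ->
  f = g %[ae P] -> \int[P]_(x in D) f x = \int[P]_(x in D) g x.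
Proof.
move=> mD mf mg fg; congr fine; apply: ae_eq_integral => //.
- exact/measurable_EFinP.
- exact/measurable_EFinP.
- by apply: filterS fg => x /= fg _; rewrite fg.
Qed.

Lemma ip_ae f f' g g' : f \in L2 -> f' \in L2 -> g \in L2 -> g' \in L2 ->
  f = f' %[ae P] -> g = g' %[ae P] -> ip f g = ip f' g'.
Proof.
move=> hf hf' hg hg' ff gg; apply: Rintegral_ae => //.
- by apply: measurable_funM; exact: L2_measurable.
- by apply: measurable_funM; exact: L2_measurable.
- by apply: filterS2 ff gg => x ff gg _; rewrite ff// gg.
Qed.

Lemma ip_eq0 f : f \in L2 -> ip f f = 0 -> f = (fun _ => 0) %[ae P].
Proof.
move=> hf h0.
have := Lfun2_integrable_sqr hf => /[dup] /integrable_fin_num fn /integrableP[mf2 _].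
have e0 : (\int[P]_x `|(EFin \o (fun x => f x ^+ 2)%R) x| = 0)%E.
  under eq_integral do rewrite /= ger0_norm ?sqr_ge0//.
  rewrite -[LHS]fineK ?fn//; congr EFin; rewrite -[RHS]h0 /ip /Rintegral.
  by congr fine; apply: eq_integral => x _; rewrite expr2.
have := (ae_eq_integral_abs P measurableT mf2).1 e0.
apply: filterS => x /= H /H [] /eqP; by rewrite sqrf_eq0 => /eqP.
Qed.

Lemma ip_eq0_ae f : f \in L2 -> f = (fun _ => 0) %[ae P] -> ip f f = 0.
Proof.
move=> hf h; rewrite (@ip_ae f (fun _ => 0) f (fun _ => 0)) ?ip0l//; exact: L2_cst.
Qed.

(** The quadratic [Q] in t is nonnegative. If [ip g g] is 0 it is affine, and the chosen t would
    give it the value -1 unless [ip f g] is 0; otherwise t is taken at its minimum. *)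
Lemma cauchy_schwarz f g : f \in L2 -> g \in L2 -> ip f g ^+ 2 <= ip f f * ip g g.
Proof.
move=> hf hg.
have Q t : 0 <= ip f f - 2 * t * ip f g + t ^+ 2 * ip g g.
  have hz := L2Z t hg.
  have := ip_ge0 (fun x => f x - t * g x).
  rewrite ipBl ?ipBr ?ipZl ?ipZr//; try exact: L2B.
  rewrite (ipC g f); congr (_ <= _); ring.
have g0 := ip_ge0 g; have [g0'|gN] := eqVneq (ip g g) 0.
  have {}Q t : 0 <= ip f f - 2 * t * ip f g by have := Q t; rewrite g0' mulr0 addr0.
  rewrite g0' mulr0.
  have [->|fg] := eqVneq (ip f g) 0; first by rewrite expr0n.
  have := Q ((ip f f + 1) / (2 * ip f g)).
  rewrite (_ : 2 * _ * _ = ip f f + 1); last by field.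
  lra.
have {}g0 : 0 < ip g g by rewrite lt_def gN.
have := Q (ip f g / ip g g).
rewrite (_ : _ + _ = (ip f f * ip g g - ip f g ^+ 2) / ip g g); last by field.
by rewrite pmulr_lge0 ?invr_gt0// subr_ge0.
Qed.

(** Dominated convergence, prepared for replacing bumps by indicators of boxes. The conclusion is
    about the extended integral because a real-valued integral equal to 0 could also hide an
    infinite one. *)
Lemma Rintegral_dominated0 (f_ : nat -> T -> R) f g :
  (forall k, measurable_fun setT (f_ k)) -> integ g ->
  (forall k x, `|f_ k x| <= `|g x|) -> (forall x, f_ ^~ x @ \oo --> f x) ->
  (forall k, \int[P]_x f_ k x = 0) -> (\int[P]_x (f x)%:E = 0)%E.
Proof.
move=> mf ig fg cv f0.
have mlim : measurable_fun setT f by apply: (measurable_fun_cvg mf) => x _; exact: cv.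
have ig' : P.-integrable setT (fun x => `|g x|%:E) by exact: integrable_norm.
have mfE k : measurable_fun setT (fun x => (f_ k x)%:E) by exact/measurable_EFinP.
have mlE : measurable_fun setT (fun x => (f x)%:E) by exact/measurable_EFinP.
have cvE : {ae P, forall x, setT x -> (fun k => (f_ k x)%:E) @ \oo --> (f x)%:E}.
  by apply: aeW => x _; apply: cvg_EFin; [exact: nearW|exact: cv].
have leE : {ae P, forall x k, setT x -> (`|(f_ k x)%:E| <= `|g x|%:E)%E}.
  by apply: aeW => x k _; rewrite lee_fin; exact: fg.
have [_ _ c] := dominated_convergence measurableT mfE mlE cvE ig' leE.
have E k : (\int[P]_x (f_ k x)%:E = 0)%E.
  have fin : P.-integrable setT (EFin \o f_ k).
    move: ig'; apply: le_integrable => //; first exact: mfE.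
    by move=> x _; rewrite /= lee_fin normr_id; exact: fg.
  by rewrite -[LHS]fineK ?(integrable_fin_num _ fin)//; congr EFin; exact: f0.
apply: (cvg_unique _ c) => //.
rewrite (_ : [sequence _]_n = fun=> 0%E); first exact: cvg_cst.
by apply/funext => k; exact: E.
Qed.

(** Fubini for the integrand q(s) g(x) k(x, s), integrable since it is dominated by |q(s)| |g(x)|.
    It transposes an integral operator with bounded kernel. *)
Lemma ip_kernel (k : T * T -> R) (q g : T -> R) :
  measurable_fun setT k -> (forall z, `|k z| <= 1) -> q \in L2 -> g \in L2 ->
  ip (fun x => ip q (fun s => k (x, s))) g = ip q (fun s => ip g (fun x => k (x, s))).
Proof.
move=> mk k1 hq hg; pose F (z : T * T) := q z.1 * g z.2 * k (z.2, z.1).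
have L2k1 x : (fun s => k (x, s)) \in L2.
  apply: (@L2_bounded _ 1) => //.
  have mp : measurable_fun setT (fun y : T => (x, y)) by exact: measurable_fun_pair.
  exact: (measurableT_comp mk mp).
have L2k2 s : (fun x => k (x, s)) \in L2.
  apply: (@L2_bounded _ 1) => //.
  have mp : measurable_fun setT (fun y : T => (y, s)) by exact: measurable_fun_pair.
  exact: (measurableT_comp mk mp).
have mF : measurable_fun setT F.
  apply: measurable_funM.
    apply: measurable_funM.
    - exact: (measurableT_comp (L2_measurable hq) measurable_fst).
    - exact: (measurableT_comp (L2_measurable hg) measurable_snd).
  have mp : measurable_fun setT (fun z : T * T => (z.2, z.1)) by exact: measurable_fun_pair.
  exact: (measurableT_comp mk mp).
have iF : (P \x P)%E.-integrable setT (EFin \o F).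
  apply/(integrable12ltyP _ _ _).2; first exact/measurable_EFinP.
  have iq := L2_integrable hq; have ig := L2_integrable hg.
  have [mq q1] := integrableP _ _ _ iq; have [mg g1] := integrableP _ _ _ ig.
  have g1f : (\int[P]_x `|(EFin \o g) x| \is a fin_num)%E.
    by rewrite ge0_fin_numE// integral_ge0.
  have mag : measurable_fun setT (fun y => `|(EFin \o g) y|)%E by exact: measurableT_comp.
  apply: (@le_lt_trans _ _ (\int[P]_x (`|(EFin \o q) x| * \int[P]_y `|(EFin \o g) y|))%E).
    apply: ge0_le_integral => //.
    - by move=> x _; exact: integral_ge0.
    - have mA : measurable_fun setT (abse \o (EFin \o F)).
        by apply: measurableT_comp => //; exact/measurable_EFinP.
      exact: (@measurable_fun_fubini_tonelli_F _ _ _ _ _ P _ mA (fun z => abse_ge0 _)).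
    - by apply: emeasurable_funM => //; exact: measurableT_comp.
    move=> x _; rewrite -ge0_integralZl//.
    apply: ge0_le_integral => //.
    - apply: measurableT_comp => //; apply/measurable_EFinP.
      have mp : measurable_fun setT (fun y : T => (x, y)) by exact: measurable_fun_pair.
      exact: (measurableT_comp mF mp).
    - by apply: emeasurable_funM.
    move=> y _; rewrite /F /= lee_fin !normrM -[leRHS]mulr1.
    by apply: ler_wpM2l; [rewrite mulr_ge0|exact: k1].
  rewrite ge0_integralZr//; last 2 first.
  - exact: measurableT_comp.
  - by rewrite integral_ge0.
  by rewrite lte_mul_pinfty ?integral_ge0// ge0_fin_numE// integral_ge0.
have := Fubini iF; rewrite /Rintegral => FE.
rewrite /ip; congr fine.
transitivity (\int[P]_y \int[P]_x (EFin \o F) (x, y))%E.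
  apply: eq_integral => y _; rewrite /= /ip -RintegralZr//; last exact: L2M_integrable.
  rewrite /Rintegral fineK; first by apply: eq_integral => x _; rewrite /F /=; congr EFin; rewrite mulrAC.
  apply: integrable_fin_num => //.
  have h := L2M_integrable (L2Z (g y) hq) (L2k1 y).
  by move: h; apply: eq_integrable => // x _; rewrite /=; congr EFin; rewrite -mulrA mulrC.
rewrite -FE; apply: eq_integral => x _; rewrite /= /ip -RintegralZl//; last exact: L2M_integrable.
rewrite /Rintegral fineK; first by apply: eq_integral => y _; rewrite /F /=; congr EFin; rewrite mulrA.
apply: integrable_fin_num => //.
have h := L2M_integrable (L2Z (q x) hg) (L2k2 x).
by move: h; apply: eq_integrable => // y _; rewrite /=; congr EFin; rewrite mulrA.
Qed.

End SquareIntegrable.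

(** * Integration over the cube one coordinate at a time *)

Section CubeFubini.
Variables (R : realType) (d : nat).
Local Notation RT := (measurableTypeR R).
Local Notation X := (d.-tuple RT).
Local Notation lam := (@lebesgue01 R).
Local Notation cube := (@lebesgue_cube R d).

Definition upd (x : X) (i : 'I_d) (t : RT) : X :=
  [tuple if j == i then t else tnth x j | j < d].

Lemma tnth_upd x i t j : tnth (upd x i t) j = if j == i then t else tnth x j.
Proof. by rewrite tnth_mktuple. Qed.

Lemma upd_upd x i s t : upd (upd x i s) i t = upd x i t.
Proof. by apply: eq_from_tnth => j; rewrite !tnth_upd; case: eqP. Qed.

Definition updf (i : 'I_d) (z : RT * X) : X := upd z.2 i z.1.

Lemma measurable_updf i : measurable_fun setT (updf i).
Proof.
apply/measurable_fun_tnthP => j.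
have [->|ji] := eqVneq j i.
  rewrite (_ : _ \o _ = fst)//.
  by apply/funext => z /=; rewrite tnth_upd eqxx.
rewrite (_ : _ \o _ = (fun x => tnth x j) \o snd).
  exact: (measurableT_comp (measurable_tnth j) measurable_snd).
by apply/funext => z /=; rewrite tnth_upd (negbTE ji).
Qed.

HB.instance Definition _ i :=
  isMeasurableFun.Build _ _ _ _ (updf i) (measurable_updf i).

Lemma measurable_upd x i : measurable_fun setT (upd x i).
Proof.
rewrite (_ : upd x i = updf i \o (fun t => (t, x)))//.
by apply: measurableT_comp; [exact: measurable_updf|exact: measurable_fun_pair].
Qed.

Definition box (A : 'I_d -> set RT) : set X := [set x | forall i, A i (tnth x i)].

Lemma measurable_box A : (forall i, measurable (A i)) -> measurable (box A).
Proof.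
move=> mA; rewrite (_ : box A = \bigcap_(i in [set: 'I_d]) ((fun x => tnth x i) @^-1` A i)).
  apply: fin_bigcap_measurable => // i _.
  by rewrite -[X in measurable X]setTI; exact: measurable_tnth.
by apply/seteqP; split => [t H i _|t H i]; exact: H.
Qed.

Lemma cube_box A : (forall i, measurable (A i)) ->
  (cube (box A) = \prod_(i < d) lam (A i))%E.
Proof. exact: lebesgue_cube_box. Qed.

Lemma measurable_tuple_boxes :
  @measurable _ X = <<s [set box A | A in [set A | forall i, measurable (A i)]] >>.
Proof.
apply/seteqP; split; last first.
  apply: smallest_sub; first exact: sigma_algebra_measurable.
  by move=> _ [A mA <-]; exact: measurable_box.
apply: smallest_sub; first exact: smallest_sigma_algebra.
move=> B; rewrite -bigcup_seq => -[i /= _ [A mA <-]].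
apply: sub_sigma_algebra; exists (fun j => if j == i then A else setT).
  by move=> j /=; case: ifP.
apply/seteqP; split => [x /= /(_ i)|x /= [_ Ax] j]; first by rewrite eqxx.
by case: eqP => // ->.
Qed.

Lemma setI_box A B : box A `&` box B = box (fun i => A i `&` B i).
Proof.
apply/seteqP; split => [x [Ax Bx] i|x H]; first by split.
by split => i; have [] := H i.
Qed.

Lemma cube_unique (m : {measure set X -> \bar R}) :
  (forall A, (forall i, measurable (A i)) -> m (box A) = \prod_(i < d) lam (A i))%E ->
  forall B, measurable B -> m B = cube B.
Proof.
move=> mE; have bT : box (fun=> setT) = setT by apply/seteqP; split.
have eqT A : (forall i, measurable (A i)) -> m (box A) = cube (box A).
  by move=> mA; rewrite mE// cube_box.
apply: (@measure_unique _ _ _ _ (fun=> setT) measurable_tuple_boxes) => //.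
- by move=> _ _ [A mA <-] [B mB <-]; exists (fun i => A i `&` B i);
    [move=> i; exact: measurableI|rewrite setI_box].
- by move=> _; exists (fun=> setT).
- by rewrite bigcup_const.
- by move=> _ [A mA <-]; exact: eqT.
- by move=> _; rewrite -bT eqT// bT probability_setT ltry.
Qed.

(** Resampling coordinate i by an independent uniform variable does not change the law. This yields
    Fubini in any coordinate although [lebesgue_cube] is built recursively from the head. *)
Lemma cube_updf i B : measurable B ->
  distribution (lam \x cube)%E (updf i) B = cube B.
Proof.
apply: cube_unique => A mA; rewrite /distribution /pushforward /=.
rewrite (_ : _ @^-1` _ = A i `*` box (fun j => if j == i then setT else A j)).
  transitivity (lam (A i) * cube (box (fun j => if j == i then setT else A j)))%E.
    by apply: product_measure1E => //; apply: measurable_box => j; case: ifP.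
  rewrite cube_box; last by move=> j; case: ifP.
  rewrite (bigD1 i)//= [in RHS](bigD1 i)//= eqxx probability_setT mul1e.
  by congr (_ * _)%E; apply: eq_bigr => j /negbTE ->.
apply/seteqP; split => [[t x] H|[t x] [/= H1 H2] j].
  split => /=; first by have := H i; rewrite /updf /= tnth_upd eqxx.
  by move=> j; have := H j; rewrite /updf /= tnth_upd; case: eqP.
by have := H2 j; rewrite /updf /= tnth_upd; case: eqP => // ->.
Qed.

Lemma cube_integral_updf i (F : X -> \bar R) :
  (\int[cube]_x F x = \int[distribution (lam \x cube) (updf i)]_x F x)%E.
Proof. by apply/esym/eq_measure_integral => A mA _; exact: cube_updf. Qed.

Lemma integrable_updf i (F : X -> \bar R) : cube.-integrable setT F ->
  (lam \x cube)%E.-integrable setT (F \o updf i).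
Proof.
move=> /integrableP[mF iF]; apply/integrableP; split.
  by apply: measurableT_comp => //; exact: measurable_updf.
move: iF; rewrite (cube_integral_updf i) ge0_integral_distribution//.
exact: measurableT_comp.
Qed.

Lemma cube_fubini i (F : X -> \bar R) : cube.-integrable setT F ->
  (\int[cube]_x F x = \int[cube]_x \int[lam]_t F (upd x i t))%E.
Proof.
move=> /[dup] iF /integrableP[mF _]; rewrite (cube_integral_updf i).
rewrite integral_distribution//; last exact: integrable_updf.
by rewrite -integral21_prod_meas1//; exact: integrable_updf.
Qed.

Lemma integrable_slice i (F : X -> R) : cube.-integrable setT (EFin \o F) ->
  cube.-integrable setT (EFin \o (fun x => \int[lam]_t F (upd x i t))).
Proof.
move=> iF; have iG := integrable_updf i iF.
have [mF _] := integrableP _ _ _ iF; have [mG _] := integrableP _ _ _ iG.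
have mH : measurable_fun setT (fun x => \int[lam]_t F (upd x i t)).
  by apply: measurableT_comp => //; exact: (measurable_fubini_G iG).
apply/integrableP; split; first exact/measurable_EFinP.
apply: le_lt_trans ((integrable21ltyP _ _ mG).1 iG).
apply: ge0_le_integral => //.
- by do ?apply: measurableT_comp => //; exact/measurable_EFinP.
- apply: (measurable_fun_fubini_tonelli_G (abse \o (EFin \o F \o updf i))) => //=.
  by do ?apply: measurableT_comp => //; exact: measurable_updf.
move=> x _; have ms : measurable_fun setT (fun t => (F (upd x i t))%:E).
  exact: (measurableT_comp mF (measurable_upd x i)).
apply: le_trans (le_abse_integral lam measurableT ms).
(* [fine] sends infinite values to 0, so it can only decrease the absolute value. *)
rewrite /= /Rintegral.
by case: (\int[_]_ _ _)%E => [r| |] //=; rewrite ?normr0 ?leey// lexx.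
Qed.

(** Almost every slice is integrable, so passing to real-valued inner integrals alters them only on
    a null set. *)
Lemma cube_Rfubini i (F : X -> R) : cube.-integrable setT (EFin \o F) ->
  \int[cube]_x F x = \int[cube]_x \int[lam]_t F (upd x i t).
Proof.
move=> iF; have iG := integrable_updf i iF.
have fG := ae_integrable2 iG.
rewrite /Rintegral (cube_fubini i)//; congr fine.
apply: ae_eq_integral => //.
- exact: (measurable_fubini_G iG).
- apply/measurable_EFinP; apply: measurableT_comp => //.
  exact: (measurable_fubini_G iG).
apply: filterS fG => x /= fx _; rewrite fineK//.
exact: integrable_fin_num fx.
Qed.

(** The cylinder over a null set is a box with one side of measure 0. *)
Lemma ae_coord i (Q : RT -> Prop) :
  {ae lam, forall t, Q t} -> {ae cube, forall x, Q (tnth x i)}.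
Proof.
move=> [N [mN N0 QN]]; exists ((fun x => tnth x i) @^-1` N); split.
- by rewrite -[X in measurable X]setTI; exact: measurable_tnth.
- rewrite (_ : _ @^-1` _ = box (fun j => if j == i then N else setT)).
    rewrite cube_box; last by move=> j; case: ifP.
    by rewrite (bigD1 i)//= eqxx N0 mul0e.
  apply/seteqP; split => [x Nx j|x /(_ i)]; last by rewrite eqxx.
  by case: eqP => // ->.
- by move=> x Qx; exact: QN.
Qed.

End CubeFubini.

(** * Primitives and the one-dimensional Poincare inequality *)

Section OneDimCalculus.
Variable R : realType.
Local Notation leb := (@lebesgue_measure R).

Lemma is_derive_continuous (F : R -> R) (x l : R) : is_derive x 1 F l -> {for x, continuous F}.
Proof. by move=> [dF _]; apply/differentiable_continuous/derivable1_diffP. Qed.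

Lemma FTC2 (F f : R -> R) (a b : R) : a < b ->
  (forall x, a <= x <= b -> is_derive x 1 F (f x)) -> {within `[a, b], continuous f} ->
  \int[leb]_(x in `[a, b]) f x = F b - F a.
Proof.
move=> ab dF cf; rewrite /Rintegral (@continuous_FTC2 _ f F)//.
  have cF x : a <= x <= b -> {for x, continuous F}.
    by move=> /dF; exact: is_derive_continuous.
  split.
  - by move=> x; rewrite in_itv/= => /andP[ax xb]; have [] := dF x; rewrite ?ltW.
  - by apply: cvg_at_right_filter; apply: cF; rewrite lexx ltW.
  - by apply: cvg_at_left_filter; apply: cF; rewrite lexx ltW.
move=> x; rewrite in_itv/= => /andP[ax xb].
by rewrite derive1E; have [_ ->] : is_derive x 1 F (f x) by apply: dF; rewrite !ltW.
Qed.

Lemma continuous_integrable (f : R -> R) (a b : R) : {within `[a, b], continuous f} ->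
  leb.-integrable `[a, b] (EFin \o f).
Proof. by move=> cf; apply: continuous_compact_integrable => //; exact: segment_compact. Qed.

(* With T = - rho tan (rho (x - 1/2)), T' = - rho^2 - T^2, so that
   (W^2 T)' = w^2 - rho^2 W^2 - (w - T W)^2; then rho tends to pi. *)
Lemma dirichlet_poincare (W w : R -> R) :
  (forall x : R, 0 <= x <= 1 -> is_derive x 1 W (w x)) -> continuous w ->
  W 0 = 0 -> W 1 = 0 ->
  pi ^+ 2 * \int[leb]_(x in `[0, 1]) (W x ^+ 2) <= \int[leb]_(x in `[0, 1]) (w x ^+ 2).
Proof.
move=> dW cw W0 W1.
have cW : {within `[0, 1], continuous W}.
  apply/subspace_continuousP => x; rewrite /= in_itv/= => x01.
  by apply: cvg_within_filter; exact: is_derive_continuous (dW x x01).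
have cwI : {within `[0, 1], continuous w} by apply: continuous_subspaceT => x; exact: cw.
have c2 (f : R -> R) : {within `[0, 1], continuous f} -> {within `[0, 1], continuous (fun x => f x ^+ 2)}.
  move=> cf x; rewrite (_ : (fun x => _) = f \* f); first by apply: continuousM; exact: cf.
  by apply/funext => y; rewrite expr2.
have iW := continuous_integrable (c2 _ cW).
have iw := continuous_integrable (c2 _ cwI).
have step rho : 0 < rho < pi ->
    rho ^+ 2 * \int[leb]_(x in `[0, 1]) (W x ^+ 2) <= \int[leb]_(x in `[0, 1]) (w x ^+ 2).
  move=> /andP[r0 rpi].
  (* As rho < pi, the argument stays strictly between - pi / 2 and pi / 2 up to both endpoints, so
     [T] has no pole; rho = pi itself would fail at 0 and 1. *)
  have cosN0 (x : R) : 0 <= x <= 1 -> cos (rho * (x - 2^-1)) != 0.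
    move=> /andP[x0 x1]; rewrite gt_eqF//; apply: cos_gt0_pihalf.
    have : rho * (x - 2^-1) <= rho * 2^-1 by rewrite ler_wpM2l ?(ltW r0)//; lra.
    have : rho * - 2^-1 <= rho * (x - 2^-1) by rewrite ler_wpM2l ?(ltW r0)//; lra.
    move=> h1 h2; apply/andP; split; lra.
  pose T x := - (rho * tan (rho * (x - 2^-1))).
  pose dT x := - (rho ^+ 2 + T x ^+ 2).
  have dTE (x : R) : 0 <= x <= 1 -> is_derive x 1 T (dT x).
    move=> x01; have dt := is_derive_tan (cosN0 x x01).
    have dl : is_derive x 1 (fun y : R => rho * (y - 2^-1)) rho.
      have : is_derive x 1 (rho \*: (id - cst 2^-1 : R -> R)) rho.
        by apply: is_derive_eq; rewrite subr0 /GRing.scale /= mulr1.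
      by move=> h; exact: h.
    have dc := @is_derive1_comp _ tan (fun y : R => rho * (y - 2^-1)) x _ _ dt dl.
    have h : is_derive x 1 T _ := is_deriveN (is_deriveZ rho dc).
    apply: is_derive_eq h _.
    rewrite (cos2_tan2 (cosN0 x x01)) /dT /T /GRing.scale /=; ring.
  have cT : {within `[0, 1], continuous T}.
    apply/subspace_continuousP => x; rewrite /= in_itv/= => x01.
    by apply: cvg_within_filter; exact: is_derive_continuous (dTE x x01).
  pose G x := W x ^+ 2 * T x.
  pose g x := 2 * (W x * w x * T x) + W x ^+ 2 * dT x.
  have dG (x : R) : 0 <= x <= 1 -> is_derive x 1 G (g x).
    move=> x01; have h1 := dW x x01; have h2 := dTE x x01.
    have h3 : is_derive x 1 (W ^+ 2 * T) (g x).
      apply: is_derive_eq; rewrite /g /GRing.scale /= !fctE /=.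
      by rewrite expr1; ring.
    by move: h3; congr is_derive; apply/funext => y; rewrite !fctE.
  have cg : {within `[0, 1], continuous g}.
    move=> x; apply: cvgD.
      apply: cvgM; first exact: cvg_cst.
      by apply: cvgM; [apply: cvgM; [exact: cW|exact: cwI]|exact: cT].
    apply: cvgM; first exact: c2.
    apply: cvgN; apply: cvgD; [exact: cvg_cst|exact: c2].
  have := FTC2 ltr01 dG cg; rewrite /G W0 W1 expr0n !mul0r subrr => g0.
  rewrite -subr_ge0 -RintegralZl// -RintegralB//; last first.
    apply: continuous_integrable => x.
    by apply: cvgM; [exact: cvg_cst|exact: c2].
  apply: (@le_trans _ _ (\int[leb]_(x in `[0, 1]) g x)); first by rewrite g0.
  apply: le_Rintegral => //.
  - exact: continuous_integrable.
  - apply: continuous_integrable => x; apply: cvgB; first exact: c2.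
    by apply: cvgM; [exact: cvg_cst|exact: c2].
  move=> x _; rewrite /g /dT -subr_ge0.
  rewrite (_ : _ - _ = (w x - T x * W x) ^+ 2) ?sqr_ge0//; ring.
set A := \int[leb]_(x in _) _ in step *; set B := \int[leb]_(x in _) _ in step *.
have A0 : 0 <= A by apply: Rintegral_ge0 => x _; exact: sqr_ge0.
rewrite leNgt; apply/negP => BA.
have p0 := pi_gt0 R.
have AN : 0 < A.
  rewrite lt_def A0 andbT; apply/eqP => A00; move: BA; rewrite A00 mulr0 ltNge.
  by rewrite Rintegral_ge0// => x _; exact: sqr_ge0.
(* rho := (pi + B / (A pi)) / 2 lies below pi and is too large by AM-GM. *)
have B0 : 0 <= B by apply: Rintegral_ge0 => x _; exact: sqr_ge0.
pose s := B / (A * pi).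
have s0 : 0 <= s by rewrite /s divr_ge0// mulr_ge0// ltW.
have sE : s * (A * pi) = B by rewrite /s divfK// mulf_neq0// gt_eqF.
have spi : s < pi.
  by rewrite /s ltr_pdivrMr ?mulr_gt0//; move: BA; rewrite expr2; lra.
have := step ((pi + s) / 2); rewrite -[B]sE; apply/implyP; rewrite negb_imply.
apply/andP; split; first by apply/andP; split; lra.
rewrite -ltNge -subr_gt0 (_ : _ - _ = A * ((pi - s) / 2) ^+ 2); last by field.
by rewrite mulr_gt0// exprn_gt0//; lra.
Qed.

End OneDimCalculus.

(** * Primitives as inner products with step functions *)

Section Primitive.
Variable R : realType.
Local Notation RT := (measurableTypeR R).
Local Notation leb := (@lebesgue_measure R).
Local Notation lam := (@lebesgue01 R).
Local Notation L2 := (Lfun lam 2%:E).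

Lemma lam_ae01 : {ae lam, forall x : RT, 0 < x < 1}.
Proof.
exists (~` `]0, 1[%classic); split.
- by apply: measurableC; exact: measurable_itv.
- by rewrite /lebesgue01 /mrestr setICl measure0.
- by move=> x /= H; rewrite in_itv.
Qed.

(* The definitions carry several convertible presentations of the filter of
   lebesgue01-almost everywhere, which defeat instance search in filterS. *)
Lemma lam_aeS (P Q : RT -> Prop) : {ae lam, forall x : RT, P x} ->
  (forall x, P x -> Q x) -> {ae lam, forall x : RT, Q x}.
Proof. by move=> h PQ; apply: filterS h. Qed.

Lemma lam_aeS2 (P1 P2 Q : RT -> Prop) : {ae lam, forall x : RT, P1 x} ->
  {ae lam, forall x : RT, P2 x} -> (forall x, P1 x -> P2 x -> Q x) ->
  {ae lam, forall x : RT, Q x}.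
Proof. by move=> h1 h2 PQ; apply: filterS2 h1 h2. Qed.

Lemma lam_integral (f : RT -> \bar R) : measurable_fun setT f ->
  (\int[lam]_x f x = \int[leb]_(x in `]0%R, 1%R[) f x)%E.
Proof.
move=> mf; transitivity (\int[lam]_(x in `]0%R, 1%R[) f x)%E.
  rewrite [RHS]integral_mkcond; apply: ae_eq_integral => //.
    by apply/(measurable_restrictT _ _).1 => //; exact: measurable_funTS.
  by apply: filterS lam_ae01 => x x01 _; rewrite patchE mem_set//= in_itv.
apply: eq_measure_integral => A mA AD.
by rewrite /lebesgue01 /mrestr /=; congr (lebesgue_measure _); exact: setIidl.
Qed.

Lemma lam_Rintegral (f : RT -> R) : measurable_fun setT f ->
  \int[lam]_x f x = \int[leb]_(x in `]0%R, 1%R[) f x.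
Proof. by move=> mf; rewrite /Rintegral lam_integral//; exact/measurable_EFinP. Qed.

Definition heav (x s : R) : R := (s <= x)%R%:R.

Lemma measurable_heav x : measurable_fun setT (heav x : RT -> R).
Proof.
rewrite (_ : heav x = \1_`]-oo, x]); first exact: measurable_indic.
by apply/funext => s; rewrite indicE /heav mem_setE in_itv.
Qed.

Lemma heav_le1 x s : `|heav x s| <= 1.
Proof. by rewrite /heav; case: (s <= x); rewrite ?normr1 ?normr0. Qed.

Lemma L2_heav x : (heav x : RT -> R) \in L2.
Proof. exact: L2_bounded (measurable_heav x) (heav_le1 x). Qed.

(** Written as an inner product, the primitive from 0 inherits linearity, insensitivity to null sets
    and its bounds from [ip], and is defined on all of R. [coprim] is its adjoint. *)
Definition prim (q : RT -> R) (x : R) : R := ip lam q (heav x).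

Definition coprim (g : RT -> R) (s : R) : R := ip lam g (fun x => heav x s).

Lemma L2_coheav s : (fun x : RT => heav x s) \in L2.
Proof.
apply: (@L2_bounded _ _ _ _ _ 1) => [|x]; last exact: heav_le1.
rewrite (_ : (fun x => _) = \1_`[s, +oo[); first exact: measurable_indic.
by apply/funext => x; rewrite indicE /heav mem_setE in_itv/= andbT.
Qed.

(** Cauchy-Schwarz against the indicator of []x, y]]: a primitive of an L^2 function is Hoelder
    continuous of exponent 1/2. *)
Lemma prim_sub_le (q : RT -> R) (x y : R) : q \in L2 -> x <= y ->
  (prim q y - prim q x) ^+ 2 <= ip lam q q * (y - x).
Proof.
move=> hq xy; rewrite /prim -ipBr//; try exact: L2_heav.
have hh : (fun s => heav y s - heav x s) \in L2 by apply: L2B; exact: L2_heav.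
apply: le_trans (cauchy_schwarz hq hh) _; apply: ler_wpM2l; first exact: ip_ge0.
have E : (fun s => (heav y s - heav x s) * (heav y s - heav x s)) = \1_`]x, y] :> (RT -> R).
  apply/funext => s; rewrite indicE mem_setE in_itv/= /heav ltNge.
  case sx : (s <= x); case sy : (s <= y) => /=; rewrite ?subrr ?mul0r ?subr0 ?mulr1//.
  by move: sy; rewrite (le_trans sx xy).
rewrite /ip E /Rintegral integral_indic// setIT /lebesgue01 /mrestr.
have h : (lebesgue_measure (`]x, y] `&` `]0%R, 1%R[) <= (y - x)%:E :> \bar R)%E.
  apply: (@le_trans _ _ (lebesgue_measure `]x, y]%classic)).
    by apply: le_measure => //; rewrite inE//; exact: measurableI.
  by rewrite lebesgue_measure_itv/= lte_fin; case: ltP => // _; rewrite lee_fin subr_ge0.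
rewrite -lee_fin fineK// ge0_fin_numE//; exact: le_lt_trans h (ltry _).
Qed.

Lemma prim_continuous (q : RT -> R) : q \in L2 -> continuous (prim q).
Proof.
move=> hq x; apply/cvgrPdist_lt => e e0.
have c0 : 0 < ip lam q q + 1 by rewrite ltr_wpDl// ip_ge0.
have sq y : (prim q x - prim q y) ^+ 2 <= ip lam q q * `|x - y|.
  case: (leP x y) => xy.
    by rewrite -sqrrN opprB distrC ger0_norm ?subr_ge0// prim_sub_le.
  by rewrite gtr0_norm ?subr_gt0// prim_sub_le// ltW.
near=> y.
rewrite -(ltr_pXn2r (n := 2))// ?nnegrE//; last exact: ltW.
rewrite real_normK ?num_real//; apply: le_lt_trans (sq y) _.
have h : `|x - y| < e ^+ 2 / (ip lam q q + 1).
  by near: y; apply: cvgr_dist_lt => //; rewrite divr_gt0// exprn_gt0.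
apply: (@le_lt_trans _ _ ((ip lam q q + 1) * `|x - y|)).
  by rewrite ler_wpM2r// lerDl.
by rewrite mulrC -ltr_pdivlMr.
Unshelve. all: by end_near. Qed.

(** Cauchy-Schwarz bounds the square by [ip lam q q]; the inequality a <= 1 + a ^ 2 then avoids a
    square root. *)
Lemma prim_le (q : RT -> R) x : q \in L2 -> `|prim q x| <= 1 + ip lam q q.
Proof.
move=> hq; have := cauchy_schwarz hq (L2_heav x); rewrite -/(prim q x).
have h1 : ip lam (heav x) (heav x) <= 1.
  rewrite -[leRHS](Rintegral_prob_cst lam).
  apply: le_Rintegral => //.
  - by apply: L2M_integrable; exact: L2_heav.
  - by apply: L2_integrable; exact: L2_cst.
  - by move=> s _; rewrite /heav; case: (s <= x); rewrite ?mulr1 ?mulr0.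
have q0 := ip_ge0 lam q.
move=> h; have {h h1} : prim q x ^+ 2 <= ip lam q q.
  by apply: le_trans h _; rewrite -[leRHS]mulr1; exact: ler_wpM2l.
rewrite -real_normK ?num_real//.
move: (`|prim q x|) (ip lam q q) => a b {q0} ab.
have := sqr_ge0 (a - 1); nra.
Qed.

Lemma measurable_prim (q : RT -> R) : q \in L2 -> measurable_fun setT (prim q : RT -> R).
Proof. by move=> hq; apply: continuous_measurable_fun; exact: prim_continuous. Qed.

Lemma L2_prim (q : RT -> R) : q \in L2 -> (prim q : RT -> R) \in L2.
Proof. by move=> hq; apply: L2_bounded (measurable_prim hq) _ => x; exact: prim_le. Qed.

Lemma primZ c q x : q \in L2 -> prim (fun s => c * q s) x = c * prim q x.
Proof. by move=> h; rewrite /prim ipZl//; exact: L2_heav. Qed.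

Lemma prim_sum (I : Type) (s : seq I) (Q : pred I) (F : I -> RT -> R) x :
  (forall i, Q i -> F i \in L2) ->
  prim (fun t => \sum_(i <- s | Q i) F i t) x = \sum_(i <- s | Q i) prim (F i) x.
Proof. by move=> h; rewrite /prim ip_suml//; exact: L2_heav. Qed.

Lemma prim_ae q q' x : q \in L2 -> q' \in L2 -> q = q' %[ae lam] -> prim q x = prim q' x.
Proof.
by move=> h h' e; apply: ip_ae => //; [exact: L2_heav|exact: L2_heav|exact: aeW].
Qed.

(** Fubini with the kernel [heav]. This adjunction replaces integration by parts when only [q] in
    L^2 is known. *)
Lemma ip_prim (q g : RT -> R) : q \in L2 -> g \in L2 ->
  ip lam (prim q) g = ip lam q (coprim g).
Proof.
move=> hq hg; apply: (@ip_kernel _ _ _ lam (fun z => heav z.1 z.2)) => //.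
  rewrite (_ : (fun x => _) = (fun b : bool => b%:R) \o (fun z : RT * RT => z.2 <= z.1)%R)//.
  by apply: measurableT_comp => //; exact: measurable_fun_ler.
by move=> z; exact: heav_le1.
Qed.

End Primitive.

(** * Integration by parts and the sharp bound for mean-free primitives *)

Section Wirtinger.
Variable R : realType.
Local Notation RT := (measurableTypeR R).
Local Notation lam := (@lebesgue01 R).
Local Notation leb := (@lebesgue_measure R).
Local Notation L2 := (Lfun lam 2%:E).

(** [heav x s] and [heav s x] add up to 1 except at x = s, a null set. *)
Lemma coprimE (g : RT -> R) s : g \in L2 -> coprim g s = \int[lam]_x g x - prim g s.
Proof.
move=> hg; have L1 : (fun _ : RT => 1) \in L2 by exact: L2_cst.
have hs : (fun x => 1 - heav s x) \in L2 by apply: L2B => //; exact: L2_heav.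
transitivity (ip lam g (fun x => 1 - heav s x)).
  apply: ip_ae => //; [exact: L2_coheav|exact: aeW|].
  exists [set s]; split => //=.
    apply/eqP; rewrite eq_le measure_ge0 andbT.
    rewrite /lebesgue01 /mrestr -(lebesgue_measure_set1 s); apply: le_measure => //.
      by rewrite inE; apply: measurableI => //; exact: measurable_itv.
    by rewrite inE.
  move=> x /=; apply: contra_notP => xs _; rewrite /heav.
  by case: (ltgtP s x) xs => [_ _|_ _|-> []//]; rewrite /= ?subr0 ?subrr.
rewrite ipBr//; last exact: L2_heav.
congr (_ - _); apply: eq_Rintegral => x _; exact: mulr1.
Qed.

Section C1.
Variables g g' : R -> R.
Hypothesis dg : forall x : R, 0 <= x <= 1 -> is_derive x 1 g (g' x).
Hypothesis cg' : continuous g'.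

Let mg' : measurable_fun setT (g' : RT -> R).
Proof. by apply: continuous_measurable_fun. Qed.

Lemma Rintegral_lam_C1 : \int[lam]_x g' x = g 1 - g 0.
Proof.
rewrite lam_Rintegral// -(FTC2 ltr01 dg); last by apply: continuous_subspaceT => x; exact: cg'.
have h : leb.-integrable `[0, 1] (EFin \o g').
  by apply: continuous_integrable; apply: continuous_subspaceT => x; exact: cg'.
rewrite Rintegral_itv_bndo_bndc; last first.
  by apply: integrableS h => //; apply: subset_itv; rewrite bnd_simp.
by rewrite Rintegral_itv_obnd_cbnd//; apply: integrableS h => //; apply: subset_itv; rewrite bnd_simp.
Qed.

Lemma prim_C1 (s : R) : 0 < s < 1 -> prim g' s = g s - g 0.
Proof.
move=> /andP[s0 s1].
have dgs (x : R) : 0 <= x <= s -> is_derive x 1 g (g' x).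
  by move=> /andP[x0 xs]; apply: dg; rewrite x0 (le_trans xs (ltW s1)).
have cgs : {within `[0, s], continuous g'} by apply: continuous_subspaceT => x; exact: cg'.
rewrite -(FTC2 s0 dgs cgs).
have h : leb.-integrable `[0, s] (EFin \o g').
  by apply: continuous_integrable; apply: continuous_subspaceT => x; exact: cg'.
rewrite -Rintegral_itv_obnd_cbnd; last first.
  by apply: integrableS h => //; apply: subset_itv; rewrite bnd_simp.
rewrite /prim /ip lam_Rintegral; last by apply: measurable_funM => //; exact: measurable_heav.
rewrite Rintegral_mkcond [RHS]Rintegral_mkcond; apply: eq_Rintegral => x _.
rewrite !patchE /heav !mem_setE !in_itv/=.
case: (ltP 0 x) => //= x0; case: (leP x s) => xs; rewrite ?(mulr1, mulr0) ?if_same//.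
by rewrite (le_lt_trans xs s1).
Qed.

(** The constant drops out because g' has integral g(1) - g(0) = 0, and for the same reason the
    adjoint primitive of g' is -g. *)
Lemma by_parts_test (q : RT -> R) (c M : R) : q \in L2 ->
  (forall x, `|g x| <= M) -> (forall x, `|g' x| <= M) -> g 0 = 0 -> g 1 = 0 ->
  measurable_fun setT (g : RT -> R) ->
  ip lam (fun x => c + prim q x) g' = - ip lam q g.
Proof.
move=> hq bg bg' g0 g1 mg.
have Lg : (g : RT -> R) \in L2 by apply: L2_bounded mg bg.
have Lg' : (g' : RT -> R) \in L2 by apply: L2_bounded mg' bg'.
have Lc (a : R) : (fun _ : RT => a) \in L2 by exact: L2_cst.
rewrite ipDl//; last exact: L2_prim.
rewrite (_ : ip lam (fun=> c) g' = 0); last first.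
  by rewrite ipC /ip RintegralZr ?Rintegral_lam_C1 ?g0 ?g1 ?subrr ?mul0r//; exact: L2_integrable.
rewrite add0r ip_prim// -mulN1r -ipZr//.
have LN : (fun x => -1 * g x) \in L2 by exact: L2Z.
apply: ip_ae => //; last 2 first.
- exact: aeW.
- apply: filterS (lam_ae01 R) => s s01 _.
  by rewrite coprimE// Rintegral_lam_C1 prim_C1// g0 g1 subrr sub0r subr0 mulN1r.
rewrite (_ : coprim g' = fun s => \int[lam]_x g' x - prim g' s).
  by apply: L2B => //; exact: L2_prim.
by apply/funext => s; exact: coprimE.
Qed.

End C1.

Definition mfprim (q : RT -> R) (x : R) : R := prim q x - \int[lam]_t prim q t.

Lemma L2_mfprim (q : RT -> R) : q \in L2 -> (mfprim q : RT -> R) \in L2.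
Proof. by move=> hq; apply: L2B; [exact: L2_prim|exact: L2_cst]. Qed.

Lemma Rintegral_mfprim (q : RT -> R) : q \in L2 -> \int[lam]_x mfprim q x = 0.
Proof.
move=> hq; rewrite RintegralB//.
- by rewrite Rintegral_prob_cst subrr.
- by apply: L2_integrable; exact: L2_prim.
- by apply: L2_integrable; exact: L2_cst.
Qed.

(* Duality reduces the inequality for u, of mean zero, to the Dirichlet one for
   its primitive: |u|^2 = <prim q, u> = - <q, prim u>. *)
Lemma mfprim_le (q : RT -> R) : q \in L2 ->
  pi ^+ 2 * ip lam (mfprim q) (mfprim q) <= ip lam q q.
Proof.
move=> hq; set u := mfprim q; have hu : u \in L2 by exact: L2_mfprim.
have cu : continuous u.
  move=> x; apply: cvgB; [exact: prim_continuous|exact: cvg_cst].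
(* [u] is continuous on R; starting at -1 makes 0 and 1 interior points, where [F] has the two-sided
   derivative that [dirichlet_poincare] asks for. *)
pose F (x : R) := \int[leb]_(t in `[-1, x]) u t.
have dF (x : R) : 0 <= x <= 1 -> is_derive x 1 F (u x).
  move=> /andP[x0 x1].
  have x2 : x < 2 by lra.
  have iu : leb.-integrable `[-1, 2] (EFin \o u).
    by apply: continuous_integrable; apply: continuous_subspaceT => y; exact: cu.
  have x3 : -1 < x by lra.
  have [h1 h2] := continuous_FTC1_closed x2 iu x3 (cu x).
  by rewrite -[u x]h2 derive1E; exact: derivableP.
have F01 : F 1 = F 0.
  by apply/eqP; rewrite -subr_eq0 -(Rintegral_lam_C1 dF cu) Rintegral_mfprim.
have pF (s : R) : 0 < s < 1 -> prim u s = F s - F 0 by move=> s01; rewrite (prim_C1 dF cu).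
pose W x := F x - F 0.
have dW (x : R) : 0 <= x <= 1 -> is_derive x 1 W (u x).
  move=> x01; have h := dF x x01.
  have : is_derive x 1 (F - cst (F 0)) (u x) by apply: is_derive_eq; rewrite subr0.
  by [].
have D := dirichlet_poincare dW cu; rewrite /W subrr F01 subrr in D.
have {}D := D erefl erefl.
have E1 : ip lam u u = \int[leb]_(x in `[0, 1]) (u x ^+ 2).
  have h : leb.-integrable `[0, 1] (EFin \o (fun x => u x ^+ 2)).
    apply: continuous_integrable; apply: continuous_subspaceT => x.
    rewrite (_ : (fun x => _) = u \* u); first by apply: continuousM; exact: cu.
    by apply/funext => y; rewrite expr2.
  rewrite /ip lam_Rintegral; last exact: measurable_funM (L2_measurable hu) (L2_measurable hu).
  rewrite -Rintegral_itv_obnd_cbnd; last first.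
    by apply: integrableS h => //; apply: subset_itv; rewrite bnd_simp.
  rewrite -Rintegral_itv_bndo_bndc; last first.
    by apply: integrableS h => //; apply: subset_itv; rewrite bnd_simp.
  by apply: eq_Rintegral => x _; rewrite expr2.
have hp := L2_prim hu.
have E2 : ip lam (prim u) (prim u) = \int[leb]_(x in `[0, 1]) ((F x - F 0) ^+ 2).
  have h : leb.-integrable `[0, 1] (EFin \o (fun x => (F x - F 0) ^+ 2)).
    apply: continuous_integrable; apply/subspace_continuousP => x; rewrite /= in_itv/= => x01.
    apply: cvg_within_filter.
    rewrite (_ : (fun x => _) = W \* W); last by apply/funext => y; rewrite expr2.
    by apply: continuousM; exact: is_derive_continuous (dW x x01).
  rewrite /ip lam_Rintegral; last exact: measurable_funM (L2_measurable hp) (L2_measurable hp).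
  rewrite -Rintegral_itv_obnd_cbnd; last first.
    by apply: integrableS h => //; apply: subset_itv; rewrite bnd_simp.
  rewrite -Rintegral_itv_bndo_bndc; last first.
    by apply: integrableS h => //; apply: subset_itv; rewrite bnd_simp.
  by apply: eq_Rintegral => x /[!inE]/=; rewrite in_itv/= => x01; rewrite !pF// expr2.
have E3 : ip lam u u = - ip lam q (prim u).
  have -> : ip lam u u = ip lam (prim q) u.
    transitivity (ip lam (prim q) u - ip lam (fun _ => \int[lam]_t prim q t) u).
      by apply: (ipBl (L2_prim hq) (L2_cst lam _) hu).
    rewrite -[RHS]subr0; congr (_ - _).
    by rewrite /ip RintegralZl ?Rintegral_mfprim ?mulr0//; exact: L2_integrable.
  rewrite (ip_prim hq hu) -mulN1r -(ipZr (-1) hp hq); congr ip; apply/funext => s.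
  by rewrite coprimE// Rintegral_mfprim// sub0r mulN1r.
have CS := cauchy_schwarz hq hp.
rewrite E2 in CS; rewrite -E1 in D.
move: (ip_ge0 lam u) (ip_ge0 lam q) CS D; rewrite -(sqrrN (ip lam q _)) -E3.
have := pi_gt0 R.
(* With a, b, c the squared norms of u, q and prim u: a ^ 2 <= b c by Cauchy-Schwarz and p ^ 2 c <=
   a by the Dirichlet bound, hence p ^ 2 a ^ 2 <= a b. *)
move: (ip lam u u) (ip lam q q) (\int[leb]_(x in _) _) (pi : R) => a b c p p0 a0 b0 ab ca.
have [->|aN] := eqVneq a 0; first by rewrite mulr0.
have {aN}a0 : 0 < a by rewrite lt_def aN.
rewrite -(ler_pM2r a0).
have h : p ^+ 2 * a ^+ 2 <= p ^+ 2 * (b * c) by rewrite ler_wpM2l// sqr_ge0.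
have h2 : b * (p ^+ 2 * c) <= b * a by rewrite ler_wpM2l.
by rewrite -mulrA -expr2 (le_trans h)// mulrCA.
Qed.

End Wirtinger.

(** * Test functions *)

Section TestFunctions.
Variables (R : realType) (d : nat).
Local Notation RT := (measurableTypeR R).
Local Notation X := (d.-tuple RT).
Implicit Types (f : 'rV[R]_d -> R) (i j : 'I_d).

Local Notation del i := (delta_mx ord0 i : 'rV[R]_d).

Lemma cvg_rV (T : Type) (F : set_system T) (FF : Filter F) (g : T -> 'rV[R]_d) (M : 'rV[R]_d) :
  (forall i, (fun x => g x ord0 i) @ F --> M ord0 i) -> g @ F --> M.
Proof.
move=> h A [P MP sPA]; rewrite /= nbhs_simpl /=.
have : \forall x \near F, forall i, P ord0 i (g x ord0 i).
  by apply: filter_forall => i; exact: (h i _ (MP ord0 i)).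
by apply: filterS => x H; apply: sPA => k i; rewrite (ord1 k).
Qed.

(** Links the topology of row vectors to the product sigma-algebra of tuples: f is the limit of its
    values at the grid points of mesh 1 / (N + 1), and each approximant is constant on countably
    many half-open boxes. *)
Lemma measurable_to_rV f : continuous f -> measurable_fun setT (f \o @to_rV R d : X -> R).
Proof.
move=> cf.
pose fl (N : nat) (t : R) : int := Num.floor (N.+1%:R * t).
pose app (N : nat) (z : {ffun 'I_d -> int}) : 'rV[R]_d := \row_i ((z i)%:~R / N.+1%:R).
pose zz N (x : X) : {ffun 'I_d -> int} := [ffun i => fl N (tnth x i)].
pose h N (x : X) := f (app N (zz N x)).
apply: (@measurable_fun_cvg _ _ _ _ h) => [N|x _].
  move=> _ B mB; rewrite setTI.
  rewrite (_ : _ @^-1` B =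
    \bigcup_(z : {ffun 'I_d -> int}) (if f (app N z) \in B then box (fun i => fl N @^-1` [set z i]) else set0)).
    apply: countable_bigcupT_measurable; first exact: countableP.
    move=> z; case: ifP => // _; apply: measurable_box => i.
    rewrite (_ : _ @^-1` _ = [set` `[(z i)%:~R / N.+1%:R, (z i + 1)%:~R / N.+1%:R[%R]).
      exact: measurable_itv.
    apply/seteqP; split => t /=; rewrite in_itv/= /fl ler_pdivrMr ?ltr_pdivlMr// mulrC.
      by move=> <-; exact: floor_itv.
    by move=> H; apply: floor_def.
  apply/seteqP; split => [x /= Bx|x [z _]].
    exists (zz N x) => //; rewrite mem_set//= => i; by rewrite /= ffunE.
  case: ifP => // /set_mem Bz H /=; rewrite /h (_ : zz N x = z)//.
  by apply/ffunP => i; rewrite ffunE; exact: H.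
apply: (@cvg_comp _ _ _ (fun N => app N (zz N x)) f); last exact: cf.
apply: cvg_rV => i.
rewrite (_ : (fun N => _) = fun N : nat => (fl N (tnth x i))%:~R / N.+1%:R); last first.
  by apply/funext => N; rewrite !mxE ffunE.
rewrite mxE; apply/cvgrPdist_le => e e0.
near=> N.
have N0 : 0 < N.+1%:R :> R by [].
have /andP[h1 h2] := floor_itv (N.+1%:R * tnth x i).
have -> : tnth x i - (fl N (tnth x i))%:~R / N.+1%:R =
   (N.+1%:R * tnth x i - (fl N (tnth x i))%:~R) / N.+1%:R by field.
rewrite ger0_norm; last by rewrite divr_ge0 ?(ltW N0)// subr_ge0.
apply: (@le_trans _ _ (N.+1%:R^-1)).
  rewrite ler_pdivrMr// mulVf ?gt_eqF// /fl lerBlDr addrC ltW//.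
  by move: h2; rewrite intrD.
apply/ltW; near: N; exact: (near_infty_natSinv_lt (PosNum e0)).
Unshelve. all: by end_near. Qed.

(** Turns the directional derivative into a one-variable one along a coordinate line, where
    [by_parts_test] applies. *)
Lemma partial_slice f (x : X) i (t : R) :
  derivable f (to_rV (upd x i t)) (del i) ->
  is_derive t 1 (fun s : R => f (to_rV (upd x i s))) (partial i f (to_rV (upd x i t))).
Proof.
have E (s : R) : to_rV (upd x i s) = (s - t) *: del i + to_rV (upd x i t).
  apply/rowP => j; rewrite !mxE !tnth_upd eqxx /=.
  by case: eqVneq => ji; rewrite ?mulr1 ?subrK// mulr0 add0r.
have EE : (fun h : R => h^-1 *: (f (to_rV (upd x i (h *: 1 + t))) - f (to_rV (upd x i t)))) =
          (fun h : R => h^-1 *: (f (h *: del i + to_rV (upd x i t)) - f (to_rV (upd x i t)))).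
  apply/funext => h; congr (_ *: (f _ - _)).
  by rewrite E /GRing.scale /= mulr1 addrK.
move=> df; split.
  by rewrite /derivable EE.
by rewrite /derive /partial /derive EE.
Qed.

Lemma smooth_partial j f : smooth f -> smooth (partial j f).
Proof. by move=> sf s; have := sf (rcons s j); rewrite foldr_rcons. Qed.

Lemma smooth_continuous f : smooth f -> continuous f.
Proof. by move=> /(_ [::])[]. Qed.

Lemma smooth_derivable f i x : smooth f -> derivable f x (del i).
Proof. by move=> /(_ [::])[_]; exact. Qed.

(** Off its closed support f vanishes on a neighbourhood, hence so does its derivative. *)
Lemma test_partial j f : test_function f -> test_function (partial j f).
Proof.
move=> [sf cf fO].
set K := closure _ in cf fO.
have K0 x : ~ K x -> partial j f x = 0.
  move=> xK; rewrite /partial (@near_eq_derive _ _ _ f (cst 0)) ?derive_cst//.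
  have : nbhs x (~` K) by apply: open_nbhs_nbhs; split => //; exact/closed_openC/closed_closure.
  apply: filterS => y yK; apply/eqP; apply: contrapT => /negP fy; apply: yK.
  exact: subset_closure.
have KS : closure [set x | partial j f x != 0] `<=` K.
  have /closure_id -> : closed K by exact: closed_closure.
  apply: closure_subset => x /= /eqP; apply: contra_notP; exact: K0.
split; first exact: smooth_partial.
- by apply: (subclosed_compact _ cf KS); exact: closed_closure.
- exact: subset_trans KS fO.
Qed.

Lemma test_bounded f : test_function f -> exists M, forall x, `|f x| <= M.
Proof.
move=> [sf cf _].
have [M [Mr HM]] := compact_bounded (continuous_compact (continuous_subspaceT (smooth_continuous sf)) cf).
exists (`|M| + 1) => x; have [/eqP fx|fx] := boolP (f x == 0).
  by rewrite fx normr0 addr_ge0.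
apply: (HM (`|M| + 1)); first by rewrite (le_lt_trans (ler_norm M))// ltrDl.
by exists x => //; exact: subset_closure.
Qed.

Lemma test_out f x : test_function f -> ~ Omega x -> f x = 0.
Proof.
move=> [_ _ fO] xO; apply/eqP; apply: contrapT => /negP fx; apply: xO; apply: fO.
exact: subset_closure.
Qed.

End TestFunctions.

(** * Symmetry of second derivatives *)

Section Schwarz.
Variables (R : realType) (d : nat).
Implicit Types (f : 'rV[R]_d -> R) (i j : 'I_d) (x a : 'rV[R]_d).

Local Notation del i := (delta_mx ord0 i : 'rV[R]_d).

Lemma partial_line f a i (s : R) : smooth f ->
  is_derive s 1 (fun t : R => f (t *: del i + a)) (partial i f (s *: del i + a)).
Proof.
move=> sf.
have EE : (fun h : R => h^-1 *: (f ((h *: 1 + s) *: del i + a) - f (s *: del i + a))) =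
          (fun h : R => h^-1 *: (f (h *: del i + (s *: del i + a)) - f (s *: del i + a))).
  by apply/funext => h; rewrite /GRing.scale /= mulr1 addrA -[in RHS]scalerDl.
have df : derivable f (s *: del i + a) (del i) := smooth_derivable sf.
split.
  by rewrite /derivable EE.
by rewrite /derive /partial /derive EE.
Qed.

Arguments partial_line {f} a i s.

Lemma MVT_line (u du : R -> R) (h : R) : 0 < h -> (forall s : R, is_derive s 1 u (du s)) ->
  exists2 c, 0 < c < h & u h - u 0 = du c * h.
Proof.
move=> h0 H.
have cu : {within `[0, h], continuous u}.
  by apply: continuous_subspaceT => s; exact: is_derive_continuous (H s).
have [c] := @MVT _ u du 0 h h0 (fun s _ => H s) cu.
by rewrite in_itv/= subr0 => ch E; exists c.
Qed.

(** The mean value theorem twice: first along i for the increment in direction j, then along j for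
    the partial derivative in i. *)
Lemma second_difference f x i j (h : R) : smooth f -> 0 < h ->
  exists c e, [/\ 0 < c < h, 0 < e < h &
    f (h *: del i + (h *: del j + x)) - f (h *: del i + x) - (f (h *: del j + x) - f x) =
    partial j (partial i f) (e *: del j + (c *: del i + x)) * h * h].
Proof.
move=> sf h0.
have [s|c ch E1] := @MVT_line (fun s => f (s *: del i + (h *: del j + x)) - f (s *: del i + x))
  (fun s => partial i f (s *: del i + (h *: del j + x)) - partial i f (s *: del i + x)) h h0.
  have h1 := partial_line (h *: del j + x) i s sf; have h2 := partial_line x i s sf.
  exact: (is_deriveB h1 h2).
have [s|e eh E2] := @MVT_line (fun t => partial i f (t *: del j + (c *: del i + x)))
  (fun t => partial j (partial i f) (t *: del j + (c *: del i + x))) h h0.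
  exact: partial_line (smooth_partial _ sf).
exists c, e; split => //; rewrite -E2 -[X in f (_ + _) - _ - (_ - f X)]add0r.
rewrite -(scale0r (del i)) -[in X in f X - f (0 *: _ + _)](add0r (h *: _ + x)).
rewrite -[X in f (X + (h *: _ + x)) - f (0 *: _ + _)](scale0r (del i)) E1.
by rewrite scale0r add0r addrCA.
Qed.

Arguments second_difference {f} x i j {h}.

Let mul_cancel2 (h p p' D1 D2 : R) : 0 < h -> D1 = D2 ->
  D1 = p * h * h -> D2 = p' * h * h -> p = p'.
Proof.
by move=> /gt_eqF/negbT h0 -> -> /(mulIf h0)/(mulIf h0).
Qed.

Let dist_half (e A B P Q : R) : P = Q -> `|B - P| < e / 2 -> `|A - Q| < e / 2 -> `|A - B| <= e.
Proof.
move=> -> B1 A1; rewrite -(subrK Q A) -addrA (le_trans (ler_normD _ _))//.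
by rewrite (splitr e) lerD// ltW// distrC.
Qed.

(** The second difference is symmetric in i and j, so the two mixed partials agree at two points
    within any given distance of x; continuity at x concludes. *)
Lemma partialC f i j : smooth f -> partial i (partial j f) = partial j (partial i f).
Proof.
move=> sf; apply/funext => x.
have c1 := smooth_continuous (smooth_partial i (smooth_partial j sf)).
have c2 := smooth_continuous (smooth_partial j (smooth_partial i sf)).
apply/eqP; rewrite -subr_eq0 -normr_le0; apply/ler_addgt0Pl => e e0; rewrite addr0.
have e2 : 0 < e / 2 by rewrite divr_gt0.
have N (g : 'rV[R]_d -> R) : continuous g -> nbhs x (fun y => `|g x - g y| < e / 2).
  by move=> /(_ x)/cvgrPdist_lt; apply.
have [r1 /= r10 H1] := (nbhs_ballP _ _).1 (N _ c1).
have [r2 /= r20 H2] := (nbhs_ballP _ _).1 (N _ c2).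
(* Half the radius, because both displacements add up in the same coordinate when i = j. *)
pose h := Num.min r1 r2 / 2.
have h0 : 0 < h by rewrite divr_gt0// lt_min r10.
have inb (r c b : R) (k l : 'I_d) : 2 * h <= r -> 0 < c < h -> 0 < b < h ->
    ball x r (b *: del l + (c *: del k + x)).
  move=> hr /andP[c0 ch] /andP[b0 bh]; split; first by lra.
  move=> p q; rewrite /ball /= !mxE.
  rewrite (_ : _ - _ = - (b * ((p == ord0) && (q == l))%:R + c * ((p == ord0) && (q == k))%:R)); last by ring.
  by rewrite normrN; do 2 case: (_ && _) => /=; rewrite ?mulr1 ?mulr0 ?addr0 ?add0r ger0_norm; lra.
have h2 : 2 * h = Num.min r1 r2 by rewrite /h; field.
have [c [b [ch bh E1]]] := second_difference x i j sf h0.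
have [c' [b' [ch' bh' E2]]] := second_difference x j i sf h0.
have E : partial j (partial i f) (b *: del j + (c *: del i + x)) =
           partial i (partial j f) (b' *: del i + (c' *: del j + x)).
  apply: (mul_cancel2 h0 _ E1 E2); rewrite (addrCA (h *: del j)).
  move: (f (_ + (_ + _))) (f (h *: del i + x)) (f (h *: del j + x)) (f x) => q r s t.
  ring.
have hr1 : 2 * h <= r1 by rewrite h2 ge_min lexx.
have hr2 : 2 * h <= r2 by rewrite h2 ge_min lexx orbT.
have K1 := H2 _ (inb _ _ _ i j hr2 ch bh); have K2 := H1 _ (inb _ _ _ j i hr1 ch' bh').
exact: dist_half E K1 K2.
Qed.

End Schwarz.

(** * Functions flat at the origin *)

Section FlatFunctions.
Variable R : realType.
Implicit Types (p q : {poly R}) (t x y : R).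

(** For p = 1 this is the classical smooth function exp(-1/t). Polynomials in 1/t make the family
    closed under derivation, through [dflat]. *)
Definition flat p t : R := if 0 < t then p.[t^-1] * expR (- t^-1) else 0.

Definition dflat p : {poly R} := 'X^2 * (p - p^`()).

(** With z = y / (n + 1): z ^ n <= (1 + z) ^ (n + 1) <= exp(z) ^ (n + 1) = exp(y). *)
Lemma pow_le_expR n : exists2 C, 0 <= C & forall y, 0 < y -> y ^+ n <= C * expR y.
Proof.
exists (n.+1%:R ^+ n); first exact: exprn_ge0.
move=> y y0; set z := y / n.+1%:R.
have z0 : 0 <= z by rewrite divr_ge0// ltW.
have -> : y = n.+1%:R * z by rewrite mulrC divfK.
rewrite exprMn ler_wpM2l ?exprn_ge0// expRM_natl.
apply: (@le_trans _ _ ((1 + z) ^+ n.+1)); last first.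
  by apply: lerXn2r; rewrite ?nnegrE ?expR_ge0 ?expR_ge1Dx// addr_ge0.
apply: (@le_trans _ _ ((1 + z) ^+ n)).
  by apply: lerXn2r; rewrite ?nnegrE ?addr_ge0// lerDr.
by apply: ler_weXn2l => //; rewrite lerDl.
Qed.

Lemma poly_le_expR p : exists2 C, 0 <= C & forall y, 0 < y -> `|p.[y]| <= C * expR y.
Proof.
suff [C C0 H] : exists2 C, 0 <= C &
    forall y, 0 < y -> `|\sum_(i < size p) p`_i * y ^+ i| <= C * expR y.
  by exists C => // y y0; rewrite horner_coef; exact: H.
elim: (size p) => [|n [C C0 IH]].
  by exists 0 => // y _; rewrite big_ord0 normr0 mul0r.
have [D D0 HD] := pow_le_expR n.
exists (C + `|p`_n| * D); first by rewrite addr_ge0// mulr_ge0.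
move=> y y0; rewrite big_ord_recr /= (le_trans (ler_normD _ _))// mulrDl lerD ?IH//.
by rewrite normrM -mulrA ler_wpM2l// ger0_norm ?exprn_ge0 ?HD// ltW.
Qed.

(** Quadratic decay is just what makes the derivative at 0 vanish. The factor t ^ 2 comes from
    bounding X ^ 2 p instead of p at 1/t. *)
Lemma flat_le p : exists2 C, 0 <= C & forall t, `|flat p t| <= C * t ^+ 2.
Proof.
have [C C0 H] := poly_le_expR ('X^2 * p); exists C => // t.
rewrite /flat; case: ifPn => [t0|_]; last by rewrite normr0 mulr_ge0// sqr_ge0.
have ti : 0 < t^-1 by rewrite invr_gt0.
have := H _ ti; rewrite hornerM hornerXn normrM normrX (gtr0_norm ti).
rewrite normrM expRN (@gtr0_norm _ (expR _)^-1) ?invr_gt0 ?expR_gt0//.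
move: (`|_|) (expR _) (expR_gt0 t^-1) => a e e_gt0 h.
rewrite ler_pdivrMr// -mulrA (mulrC (t ^+ 2)) mulrA -ler_pdivrMr ?exprn_gt0//.
by rewrite mulrC -exprVn.
Qed.

Lemma is_derive_flat p t : is_derive t 1 (flat p) (flat (dflat p) t).
Proof.
case: (ltgtP 0 t) => [t0|t0|<-].
- have dV : is_derive t 1 (fun y : R => y^-1) (- (t ^- 2)).
    apply: is_derive_eq; first by apply: is_deriveV; rewrite gt_eqF.
    by rewrite /GRing.scale /= mulr1.
  have dp : is_derive (t^-1) 1 (horner p) (p^`()).[t^-1].
    rewrite derivE derive1E; apply/derivableP; exact: derivable_horner.
  have h1 := is_derive1_comp dp dV.
  have h2 := @is_derive1_comp _ expR (- (fun y : R => y^-1)) t _ _ (is_derive_expR _) (is_deriveN dV).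
  apply: (near_eq_is_derive (f := (horner p \o (fun y : R => y^-1)) * (expR \o (- (fun y : R => y^-1))))).
    near=> y; rewrite /flat ifT//; near: y; exact: lt_nbhsr.
  apply: is_derive_eq (is_deriveM h1 h2) _.
  rewrite /flat t0 /dflat hornerM hornerXn hornerD hornerN /GRing.scale /=.
  rewrite -exprVn (_ : (- [eta GRing.inv]) t = - t^-1)//.
  by move: (expR (- t^-1)) (p.[t^-1]) ((p^`()%R).[t^-1]) (t^-1) => a b c e; ring.
- apply: (near_eq_is_derive (f := cst 0)).
    near=> y; rewrite /flat ifF//; apply/negbTE; rewrite -leNgt ltW//; near: y; exact: lt_nbhsl.
  by rewrite /flat ltNge (ltW t0) /=; exact: is_derive_cst.
(* Remaining case t = 0: the difference quotient is at most C |h|. *)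
have [C C0 H] := flat_le p.
have f0 : flat p 0 = 0 by rewrite /flat ltxx.
rewrite [X in is_derive _ _ _ X](_ : _ = 0); last by rewrite /flat ltxx.
have lim : h^-1 *: (flat p (h *: 1 + 0) - flat p 0) @[h --> 0^'] --> 0.
  have C1 : 0 < C + 1 by rewrite ltr_wpDl.
  apply/cvgrPdist_lt => e e0; near=> h.
  have h0 : h != 0 by near: h; exact: nbhs_dnbhs_neq.
  rewrite f0 subr0 addr0 sub0r normrN /GRing.scale /= mulr1 normrM normfV.
  rewrite mulrC ltr_pdivrMr ?normr_gt0//.
  apply: (le_lt_trans (H h)); rewrite -real_normK ?num_real// expr2 mulrA.
  rewrite ltr_pM2r ?normr_gt0//.
  apply: (@le_lt_trans _ _ ((C + 1) * `|h|)); first by rewrite ler_wpM2r// lerDl.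
  rewrite mulrC -ltr_pdivlMr//.
  near: h; apply: dnbhs0_lt; exact: divr_gt0.
split.
  by apply/cvg_ex; exists 0; exact: lim.
exact: cvg_lim lim.
Unshelve. all: by end_near. Qed.

(** With q fixed, finite sums of terms r(x) flat p (q(x)) are closed under derivation; the list
    holds the pairs (r, p), and [dflatcomb] is the product and chain rule on it. *)
Definition flatcomb q (L : seq ({poly R} * {poly R})) x : R :=
  \sum_(z <- L) z.1.[x] * flat z.2 q.[x].

Definition dflatcomb q (L : seq ({poly R} * {poly R})) :=
  flatten [seq [:: (z.1^`(), z.2); (z.1 * q^`(), dflat z.2)] | z <- L].

Lemma is_derive_flatcomb q L x :
  is_derive x 1 (flatcomb q L) (flatcomb q (dflatcomb q L) x).
Proof.
elim: L => [|[r p] L IH].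
  have -> : flatcomb q [::] = cst 0 by apply/funext => y; rewrite /flatcomb big_nil.
  exact: is_derive_cst.
have -> : flatcomb q ((r, p) :: L) = (horner r * (flat p \o horner q)) + flatcomb q L.
  by apply/funext => y; rewrite /flatcomb big_cons.
have dp (s : {poly R}) y : is_derive y 1 (horner s) (s^`()).[y].
  rewrite derivE derive1E; apply/derivableP; exact: derivable_horner.
have h := is_deriveD (is_deriveM (dp r x) (is_derive1_comp (is_derive_flat p q.[x]) (dp q x))) IH.
apply: is_derive_eq h _.
rewrite [in RHS]/flatcomb /= !big_cons /= -/(flatcomb q (dflatcomb q L) x) addrA hornerM.
congr (_ + _); rewrite /GRing.scale /=.
move: (r.[x]) ((r^`()%R).[x]) ((q^`()%R).[x]) (flat (dflat p) _) (flat p _) => a b c e f; ring.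
Qed.

Lemma flat1_ge0 t : 0 <= flat 1 t.
Proof. by rewrite /flat; case: ifP => // _; rewrite hornerC mul1r expR_ge0. Qed.

Lemma flat1_le1 t : flat 1 t <= 1.
Proof.
rewrite /flat; case: ifP => // t0; rewrite hornerC mul1r expRN invf_le1 ?expR_gt0//.
by rewrite (le_trans _ (expR_ge1Dx _))// lerDl invr_ge0 ltW.
Qed.

End FlatFunctions.

(** * Product bumps supported in the open cube *)

Section ProductBumps.
Variables (R : realType) (d : nat).
Local Notation RT := (measurableTypeR R).
Local Notation del i := (delta_mx ord0 i : 'rV[R]_d).

Section TensorSmooth.
Variable F : 'I_d -> nat -> R -> R.
Hypothesis dF : forall i n (t : R), is_derive t 1 (F i n) (F i n.+1 t).

(** [F i n] is the n-th derivative of the i-th factor, so every iterated partial of a [tens] is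
    again a [tens], with another multi-index. *)
Definition tens (m : 'I_d -> nat) (v : 'rV[R]_d) : R := \prod_(i < d) F i (m i) (v ord0 i).

Let bump_ord (j : 'I_d) (m : 'I_d -> nat) (i : 'I_d) : nat := if i == j then (m i).+1 else m i.

Let tens_derive (m : 'I_d -> nat) j v : is_derive v (del j) (tens m) (tens (bump_ord j m) v).
Proof.
pose c := \prod_(i < d | i != j) F i (m i) (v ord0 i).
have E (h : R) : tens m (h *: del j + v) = c * F j (m j) (h + v ord0 j).
  rewrite /tens (bigD1 j)//= mulrC !mxE !eqxx mulr1; congr (_ * _).
  by apply: eq_bigr => i /negbTE ij; rewrite !mxE ij /= mulr0 add0r.
have E0 : tens m v = c * F j (m j) (v ord0 j).
  by rewrite -[v in LHS]add0r -(scale0r (del j)) E add0r.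
have EE : (fun h : R => h^-1 *: (tens m (h *: del j + v) - tens m v)) =
  (fun h : R => c *: (h^-1 *: (F j (m j) (h *: 1 + v ord0 j) - F j (m j) (v ord0 j)))).
  apply/funext => h; rewrite E E0 /GRing.scale /= mulr1 -mulrBr mulrCA.
  by [].
have [dv Dv] := dF j (m j) (v ord0 j).
have lim : (fun h : R => h^-1 *: (tens m (h *: del j + v) - tens m v)) @ 0^' -->
    c * F j (m j).+1 (v ord0 j).
  rewrite EE; apply: cvgM; first exact: cvg_cst.
  by rewrite -Dv; exact: dv.
have -> : tens (bump_ord j m) v = c * F j (m j).+1 (v ord0 j).
  rewrite /tens (bigD1 j)//= mulrC /bump_ord eqxx; congr (_ * _).
  by apply: eq_bigr => i /negbTE ->.
split; last exact: cvg_lim lim.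
by apply/cvg_ex; eexists; exact: lim.
Qed.

Lemma smooth_tens m : smooth (tens m).
Proof.
move=> s; have [m' ->] : exists m', foldr (@partial R d) (tens m) s = tens m'.
  elim: s => [|j s [m' IH]] /=; first by exists m.
  exists (bump_ord j m'); rewrite IH; apply/funext => v.
  by have [_] := tens_derive m' j v.
split; last by move=> i v; have [] := tens_derive m' i v.
rewrite /tens; elim: (index_enum _) => [|i r IH] v.
  rewrite (_ : (fun v => _) = cst 1); first exact: cst_continuous.
  by apply/funext => u; rewrite big_nil.
rewrite (_ : (fun v => _) = (F i (m' i) \o (fun u : 'rV[R]_d => u ord0 i)) \*
  (fun u => \prod_(i <- r) F i (m' i) (u ord0 i))); last by apply/funext => u; rewrite big_cons.
apply: continuousM; last exact: IH.
apply: continuous_comp; first exact: coord_continuous.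
exact: is_derive_continuous (dF i (m' i) (v ord0 i)).
Qed.

End TensorSmooth.

(** Positive at most on the open interval; the test a < b is needed because the product is also
    positive between b and a when b < a. The factor k drives [flat 1] of it to 1 inside. *)
Definition bumpq (k : nat) (a b : R) : {poly R} :=
  if a < b then k%:R *: (('X - a%:P) * (b%:P - 'X)) else 0.

Lemma bumpq_gt0 k a b x : (0 < (bumpq k a b).[x]) -> a < x < b.
Proof.
rewrite /bumpq; case: ifP => ab; last by rewrite horner0 ltxx.
rewrite hornerZ; case: k => [|k]; first by rewrite mul0r ltxx.
rewrite pmulr_rgt0// !hornerE => h; apply/andP; split; rewrite ltNge; apply/negP => xx.
  have : (x - a) * (b - x) <= 0 by rewrite mulr_le0_ge0//; lra.
  by rewrite leNgt h.
have : (x - a) * (b - x) <= 0 by rewrite mulr_ge0_le0//; lra.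
by rewrite leNgt h.
Qed.

Definition bump k (a b : R) (x : R) : R := flat 1 (bumpq k a b).[x].

Definition bumps k (a b : 'I_d -> R) (v : 'rV[R]_d) : R := \prod_(i < d) bump k (a i) (b i) (v ord0 i).

Lemma test_bumps k (a b : 'I_d -> R) : (forall i, 0 < a i) -> (forall i, b i < 1) ->
  test_function (bumps k a b).
Proof.
move=> a0 b1.
pose F i n := flatcomb (bumpq k (a i) (b i)) (iter n (dflatcomb (bumpq k (a i) (b i))) [:: (1, 1)]).
have dF i n (t : R) : is_derive t 1 (F i n) (F i n.+1 t) by exact: is_derive_flatcomb.
have E : bumps k a b = tens F (fun=> 0%N).
  apply/funext => v; apply: eq_bigr => i _.
  by rewrite /F /flatcomb /= big_seq1 /= hornerC mul1r.
pose K := [set v : 'rV[R]_d | forall i, v ord0 i \in `[a i, b i]].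
have cK : compact K.
  by apply: (@rV_compact _ _ (fun i => `[a i, b i]%classic)) => i; exact: segment_compact.
have hK : closed K.
  rewrite (_ : K = \bigcap_i ((fun v : 'rV[R]_d => v ord0 i) @^-1` `[a i, b i]%classic)).
    apply: closed_bigI => i _; apply: preimage_closed; last exact: itv_closed.
    by move=> v _; exact: coord_continuous.
  by apply/seteqP; split => v H i; [move=> _; exact: H|exact: H].
have SK : closure [set v | bumps k a b v != 0] `<=` K.
  have /closure_id -> := hK; apply: closure_subset => v /= vN i.
  have : bump k (a i) (b i) (v ord0 i) != 0.
    by apply: contra_neq vN => v0; rewrite /bumps (bigD1 i)//= v0 mul0r.
  rewrite /bump /flat; case: ifPn => [/bumpq_gt0/andP[av vb] _|_ /eqP//].
  by rewrite in_itv/= !ltW.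
split.
- by rewrite E; exact: smooth_tens.
- by apply: subclosed_compact cK SK; exact: closed_closure.
- move=> v /SK H i; have := H i; rewrite in_itv/= => /andP[av vb].
  by rewrite (lt_le_trans (a0 i) av) (le_lt_trans vb (b1 i)).
Qed.

Lemma bump_cvg (a : R) (x : R) :
  (fun k : nat => bump k (Num.max a k.+2%:R^-1) (1 - k.+2%:R^-1) x) @ \oo -->
  ((Num.max a 0 < x < 1)%R%:R : R).
Proof.
have kinv (e : R) : 0 < e -> \forall k \near \oo, k.+2%:R^-1 < e.
  move=> e0; have := near_infty_natSinv_lt (PosNum e0).
  move=> [N _ HN]; exists N => // k /= Nk; apply: (HN k.+1) => /=; exact: leqW.
case: (boolP (Num.max a 0 < x < 1)) => [/andP[]|xN]; last first.
  apply: cvg_near_cst; apply: nearW => k; rewrite /bump /flat; case: ifPn => // /bumpq_gt0.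
  rewrite gt_max => /andP[/andP[ax kx] xk]; case/negP: xN.
  have k0 : 0 < k.+2%:R^-1 :> R by rewrite invr_gt0.
  by rewrite gt_max ax (lt_trans k0 kx) (lt_trans xk)// ltrBlDr ltrDl.
rewrite gt_max => /andP[ax x0] x1.
(* Once 1 / (k + 2) < e, the distances from x to the two ends of the bump are at least min(x - a, e)
   and e; their product is [c]. *)
pose e := Num.min (x / 2) ((1 - x) / 2).
have e0 : 0 < e by rewrite lt_min; apply/andP; split; lra.
pose c := Num.min (x - a) e * e.
have c0 : 0 < c by rewrite mulr_gt0// lt_min e0 subr_gt0 ax.
apply/cvgrPdist_lt => r r0.
near=> k.
have ke : k.+2%:R^-1 < e by near: k; exact: kinv.
have k0 : (0 < k)%N by near: k; exact: nbhs_infty_gt.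
have [ex e1] : e <= x / 2 /\ e <= (1 - x) / 2 by split; rewrite /e ge_min lexx ?orbT.
move: (k.+2%:R^-1 : R) ke => y ye.
have qc : k%:R * c <= (bumpq k (Num.max a y) (1 - y)).[x].
  rewrite /bumpq ifT; last by rewrite gt_max; apply/andP; split; lra.
  rewrite hornerZ ler_pM2l ?ltr0n// !hornerE; apply: ler_pM.
  - by rewrite le_min (ltW e0) subr_ge0 ltW.
  - exact: ltW.
  - by case: (leP a y) => _; rewrite ge_min; apply/orP; [right|left]; lra.
  - lra.
have kc : 0 < k%:R * c by rewrite mulr_gt0// ltr0n.
rewrite /bump /flat (lt_le_trans kc qc) hornerC mul1r.
rewrite ger0_norm; last first.
  by rewrite subr_ge0 expRN invf_le1 ?expR_gt0// (le_trans _ (expR_ge1Dx _))// lerDl invr_ge0 ltW// (lt_le_trans kc qc).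
have kr : (r * c)^-1 < k%:R by near: k; exact: nbhs_infty_gtr.
have : (k%:R * c)^-1 < r.
  by rewrite -[ltRHS]invrK ltf_pV2 ?posrE ?invr_gt0// -ltr_pdivrMr// -invfM.
apply: le_lt_trans.
set q := (bumpq _ _ _).[x] in qc *.
apply: (@le_trans _ _ q^-1); last by rewrite lef_pV2// posrE (lt_le_trans kc qc).
(* exp(-1/q) >= 1 - 1/q, while 1/q is at most 1 / (k c), below the tolerance. *)
by rewrite lerBlDr addrC -lerBlDr; exact: expR_ge1Dx.
Unshelve. all: by end_near. Qed.

End ProductBumps.

(** * Functions orthogonal to all test functions *)

Section DuBoisReymond.
Variables (R : realType) (d : nat).
Local Notation RT := (measurableTypeR R).
Local Notation X := (d.-tuple RT).
Local Notation cube := (@lebesgue_cube R d).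
Local Notation ray a := (`]a, +oo[%classic : set RT).

Lemma measurable_test (phi : 'rV[R]_d -> R) : test_function phi ->
  measurable_fun setT (fun x : X => phi (to_rV x)).
Proof. by move=> [sphi _ _]; exact: measurable_to_rV (smooth_continuous sphi). Qed.

Lemma L2_test (phi : 'rV[R]_d -> R) : test_function phi ->
  (fun x : X => phi (to_rV x)) \in Lfun cube 2%:E.
Proof.
move=> tphi; have [M HM] := test_bounded tphi.
exact: (L2_bounded _ (measurable_test tphi) (fun x => HM _)).
Qed.

(** Products of rays are stable under intersection and generate: a one-coordinate ray is the
    countable union of such products whose other sides start at -n. *)
Lemma measurable_tuple_rays :
  @measurable _ X = <<s [set box (fun i => ray (a i)) | a in [set: 'I_d -> R]] >>.
Proof.
set G := [set _ | _ in _]; apply/seteqP; split; last first.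
  apply: smallest_sub; first exact: sigma_algebra_measurable.
  by move=> _ [a _ <-]; apply: measurable_box => i; exact: measurable_itv.
apply: smallest_sub; first exact: smallest_sigma_algebra.
move=> B; rewrite -bigcup_seq => -[i /= _ [A mA <-]]; rewrite setTI.
have rayi (c : R) : <<s G >> ((fun x : X => tnth x i) @^-1` ray c).
  rewrite (_ : _ @^-1` _ = \bigcup_(n : nat) box (fun j => ray (if j == i then c else - n%:R))).
    by apply: sigma_algebra_bigcup => n; apply: sub_sigma_algebra; eexists.
  apply/seteqP; split => [x /= xc|x [n _] /(_ i)]; last by rewrite eqxx.
  pose M : R := \big[Num.max/0]_(j < d) `|tnth x j|.
  have [n Mn] : exists n : nat, M < n%:R.
    by exists (Num.truncn M).+1; rewrite truncnS_gt.
  exists n => // j; case: eqP => [->//|_] /=; rewrite in_itv/= andbT.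
  rewrite ltrNl (le_lt_trans _ Mn)// (le_trans (ler_norm _))// normrN.
  by rewrite /M; exact: (le_bigmax _ (fun j => `|tnth x j|)).
suff : @measurable _ RT `<=` [set A | <<s G >> ((fun x : X => tnth x i) @^-1` A)] by apply.
rewrite [X in X `<=` _](RGenOInfty.measurableE R).
apply: smallest_sub; last by move=> _ [c ->]; exact: rayi.
split => [|C /= GC|F /= GF].
- by rewrite /= preimage_set0; exact: sigma_algebra0.
- by rewrite /= setTD preimage_setC; exact: sigma_algebraC.
- by rewrite /= preimage_bigcup; exact: sigma_algebra_bigcup.
Qed.

(** Bumps increase to boxes inside the open cube, so [h] has integral 0 over every product of rays,
    hence over every measurable set by a Dynkin argument. *)
Lemma test_vanish_ae (h : X -> R) : h \in Lfun cube 2%:E ->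
  (forall phi, test_function phi -> \int[cube]_x (h x * phi (to_rV x)) = 0) ->
  h = (fun=> 0) %[ae cube].
Proof.
move=> hL h0; have ih := L2_integrable hL.
have mh := L2_measurable hL.
pose chi (a : 'I_d -> R) (x : X) : R := \prod_(i < d) (Num.max (a i) 0 < tnth x i < 1)%R%:R.
have step1 a : (\int[cube]_x (h x * chi a x)%:E = 0)%E.
  pose bk k i := Num.max (a i) k.+2%:R^-1.
  pose phi (k : nat) := bumps k (bk k) (fun=> 1 - k.+2%:R^-1).
  have tphi k : test_function (phi k).
    apply: test_bumps => i; first by rewrite lt_max invr_gt0 ltr0n orbT.
    by rewrite ltrBlDr ltrDl invr_gt0.
  pose f_ k (x : X) := h x * phi k (to_rV x).
  have phi1 k v : `|phi k v| <= 1.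
    suff /andP[p0 p1] : 0 <= phi k v <= 1 by rewrite ger0_norm.
    apply: (big_ind (fun p => 0 <= p <= 1)); first by rewrite ler01 lexx.
      by move=> p q /andP[p0 p1] /andP[q0 q1]; rewrite mulr_ge0//= mulr_ile1.
    by move=> i _; rewrite flat1_ge0 flat1_le1.
  apply: (@Rintegral_dominated0 _ _ _ cube f_ _ h) => // [k|k x|x|k].
  - by apply: measurable_funM => //; exact: measurable_test (tphi k).
  - by rewrite normrM ler_piMr.
  - apply: cvgM; first exact: cvg_cst.
    rewrite /phi /bumps /chi; elim: (index_enum _) => [|i r IH].
      under eq_fun do rewrite big_nil.
      by rewrite big_nil; exact: cvg_cst.
    under eq_fun do rewrite big_cons.
    rewrite big_cons; apply: cvgM; last exact: IH.
    by rewrite mxE; exact: bump_cvg.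
  - exact: h0.
have ae01 : {ae cube, forall x : X, forall i, 0 < tnth x i < 1}.
  by apply: filter_forall => i; exact: (@ae_coord R d i (fun t : R => 0 < t < 1) (lam_ae01 R)).
have mhE : measurable_fun setT (fun x => (h x)%:E) by exact/measurable_EFinP.
have step2 a : (\int[cube]_(x in box (fun i => ray (a i))) (h x)%:E = 0)%E.
  have mb : measurable (box (fun i => ray (a i))).
    by apply: measurable_box => i; exact: measurable_itv.
  rewrite integral_mkcond -[RHS](step1 a); apply: ae_eq_integral => //.
  - by apply/(measurable_restrictT _ mb); exact: measurable_funTS.
  - apply/measurable_EFinP/measurable_funM => //.
    rewrite /chi; apply: measurable_prod => i _.
    rewrite (_ : (fun x => _) = (\1_`](Num.max (a i) 0), 1[ : RT -> R) \o (fun x : X => tnth x i)).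
      apply: measurableT_comp; last exact: measurable_tnth.
      by apply: measurable_indic; exact: measurable_itv.
    by apply/funext => x /=; rewrite indicE mem_setE in_itv.
  apply: filterS ae01 => x x01 _; rewrite patchE /chi; case: ifPn => [/set_mem xa|/negP xa].
    rewrite big1 ?mulr1// => i _; have := xa i; rewrite /= in_itv/= andbT gt_max => ->.
    by have /andP[-> ->] := x01 i.
  have [i xi] : exists i, ~~ (a i < tnth x i).
    apply: contrapT => H; apply: xa; rewrite inE => i /=; rewrite in_itv/= andbT.
    by apply: contrapT => /negP xi; apply: H; exists i.
  by rewrite (bigD1 i)//= gt_max (negbTE xi) /= mul0r mulr0.
(* Needed for complements in the Dynkin argument; rays from -1 cover almost all of the cube. *)
have stepT : (\int[cube]_x (h x)%:E = 0)%E.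
  rewrite -[RHS](step2 (fun=> -1)) [RHS]integral_mkcond; apply: ae_eq_integral => //.
    have mb : measurable (box (fun i : 'I_d => ray (-1))).
      by apply: measurable_box => i; exact: measurable_itv.
    by apply/(measurable_restrictT _ mb); exact: measurable_funTS.
  apply: filterS ae01 => x x01 _; rewrite patchE mem_set// => i /=; rewrite in_itv/= andbT.
  by have /andP[x0 _] := x01 i; rewrite (lt_trans _ x0)// ltrN10.
pose P (A : set X) := (\int[cube]_(x in A) (h x)%:E = 0)%E.
have PA A : measurable A -> P A.
  rewrite measurable_tuple_rays => mA.
  apply: (dynkin_induction measurable_tuple_rays _ _ _ _ _ mA) => //.
  - move=> _ _ [a _ <-] [b _ <-]; exists (fun i => Num.max (a i) (b i)) => //.
    rewrite setI_box; congr box; apply/funext => i; apply/seteqP; split => t /=; rewrite !in_itv/= !andbT gt_max.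
      by move=> /andP[].
    by move=> [-> ->].
  - by move=> _ [a _ <-]; exact: step2.
  - move=> S mS PS; move: stepT; rewrite -(setUv S) integral_setU_EFin//.
    + by rewrite -/(P S) PS add0e.
    + exact: measurableC.
    + by rewrite setUv; exact/measurable_EFinP.
    + exact/disj_setPCl.
  - move=> F mF tF PF; rewrite /P integral_bigcup//.
      by rewrite eseries0// => i _ _; exact: PF.
    by apply: integrableS ih => //; exact: bigcup_measurable.
have := @integral_ae_eq _ _ _ cube setT measurableT (cst 0%E) (EFin \o h) ih (measurable_cst _).
move=> H; have {H} : ae_eq cube setT (EFin \o h) (cst 0%E).
  by apply: H => E _ mE; rewrite integral0; exact: PA.
by apply: filterS => x /= H _; have [] := H I.
Qed.

End DuBoisReymond.

(** * Wavelet spaces *)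

Section DyadicCells.
Variable R : realType.
Local Notation RT := (measurableTypeR R).
Local Notation lam := (@lebesgue01 R).
Local Notation L2 := (Lfun lam 2%:E).

(** Cells are closed and overlap at nodes; off this null set each point lies in exactly one cell,
    numbered [idx m x]. *)
Definition offnodes (m : nat) (x : R) := 0 < x < 1 /\ forall i, x <> node R m i.

Lemma lam_set1 (s : R) : lam [set s] = 0%E.
Proof.
apply/eqP; rewrite eq_le measure_ge0 andbT.
rewrite /lebesgue01 /mrestr -(lebesgue_measure_set1 s); apply: le_measure => //.
  by rewrite inE; apply: measurableI => //; exact: measurable_itv.
by rewrite inE.
Qed.

Lemma ae_offnodes m : {ae lam, forall x : RT, offnodes m x}.
Proof.
have H : {ae lam, forall x : RT, forall i, x <> node R m i}.
  apply/ae_foralln => i.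
  exists [set node R m i]; split; [exact: measurable_set1|exact: lam_set1|].
  by move=> x /= /contrapT.
by apply: filterS2 (lam_ae01 R) H => x.
Qed.

Definition idx (m : nat) (x : R) : nat := Num.truncn (2 ^+ m * x).

Lemma nodeE m j : node R m j = j%:R / 2 ^+ m.
Proof. by rewrite /node natrX. Qed.

Lemma idx_itv m x : 0 < x -> (idx m x)%:R <= 2 ^+ m * x < (idx m x).+1%:R.
Proof. by move=> x0; apply: truncn_itv; rewrite mulr_ge0 ?exprn_ge0// ltW. Qed.

Lemma cell_idx m j x : offnodes m x -> cell m j x <-> j = idx m x.
Proof.
move=> [/andP[x0 x1] xN]; have p0 : 0 < 2 ^+ m :> R by rewrite exprn_gt0.
have := idx_itv m x0; rewrite /cell /= in_itv /= !nodeE ler_pdivrMr// ler_pdivlMr// (mulrC x).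
move=> h; split => [/andP[jx xj]|->]; last by have /andP[-> /ltW ->] := h.
apply/esym/truncn_def; rewrite jx lt_def xj andbT; apply/eqP => E.
by apply: (xN j.+1); rewrite nodeE E mulrC mulKf// gt_eqF.
Qed.

Lemma idx_lt m x : 0 < x < 1 -> (idx m x < 2 ^ m)%N.
Proof.
move=> /andP[x0 x1]; have /andP[h _] := idx_itv m x0.
rewrite -(ltr_nat R) (le_lt_trans h)// natrX gtr_pMr// exprn_gt0//.
Qed.

Lemma half_itv (n : nat) (y : R) : n%:R <= 2 * y < n.+1%:R ->
  n./2%:R <= y < n./2.+1%:R.
Proof.
have nE : n%:R = (odd n)%:R + 2 * n./2%:R :> R.
  by rewrite -[in LHS](odd_double_half n) natrD -mul2n natrM.
have o1 : (0 <= (odd n)%:R :> R) && ((odd n)%:R <= 1 :> R) by case: (odd n); rewrite /= ?lexx ?ler01.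
rewrite -(natr1 n) -(natr1 n./2) nE; move: (n./2%:R) ((odd n)%:R) o1 => a b.
by move=> /andP[b0 b1] /andP[h1 h2]; apply/andP; split; lra.
Qed.

Lemma idxS m x : 0 < x -> (idx m.+1 x)./2 = idx m x.
Proof.
move=> x0; apply/esym/truncn_def; apply: half_itv.
by rewrite mulrA -exprS; exact: idx_itv.
Qed.

Lemma offnodesS m x : offnodes m.+1 x -> offnodes m x.
Proof.
move=> [x01 xN]; split => // i E; apply: (xN (2 * i)%N); rewrite E !nodeE natrM exprS.
by rewrite -mulf_div divff ?mul1r.
Qed.

(** The halves of cell j are numbered 2 j and 2 j + 1, so the parent of a cell is found by halving
    its number. *)
Lemma cellS m j i x : offnodes m.+1 x -> cell m.+1 i x -> (cell m j x <-> i./2 = j).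
Proof.
move=> xN /(cell_idx _ xN) ->; have xN' := offnodesS xN.
have x0 : 0 < x by have [/andP[]] := xN.
by rewrite idxS//; split => [/(cell_idx _ xN')|<-]; [|exact/(cell_idx _ xN')].
Qed.

Lemma measurable_cell m j : measurable (cell m j : set RT).
Proof. exact: measurable_itv. Qed.

Lemma measurable_horner (p : {poly R}) : measurable_fun setT (fun x : RT => p.[x]).
Proof. by apply: continuous_measurable_fun; exact: continuous_horner. Qed.

(** A polynomial is unbounded on R, so it is first cut off outside (0,1), where [lam] lives. *)
Lemma L2_poly (p : {poly R}) : (fun x : RT => p.[x]) \in L2.
Proof.
have /(EVT_max ler01)[c _ Hc] : {within `[0, 1], continuous (fun x => `|p.[x]|)}.
  apply: continuous_subspaceT => x; apply: cvg_norm; exact: continuous_horner.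
have mp := measurable_horner p.
have mi : measurable_fun setT (\1_(`]0, 1[%classic : set RT) : RT -> R).
  by apply: measurable_indic; exact: measurable_itv.
apply: (L2_ae mp (g := fun x : RT => p.[x] * \1_(`]0, 1[%classic : set RT) x)).
  apply: (@L2_bounded _ _ _ _ _ `|p.[c]|); first exact: measurable_funM.
  move=> x; rewrite indicE mem_setE normrM.
  case: (boolP (x \in _)) => x01; rewrite ?normr1 ?mulr1 ?normr0 ?mulr0//.
  by apply: Hc; move: x01; rewrite !in_itv/= => /andP[x0 x1]; rewrite !ltW.
by apply: filterS (lam_ae01 R) => x x01 _; rewrite indicE mem_setE in_itv/= x01 mulr1.
Qed.

End DyadicCells.

(** * Wavelets cell by cell *)

Section OneDimSpaces.
Variables (R : realType) (k : nat).
Local Notation RT := (measurableTypeR R).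
Local Notation lam := (@lebesgue01 R).
Local Notation L2 := (Lfun lam 2%:E).
Variable psi : nat -> nat -> nat -> RT -> R.
Hypothesis hpsi : is_orthonormal_wavelets k psi.

Lemma Qspace_L2 m (q : RT -> R) : Qspace k m q -> q \in L2.
Proof. by case. Qed.

Lemma Zspace_L2 m (q : RT -> R) : Zspace k m q -> q \in L2.
Proof. by case: m => [|m]; [exact: Qspace_L2|case=> + _; exact: Qspace_L2]. Qed.

Lemma Qspace_lin m N (c : 'I_N -> R) (g : 'I_N -> RT -> R) :
  (forall i, Qspace k m (g i)) -> Qspace k m (fun x => \sum_(i < N) c i * g i x).
Proof.
move=> hg; split; first by apply: L2_sum => i _; apply: L2Z; exact: Qspace_L2 (hg i).
move=> j jm; have /choice[p hp] : forall i, exists p : {poly R}, polyle k p /\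
    {ae lam, forall x : RT, cell m j x -> g i x = p.[x]}.
  by move=> i; have [_ /(_ j jm)[p ? ?]] := hg i; exists p.
exists (\sum_(i < N) c i *: p i).
  apply: (big_ind (@polyle R k)); first by rewrite /polyle /= size_poly0.
    by move=> a b ha hb; rewrite /polyle /= (leq_trans (size_polyD _ _))// geq_max; apply/andP.
  by move=> i _; rewrite /polyle /= (leq_trans (size_scale_leq _ _))//; exact: (hp i).1.
have H : {ae lam, forall x : RT, forall i, cell m j x -> g i x = (p i).[x]}.
  by apply: filter_forall => i; exact: (hp i).2.
apply: (lam_aeS H) => x Hx xj; rewrite horner_sum; apply: eq_bigr => i _.
by rewrite hornerZ Hx.
Qed.

Lemma Zspace_lin m N (c : 'I_N -> R) (g : 'I_N -> RT -> R) :
  (forall i, Zspace k m (g i)) -> Zspace k m (fun x => \sum_(i < N) c i * g i x).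
Proof.
case: m => [|m] hg; first exact: Qspace_lin.
split; first by apply: Qspace_lin => i; have [] := hg i.
move=> f hf; rewrite -[LHS]/(ip lam _ f) ip_suml; last 2 first.
- by move=> i _; apply: L2Z; exact: Zspace_L2 (hg i).
- exact: Qspace_L2 hf.
rewrite big1// => i _; rewrite ipZl; [|exact: Zspace_L2 (hg i)|exact: Qspace_L2 hf].
by have [_ /(_ f hf) h] := hg i; rewrite /ip h mulr0.
Qed.

Lemma L2_indic_cell m j (q : RT -> R) : q \in L2 -> (fun x => q x * \1_(cell m j) x) \in L2.
Proof.
move=> hq; apply: (@L2_mul_bounded _ _ _ _ _ _ 1) => //.
  by apply: measurable_indic; exact: measurable_cell.
by move=> x; rewrite indicE; case: (x \in _); rewrite ?normr1 ?normr0.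
Qed.

Lemma Qspace_poly_cell m j (p : {poly R}) : polyle k p ->
  Qspace k m (fun x => p.[x] * \1_(cell m j) x).
Proof.
move=> hp; split; first exact: L2_indic_cell (L2_poly p).
move=> i im; have [->|ij] := eqVneq i j.
  by exists p => //; apply: aeW => x xj; rewrite indicE mem_set// mulr1.
exists 0; first by rewrite /polyle /= size_poly0.
apply: (lam_aeS (ae_offnodes R m)) => x xN /(cell_idx _ xN) xi.
rewrite horner0 indicE memNset ?mulr0// => /(cell_idx _ xN) xj.
by move: ij; rewrite xi xj eqxx.
Qed.

(** Orthogonality to polynomials on the cell is orthogonality of [q] to their cut-offs, which belong
    to the coarser space Q_m. *)
Lemma ZKspace_restrict m j (q : RT -> R) : (j < 2 ^ m)%N -> Zspace k m.+1 q ->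
  ZKspace k m j (fun x => q x * \1_(cell m j) x).
Proof.
move=> jm [[hq Hq] oq]; split.
- exact: L2_indic_cell.
- by apply: aeW => x xj; rewrite indicE memNset ?mulr0.
- move=> i ij; have i2 : i./2 = j.
    by move: ij; rewrite !inE => /orP[] /eqP ->; rewrite mul2n ?doubleK//; exact: half_bit_double j true.
  have im : (i < 2 ^ m.+1)%N.
    rewrite expnS mul2n -(odd_double_half i) i2.
    by case: (odd i); rewrite ?add1n ?add0n ?ltn_Sdouble ?ltn_double.
  have [p hp Hp] := Hq i im; exists p => //.
  apply: (lam_aeS2 Hp (ae_offnodes R m.+1)) => x Hpx xN xi.
  by rewrite indicE mem_set ?mulr1 ?Hpx//; apply/(cellS _ xN xi).
- move=> p hp; rewrite -[RHS](oq _ (Qspace_poly_cell m j hp)) [LHS]Rintegral_mkcond.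
  apply: eq_Rintegral => x _; rewrite patchE indicE.
  by case: (x \in _); rewrite /= ?mulr1 ?mulr0// ?mul0r.
Qed.

Lemma cell_partition m (x : R) : offnodes m x -> \sum_(j < 2 ^ m) \1_(cell m j) x = 1 :> R.
Proof.
move=> xN; have [x01 _] := xN.
rewrite (bigD1 (Ordinal (idx_lt m x01)))//= indicE mem_set; last exact/(cell_idx _ xN).
rewrite big1 ?addr0// => i ij; rewrite indicE memNset// => /(cell_idx _ xN) E.
by move/eqP: ij; apply; apply: val_inj.
Qed.

(** The indicators of the cells add up to 1 almost everywhere, and each restriction expands in the
    wavelets of its cell. *)
Lemma Zspace_wavelets m (q : RT -> R) : Zspace k m.+1 q ->
  exists c : 'I_(2 ^ m) -> nat -> R,
  q = (fun x => \sum_(j < 2 ^ m) \sum_(r < k.+1) c j r * psi m.+1 j r x) %[ae lam].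
Proof.
move=> hq; have H (j : 'I_(2 ^ m)) : exists c : nat -> R,
   (fun x => q x * \1_(cell m j) x) = (fun x => \sum_(r < k.+1) c r * psi m.+1 j r x) %[ae lam].
  have [_ _ h] := @hpsi m.+1 j (ltn0Sn m) (ltn_ord j).
  exact: h (ZKspace_restrict (ltn_ord j) hq).
have [c hc] := choice H; exists c.
have Hc : {ae lam, forall x : RT, forall j : 'I_(2 ^ m),
    q x * \1_(cell m j) x = \sum_(r < k.+1) c j r * psi m.+1 j r x}.
  by apply: filter_forall => j; apply: filterS (hc j) => x /(_ I).
apply: (lam_aeS2 Hc (ae_offnodes R m)) => x Hcx xN _.
rewrite -[LHS]mulr1 -(cell_partition xN) mulr_sumr; apply: eq_bigr => j _; exact: Hcx.
Qed.

Lemma Zspace_ZK m j (q : RT -> R) : (j < 2 ^ m)%N -> ZKspace k m j q -> Zspace k m.+1 q.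
Proof.
move=> jm [hq q0 qh qo]; split; first split => //.
  move=> i im; have [i2|i2] := eqVneq i./2 j.
    apply: qh; rewrite !inE -i2 mul2n; apply/orP.
    by case: (boolP (odd i)) => oi; [right|left]; apply/eqP;
      rewrite -[LHS](odd_double_half i) ?oi ?(negbTE oi).
  exists 0; first by rewrite /polyle /= size_poly0.
  apply: (lam_aeS2 q0 (ae_offnodes R m.+1)) => x q0x xN xi.
  rewrite horner0; apply: q0x => /(cellS _ xN xi) E; by rewrite E eqxx in i2.
move=> g hg; have [p hp Hp] := hg.2 j jm.
have hL := Qspace_L2 hg; have hpL := L2_poly p.
rewrite -[RHS](qo p hp) [RHS]Rintegral_mkcond.
have mc : measurable (cell m j : set RT) by exact: measurable_cell.
apply: (@Rintegral_ae _ _ _ lam) => //.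
- exact: measurable_funM (L2_measurable hq) (L2_measurable hL).
- apply/(measurable_restrictT _ mc); apply: measurable_funTS.
  exact: measurable_funM (L2_measurable hq) (L2_measurable hpL).
apply: (lam_aeS2 q0 Hp) => x q0x Hpx _; rewrite patchE; case: ifPn => [/set_mem/Hpx ->//|xj].
by rewrite q0x ?mul0r// => xj'; rewrite mem_set in xj.
Qed.

Lemma Zspace_psi m j r : (j < 2 ^ m)%N -> (r <= k)%N -> Zspace k m.+1 (psi m.+1 j r).
Proof.
move=> jm rk; have [h _ _] := @hpsi m.+1 j (ltn0Sn m) jm.
exact: Zspace_ZK jm (h r rk).
Qed.

(** The cut-off in [theta] changes nothing: a wavelet vanishes off its cell and has zero mean there,
    so its primitive from 0 vanishes on both sides of the cell. *)
Lemma theta_prim m j r (x : R) : (j < 2 ^ m)%N -> (r <= k)%N -> 0 < x < 1 ->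
  theta psi m.+1 j r x = prim (psi m.+1 j r) x.
Proof.
move=> jm rk x01; have [h _ _] := @hpsi m.+1 j (ltn0Sn m) jm.
have [hq q0 _ qo] := h r rk; move: q0 qo hq; rewrite /theta /=.
move: (psi m.+1 j r) => q q0 qo hq {h}.
have mq := L2_measurable hq; have mx := measurable_heav x.
have mc : measurable (cell m j : set RT) by exact: measurable_cell.
have mi : measurable_fun setT (\1_(cell m j : set RT) : RT -> R) by exact: measurable_indic.
have -> : prim q x = \int[lam]_s (q s * \1_(cell m j) s * heav x s).
  apply: (@Rintegral_ae _ _ _ lam) => //; first exact: measurable_funM.
    by apply: measurable_funM => //; exact: measurable_funM.
  apply: (lam_aeS q0) => s q0s _; rewrite indicE; case: (boolP (s \in _)) => sj; rewrite ?mulr1//.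
  by rewrite q0s ?mul0r// => sj'; rewrite mem_set in sj.
have /andP[x0 x1] := x01.
have a0 : 0 <= node R m j by rewrite nodeE divr_ge0 ?exprn_ge0.
case: ifPn => [/set_mem|/negP].
  rewrite /cell /= in_itv /= => /andP[ax xb].
  rewrite lam_Rintegral; last by apply: measurable_funM => //; exact: measurable_funM.
  rewrite [LHS]Rintegral_mkcond [RHS]Rintegral_mkcond /Rintegral; congr fine.
  apply: ae_eq_integral => //.
  - have mI : measurable (`[node R m j, x]%classic : set RT) by exact: measurable_itv.
    by apply/measurable_EFinP/(measurable_restrictT _ mI); exact: measurable_funTS.
  - have mI : measurable (`]0, 1[%classic : set RT) by exact: measurable_itv.
    apply/measurable_EFinP/(measurable_restrictT _ mI); apply: measurable_funTS.
    by apply: measurable_funM => //; exact: measurable_funM.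
  (* If the cell starts at 0, that point lies in the closed interval but not in []0, 1[]; the
     integrands agree everywhere else. *)
  exists [set 0]; split; [exact: measurable_set1|exact: lebesgue_measure_set1|].
  move=> s /=; apply: contra_notP => s0 _; congr EFin; rewrite !patchE indicE !mem_setE !in_itv/= /heav.
  case: (leP (node R m j) s) => as_ /=; last by rewrite mulr0 mul0r if_same.
  case: (leP s x) => sx /=; last by rewrite mulr0 if_same.
  rewrite (le_trans sx xb) (le_lt_trans sx x1) lt_def (le_trans a0 as_) !andbT !mulr1.
  by case: eqP => // /s0.
move=> xj; case: (ltP x (node R m j)) => [xa|ax].
  rewrite -[LHS](Rintegral_prob_cst lam); apply: eq_Rintegral => s _.
  rewrite indicE mem_setE in_itv/= /heav; case: (leP (node R m j) s) => as_ /=; last by rewrite mulr0 mul0r.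
  have -> : (s <= x)%R = false by apply/negbTE; rewrite -ltNge (lt_le_trans xa as_).
  by rewrite mulr0.
have bx : node R m j.+1 < x.
  by rewrite ltNge; apply/negP => xb; apply: xj; rewrite inE /cell /= in_itv/= ax.
(* To the right of the cell, the primitive is the full integral over the cell, which vanishes by
   orthogonality to constants. *)
have P1 : polyle k (1 : {poly R}) by rewrite /polyle /= size_poly1.
rewrite -[LHS](qo 1 P1) [LHS]Rintegral_mkcond; apply: eq_Rintegral => s _.
rewrite patchE indicE hornerC mulr1; case: ifPn => [/set_mem|_]; last by rewrite mulr0 mul0r.
rewrite /cell /= in_itv/= => /andP[_ sb].
by rewrite /heav (le_trans sb (ltW bx)) !mulr1.
Qed.

End OneDimSpaces.

(** * Spaces of primitives and finite generation up to null sets *)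

Section NormalForm.
Variable R : realType.
Local Notation RT := (measurableTypeR R).
Local Notation lam := (@lebesgue01 R).
Local Notation L2 := (Lfun lam 2%:E).

Lemma lspan_fin (T : Type) (S : set (T -> R)) (F : finType) (c : F -> R) (g : F -> T -> R) :
  (forall z, S (g z)) -> lspan S (fun x => \sum_(z : F) c z * g z x).
Proof.
move=> hg; exists #|F|, (fun i => c (enum_val i)), (fun i => g (enum_val i)); split => //.
apply/funext => x; rewrite (reindex (@enum_val F F))//.
exact: onW_bij (@enum_val_bij F).
Qed.

(** Normal form of Y_m. Keeping Z abstract frees the homotopy operator from wavelets: it uses only
    that Z consists of L^2 functions and that level 0 contains the constants. *)
Definition Yprim (Z : nat -> set (RT -> R)) (m : nat) : set (RT -> R) :=
  [set v | exists q c, [/\ Z m q, (0 < m)%N -> c = 0 & v = (fun x => c + prim q x)]].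

(** The generators are not asked to lie in S, which makes this stable under subsets and finite
    unions. *)
Definition fdim (S : set (RT -> R)) := exists (F : finType) (G : F -> RT -> R),
  (forall i, G i \in L2) /\
  forall v, S v -> exists c : F -> R, v = (fun x => \sum_i c i * G i x) %[ae lam].

Lemma fdimU S1 S2 : fdim S1 -> fdim S2 -> fdim (S1 `|` S2).
Proof.
move=> [F1 [G1 [L1 H1]]] [F2 [G2 [L2' H2]]].
exists (F1 + F2)%type, (fun i => match i with inl a => G1 a | inr b => G2 b end); split.
  by case=> a.
move=> v [/H1[c hc]|/H2[c hc]].
  exists (fun i => match i with inl a => c a | inr b => 0 end).
  apply: (lam_aeS hc) => x hx /hx ->; rewrite big_sumType /= [X in _ + X]big1 ?addr0// => i _.
  by rewrite mul0r.
exists (fun i => match i with inl a => 0 | inr b => c b end).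
apply: (lam_aeS hc) => x hx /hx ->; rewrite big_sumType /= [X in X + _]big1 ?add0r// => i _.
by rewrite mul0r.
Qed.

Lemma fdim_sub S1 S2 : S1 `<=` S2 -> fdim S2 -> fdim S1.
Proof. by move=> S12 [F [G [LG HG]]]; exists F, G; split => // v /S12 /HG. Qed.

Lemma fdim_bigcup (S : nat -> set (RT -> R)) M : (forall m, fdim (S m)) ->
  fdim [set v | exists2 m, (m <= M)%N & S m v].
Proof.
move=> hS; elim: M => [|M IH].
  by apply: fdim_sub (hS 0%N) => v [m]; rewrite leqn0 => /eqP ->.
apply: fdim_sub (fdimU IH (hS M.+1)) => v [m]; rewrite leq_eqVlt => /predU1P[->|mM Sv]; first by right.
by left; exists m.
Qed.

Lemma fdim_Yprim (Z : nat -> set (RT -> R)) m : (forall q, Z m q -> q \in L2) ->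
  fdim (Z m) -> fdim (Yprim Z m).
Proof.
move=> ZL [F [G [LG HG]]].
exists ('I_1 + F)%type, (fun i => if i is inr a then prim (G a) else (fun=> 1)); split.
  by case=> a; [exact: L2_cst|exact: L2_prim].
move=> v [q [c [Zq _ ->]]]; have [a ha] := HG q Zq.
exists (fun i => if i is inr b then a b else c).
apply: aeW => x _; rewrite big_sumType /= big_ord1 mulr1; congr (_ + _).
have LS : (fun x => \sum_i a i * G i x) \in L2 by apply: L2_sum => i _; exact: L2Z.
rewrite (prim_ae _ (ZL q Zq) LS ha) prim_sum; last by move=> i _; exact: L2Z.
by apply: eq_bigr => i _; rewrite primZ.
Qed.

Lemma Yprim_L2 (Z : nat -> set (RT -> R)) m v : (forall q, Z m q -> q \in L2) ->
  Yprim Z m v -> v \in L2.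
Proof.
by move=> ZL [q [c [Zq _ ->]]]; apply: L2D; [exact: L2_cst|exact: L2_prim (ZL q Zq)].
Qed.

Definition antideriv (p : {poly R}) : {poly R} :=
  \poly_(i < (size p).+1) (if i is j.+1 then p`_j / j.+1%:R else 0).

Lemma antiderivK p : (antideriv p)^`() = p.
Proof.
apply/polyP => i; rewrite coef_deriv coef_poly ltnS; case: ltnP => ip.
  by rewrite -(mulr_natr (_ / _)) divfK.
by rewrite mul0rn nth_default.
Qed.

Lemma antideriv0 p : (antideriv p).[0] = 0.
Proof. by rewrite horner_coef0 coef_poly. Qed.

Lemma is_derive_horner (p : {poly R}) (x : R) : is_derive x 1 (horner p) (p^`()%R).[x].
Proof. by rewrite derivE derive1E; apply/derivableP; exact: derivable_horner. Qed.

Lemma prim_horner (p : {poly R}) (x : R) : 0 < x < 1 ->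
  prim (horner (p^`()%R)) x = p.[x] - p.[0].
Proof.
move=> x01; apply: (prim_C1 (g := horner p) (fun y _ => is_derive_horner p y) _ x01).
exact: continuous_horner.
Qed.

End NormalForm.

(** * Identification of Y with the primitives of Z *)

Section WaveletSpaces.
Variables (R : realType) (k : nat).
Local Notation RT := (measurableTypeR R).
Local Notation lam := (@lebesgue01 R).
Local Notation L2 := (Lfun lam 2%:E).
Variable psi : nat -> nat -> nat -> RT -> R.
Hypothesis hpsi : is_orthonormal_wavelets k psi.
Local Notation Z := (@Zspace R k).

Lemma Zspace0_horner (p : {poly R}) : polyle k p -> Z 0%N (horner p).
Proof.
by move=> hp; split=> [|j _]; [exact: L2_poly|exists p => //; exact: aeW].
Qed.

Lemma cell00 (x : R) : cell 0 0 x <-> 0 <= x <= 1.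
Proof. by rewrite /cell /= in_itv/= /node expn0 !divr1. Qed.

Lemma Zspace0_poly (q : RT -> R) : Z 0%N q -> exists2 p, polyle k p & q = horner p %[ae lam].
Proof.
move=> [_ /(_ 0%N isT)[p hp H]]; exists p => //.
apply: (lam_aeS2 H (lam_ae01 R)) => x Hx /andP[x0 x1] _; apply: Hx; apply/cell00.
by rewrite !ltW.
Qed.

Lemma Yprim_const c : Yprim Z 0%N (fun=> c).
Proof.
exists (horner 0), c; split => //.
  by apply: Zspace0_horner; rewrite /polyle /= size_poly0.
apply/funext => x; rewrite horner0_ext /prim.
by rewrite -[LHS]addr0; congr (_ + _); rewrite -[LHS](ip0l lam (heav x)).
Qed.

(** At level 0 primitives are polynomials of degree at most k + 1; at higher levels the wavelet
    expansion is integrated term by term into [theta]. *)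
Lemma Yprim_Yspace m (v : RT -> R) : Yprim Z m v ->
  exists2 u, Yspace psi k m u & v = u %[ae lam].
Proof.
move=> [q [c [Zq c0 ->]]]; have Lq := Zspace_L2 Zq.
case: m Zq c0 => [|m] Zq c0.
  have [p hp qp] := Zspace0_poly Zq.
  exists (horner (c%:P + antideriv p)).
    split; first by apply: continuous_subspaceT; exact: continuous_horner.
    case=> // _; exists (c%:P + antideriv p) => //.
    rewrite /polyle /= (leq_trans (size_polyD _ _))// geq_max.
    rewrite (leq_trans (size_polyC_leq1 _))//= (leq_trans (size_poly _ _))//.
  apply: (lam_aeS (lam_ae01 R)) => x x01 _.
  rewrite (prim_ae _ Lq (L2_poly p) qp) -[in LHS](antiderivK p) prim_horner//.
  by rewrite antideriv0 subr0 hornerD hornerC.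
rewrite c0//; have [a ha] := Zspace_wavelets hpsi Zq.
pose F (z : 'I_(2 ^ m) * 'I_k.+1) := theta psi m.+1 z.1 z.2.
exists (fun x => \sum_(z : 'I_(2 ^ m) * 'I_k.+1) a z.1 z.2 * F z x).
  apply: lspan_fin => z; exists z.1, z.2; split => //.
  by rewrite -ltnS.
have Lpsi (j : 'I_(2 ^ m)) (r : 'I_k.+1) : psi m.+1 j r \in L2.
  by apply: (Zspace_L2 (Zspace_psi hpsi (ltn_ord j) _)); rewrite -ltnS.
have LS j : (fun x => \sum_(r < k.+1) a j r * psi m.+1 j r x) \in L2.
  by apply: L2_sum => r _; exact: L2Z.
apply: (lam_aeS (lam_ae01 R)) => x x01 _; rewrite add0r.
have LSS : (fun x => \sum_(j < 2 ^ m) \sum_(r < k.+1) a j r * psi m.+1 j r x) \in L2.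
  by apply: L2_sum => j _.
rewrite (prim_ae _ Lq LSS ha) prim_sum//.
rewrite -(pair_bigA _ (fun (j : 'I_(2 ^ m)) (r : 'I_k.+1) => a j r * theta psi m.+1 j r x)) /=.
apply: eq_bigr => j _; rewrite prim_sum; last by move=> r _; exact: L2Z.
by apply: eq_bigr => r _; rewrite primZ// (theta_prim hpsi)// -ltnS.
Qed.

(** At level 0, p is p(0) plus the primitive of p'; at higher levels each [theta] is the primitive
    of its wavelet. *)
Lemma Yspace_Yprim m (v : RT -> R) : Yspace psi k m v ->
  exists2 u, Yprim Z m u & v = u %[ae lam].
Proof.
case: m => [|m].
  move=> [_ /(_ 0%N isT)[p hp vp]].
  exists (fun x => p.[0] + prim (horner (p^`()%R)) x).
    exists (horner (p^`()%R)), p.[0]; split => //; apply: Zspace0_horner.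
    move: hp; rewrite /polyle /= => hp; apply: leq_trans (size_poly _ _) _.
    by case: (size p) hp.
  apply: (lam_aeS (lam_ae01 R)) => x x01 _.
  rewrite prim_horner// subrKC; apply: vp; apply/cell00.
  by have /andP[x0 x1] := x01; rewrite !ltW.
move=> [N [c [g [hg ->]]]].
have /choice[jr hjr] : forall i, exists jr : nat * nat,
    [/\ (jr.1 < 2 ^ m)%N, (jr.2 <= k)%N & g i = theta psi m.+1 jr.1 jr.2].
  by move=> i; have [j [r h]] := hg i; exists (j, r).
have Zpsi i : Z m.+1 (psi m.+1 (jr i).1 (jr i).2).
  by have [h1 h2 _] := hjr i; exact: (Zspace_psi hpsi h1 h2).
exists (fun x => 0 + prim (fun s => \sum_(i < N) c i * psi m.+1 (jr i).1 (jr i).2 s) x).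
  exists (fun s => \sum_(i < N) c i * psi m.+1 (jr i).1 (jr i).2 s), 0; split => //.
  exact: Zspace_lin.
apply: (lam_aeS (lam_ae01 R)) => x x01 _; rewrite add0r prim_sum; last first.
  by move=> i _; apply: L2Z; exact: Zspace_L2 (Zpsi i).
apply: eq_bigr => i _; have [h1 h2 ->] := hjr i.
by rewrite (theta_prim hpsi)// primZ//; exact: Zspace_L2 (Zpsi i).
Qed.

Lemma fdim_Zspace m : fdim (Z m).
Proof.
case: m => [|m].
  exists 'I_k.+1, (fun (i : 'I_k.+1) (x : R) => x ^+ i); split.
    move=> i; have := L2_poly ('X^i : {poly R}).
    by rewrite (_ : (fun x => _) = fun x : RT => x ^+ i)//; apply/funext => x; rewrite hornerXn.
  move=> q /Zspace0_poly[p hp qp]; exists (fun i : 'I_k.+1 => p`_i).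
  apply: (lam_aeS qp) => x /(_ I) -> _; rewrite (horner_coef_wide _ hp)//.
exists ('I_(2 ^ m) * 'I_k.+1)%type, (fun z : 'I_(2 ^ m) * 'I_k.+1 => psi m.+1 z.1 z.2); split.
  by move=> z; apply: (Zspace_L2 (Zspace_psi hpsi (ltn_ord z.1) _)); rewrite -ltnS.
move=> q /(Zspace_wavelets hpsi)[c hc]; exists (fun z : 'I_(2 ^ m) * 'I_k.+1 => c z.1 z.2).
apply: (lam_aeS hc) => x /(_ I) -> _.
by rewrite -(pair_bigA _ (fun (j : 'I_(2 ^ m)) (r : 'I_k.+1) => c j r * psi m.+1 j r x)).
Qed.

End WaveletSpaces.

(** * Products of one-dimensional functions *)

Section ProductIntegrable.
Context d1 d2 (T1 : measurableType d1) (T2 : measurableType d2) (R : realType).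
Variables (P : probability T1 R) (Q : probability T2 R).

Lemma integrable_prod (f : T1 -> R) (g : T2 -> R) :
  P.-integrable setT (EFin \o f) -> Q.-integrable setT (EFin \o g) ->
  (P \x Q)%E.-integrable setT (EFin \o (fun z => f z.1 * g z.2)).
Proof.
move=> iq ig; have [mq q1] := integrableP _ _ _ iq; have [mg g1] := integrableP _ _ _ ig.
have mF : measurable_fun setT (fun z : T1 * T2 => f z.1 * g z.2).
  apply: measurable_funM.
  - exact: (measurableT_comp ((measurable_EFinP _ _).1 mq) measurable_fst).
  - exact: (measurableT_comp ((measurable_EFinP _ _).1 mg) measurable_snd).
apply/(integrable12ltyP _ _ _).2; first exact/measurable_EFinP.
have mag : measurable_fun setT (fun y => `|(EFin \o g) y|)%E by exact: measurableT_comp.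
rewrite (_ : (\int[P]_x _)%E = (\int[P]_x (`|(EFin \o f) x| * \int[Q]_y `|(EFin \o g) y|))%E).
  rewrite ge0_integralZr//; last 2 first.
  - exact: measurableT_comp.
  - by rewrite integral_ge0.
  by rewrite lte_mul_pinfty ?integral_ge0// ge0_fin_numE// integral_ge0.
apply: eq_integral => x _; rewrite -ge0_integralZl//.
by apply: eq_integral => y _; rewrite /= normrM EFinM.
Qed.

End ProductIntegrable.

Section Tensors.
Variable R : realType.
Local Notation RT := (measurableTypeR R).
Local Notation lam := (@lebesgue01 R).
Local Notation cube d := (@lebesgue_cube R d).
Local Notation L2 := (Lfun lam 2%:E).

Definition pure d (v : 'I_d -> RT -> R) (x : d.-tuple RT) : R := \prod_(i < d) v i (tnth x i).

Lemma measurable_pure d (v : 'I_d -> RT -> R) :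
  (forall i, measurable_fun setT (v i)) -> measurable_fun setT (pure v).
Proof.
move=> mv; apply: measurable_prod => i _.
exact: (measurableT_comp (mv i) (measurable_tnth i)).
Qed.

Lemma pure_integrable d (v : 'I_d -> RT -> R) :
  (forall i, lam.-integrable setT (EFin \o v i)) ->
  (cube d).-integrable setT (EFin \o pure v).
Proof.
elim: d v => [|d IH] v iv.
  rewrite (_ : pure v = fun=> 1); last by apply/funext => x; rewrite /pure big_ord0.
  exact: finite_measure_integrable_cst.
have mv i : measurable_fun setT (v i).
  by have [mv _] := integrableP _ _ _ (iv i); exact/measurable_EFinP.
have mp : measurable_fun setT (EFin \o pure v) by apply/measurable_EFinP; exact: measurable_pure.
have ip := integrable_prod (iv ord0) (IH (fun i => v (lift ord0 i)) (fun i => iv _)).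
apply/integrableP; split => //.
rewrite ge0_integral_distribution//; last exact: measurableT_comp.
have [_] := integrableP _ _ _ ip; congr (_ < _)%E; apply: eq_integral => z _ /=.
congr (_ %:E); congr (`| _ |); rewrite /pure big_ord_recl /=; congr (_ * _).
by apply: eq_bigr => i _; rewrite tnthS.
Qed.

Lemma lspan_comb (T : Type) (S : set (T -> R)) N (c : 'I_N -> R) (g : 'I_N -> T -> R) :
  (forall a, lspan S (g a)) -> lspan S (fun x => \sum_(i < N) c i * g i x).
Proof.
elim: N c g => [|N IH] c g hg.
  exists 0%N, (fun=> 0), (fun=> fun=> 0); split; first by case.
  by apply/funext => x; rewrite !big_ord0.
have [N1 [c1 [g1 [h1 E1]]]] := IH (fun i => c (widen_ord (leqnSn N) i)) _ (fun i => hg (widen_ord (leqnSn N) i)).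
have [N2 [c2 [g2 [h2 E2]]]] := hg ord_max.
exists (N1 + N2)%N, (fun i : 'I_(N1 + N2) => match fintype.split i with inl a => c1 a | inr b => c ord_max * c2 b end),
  (fun i : 'I_(N1 + N2) => match fintype.split i with inl a => g1 a | inr b => g2 b end); split.
  by move=> i; case: (fintype.split i).
apply/funext => x; rewrite big_ord_recr /= (congr1 (fun h => h x) E1) E2 big_split_ord /=; congr (_ + _).
  by apply: eq_bigr => i _; rewrite (unsplitK (inl i)).
by rewrite mulr_sumr; apply: eq_bigr => i _; rewrite (unsplitK (inr i)) mulrA.
Qed.

Lemma lspan_sub (T : Type) (S1 S2 : set (T -> R)) : S1 `<=` S2 -> lspan S1 `<=` lspan S2.
Proof.
by move=> S12 _ [N [c [g [hg ->]]]]; exists N, c, g; split => // i; exact: S12.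
Qed.

Lemma lspan_mem (T : Type) (S : set (T -> R)) f : S f -> lspan S f.
Proof.
move=> Sf; exists 1%N, (fun=> 1), (fun=> f); split => //.
by apply/funext => x; rewrite big_ord1 mul1r.
Qed.

Lemma lspan_lin (T : Type) (S : set (T -> R)) a b f g : lspan S f -> lspan S g ->
  lspan S (fun x => a * f x + b * g x).
Proof.
move=> hf hg.
have := @lspan_comb T S 2 (fun i => if i == ord0 then a else b) (fun i => if i == ord0 then f else g).
move=> H; have {}H := H (fun i => _); rewrite (_ : (fun x => _) =
  fun x => \sum_(i < 2) (if i == ord0 then a else b) * (if i == ord0 then f else g) x).
  by apply: H => i; case: ifP.
by apply/funext => x; rewrite big_ord_recl big_ord1.
Qed.

Section Dim.
Variable d : nat.
Local Notation X := (d.-tuple RT).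
Implicit Types (v w : 'I_d -> RT -> R) (f g : X -> R) (i j : 'I_d).
Local Notation L2c := (Lfun (cube d) 2%:E).

Lemma L2_pure v : (forall i, v i \in L2) -> pure v \in L2c.
Proof.
move=> hv; apply: L2_sqr; first by apply: measurable_pure => i; exact: L2_measurable (hv i).
rewrite (_ : (fun x => _) = pure (fun i t => v i t ^+ 2)); last first.
  by apply/funext => x; rewrite /pure prodrXl.
by apply: pure_integrable => i; exact: Lfun2_integrable_sqr (hv i).
Qed.

Definition fset v i (u : RT -> R) : 'I_d -> RT -> R := fun j => if j == i then u else v j.

Lemma pureE v i x : pure v x = v i (tnth x i) * \prod_(j < d | j != i) v j (tnth x j).
Proof. by rewrite /pure (bigD1 i). Qed.

Lemma pure_upd v i x t : pure v (upd x i t) = v i t * \prod_(j < d | j != i) v j (tnth x j).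
Proof.
rewrite (pureE v i) tnth_upd eqxx; congr (_ * _).
by apply: eq_bigr => j /negbTE ji; rewrite tnth_upd ji.
Qed.

Lemma pure_fset v i u x : pure (fset v i u) x = u (tnth x i) * \prod_(j < d | j != i) v j (tnth x j).
Proof.
rewrite (pureE _ i) /fset eqxx; congr (_ * _).
by apply: eq_bigr => j /negbTE ->.
Qed.

Lemma pure_ae v w : (forall i, v i = w i %[ae lam]) -> pure v = pure w %[ae cube d].
Proof.
move=> vw; have : {ae cube d, forall x : X, forall i, v i (tnth x i) = w i (tnth x i)}.
  apply: filter_forall => i; apply: (@ae_coord R d i (fun t => v i t = w i t)).
  by apply: (lam_aeS (vw i)) => t /(_ I).
by apply: filterS => x H _; apply: eq_bigr => i _; rewrite H.
Qed.

(** The algebraic, not completed, tensor product: every slice of a member is in L^2, without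
    exceptional set, so one-variable means and primitives are defined and linear pointwise. *)
Definition tens2 : set (X -> R) := lspan [set pure v | v in [set v | forall i, v i \in L2]].

Lemma tens2_pure v : (forall i, v i \in L2) -> tens2 (pure v).
Proof.
move=> hv; exists 1%N, (fun=> 1), (fun=> pure v); split; first by move=> _; exists v.
by apply/funext => x; rewrite big_ord1 mul1r.
Qed.

Lemma tens2_ind (S : set (X -> R)) :
  (forall v, (forall i, v i \in L2) -> S (pure v)) ->
  (forall N (c : 'I_N -> R) (g : 'I_N -> X -> R), (forall a, tens2 (g a)) ->
    (forall a, S (g a)) -> S (fun x => \sum_(i < N) c i * g i x)) ->
  tens2 `<=` S.
Proof.
move=> Sp Ss _ [N [c [g [hg ->]]]]; apply: Ss => i; have [v hv <-] := hg i.
- exact: tens2_pure.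
- exact: Sp.
Qed.

Lemma tens2_L2 f : tens2 f -> f \in L2c.
Proof.
move: f; apply: tens2_ind => [v hv|N c g _ hg]; first exact: L2_pure.
by apply: L2_sum => i _; exact: L2Z.
Qed.

Lemma tens2_slice f x i : tens2 f -> (fun t => f (upd x i t)) \in L2.
Proof.
move: f; apply: tens2_ind => [v hv|N c g _ hg].
  rewrite (_ : (fun t => _) = fun t => \prod_(j < d | j != i) v j (tnth x j) * v i t); last first.
    by apply/funext => t; rewrite pure_upd mulrC.
  exact: L2Z.
by apply: L2_sum => a _; exact: L2Z (hg a).
Qed.

End Dim.
End Tensors.

(** * The homotopy operator *)

Lemma Rintegral_sum d (T : measurableType d) (R : realType) (P : probability T R)
    (I : Type) (s : seq I) (F : I -> T -> R) : (forall a, F a \in Lfun P 2%:E) ->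
  \int[P]_x (\sum_(a <- s) F a x) = \sum_(a <- s) \int[P]_x F a x.
Proof.
move=> hF; have := @ip_suml _ _ _ P _ s xpredT F (fun=> 1) (fun a _ => hF a) (L2_cst P 1).
rewrite /ip (_ : (fun x => _ * 1) = fun x => \sum_(a <- s) F a x) => [->|].
  by apply: eq_bigr => a _; apply: eq_Rintegral => x _; rewrite mulr1.
by apply/funext => x; rewrite mulr1.
Qed.

Section CoordinateOperators.
Variables (R : realType) (d : nat).
Local Notation RT := (measurableTypeR R).
Local Notation X := (d.-tuple RT).
Local Notation lam := (@lebesgue01 R).
Local Notation cube := (@lebesgue_cube R d).
Local Notation L2 := (Lfun lam 2%:E).
Local Notation L2c := (Lfun cube 2%:E).
Implicit Types (v : 'I_d -> RT -> R) (f g : X -> R) (i j : 'I_d).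

Definition Eop i f (x : X) : R := \int[lam]_t f (upd x i t).

Definition Mop i f (x : X) : R := mfprim (fun t => f (upd x i t)) (tnth x i).

(** Averages over the coordinates below m. Indexing by nat lets the telescoping sum speak of
    [Elt i.+1] for the last i; indices from d on act trivially. *)
Fixpoint Elt (m : nat) f : X -> R :=
  if m is m'.+1 then (if insub m' is Some i then Eop i (Elt m' f) else Elt m' f) else f.

Definition Kop i f : X -> R := Elt i (Mop i f).

Lemma mfprim_sum (I : Type) (s : seq I) (c : I -> R) (q : I -> RT -> R) t :
  (forall a, q a \in L2) ->
  mfprim (fun u => \sum_(a <- s) c a * q a u) t = \sum_(a <- s) c a * mfprim (q a) t.
Proof.
move=> hq; have E u : prim (fun u => \sum_(a <- s) c a * q a u) u = \sum_(a <- s) c a * prim (q a) u.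
  by rewrite prim_sum; [apply: eq_bigr => a _; rewrite primZ|move=> a _; exact: L2Z].
rewrite /mfprim E; under [in X in _ - X]eq_Rintegral do rewrite E.
under [RHS]eq_bigr do rewrite mulrBr; rewrite sumrB; congr (_ - _).
rewrite Rintegral_sum; last by move=> a; exact: L2Z (L2_prim (hq a)).
apply: eq_bigr => a _; rewrite RintegralZl//; exact: L2_integrable (L2_prim (hq a)).
Qed.

Lemma mfprimZ c (q : RT -> R) t : q \in L2 -> mfprim (fun u => c * q u) t = c * mfprim q t.
Proof.
move=> hq; have := @mfprim_sum 'I_1 (index_enum _) (fun=> c) (fun=> q) t (fun=> hq).
rewrite big_ord1 => <-; congr mfprim; apply/funext => u; by rewrite big_ord1.
Qed.

Lemma Eop_pure i v : v i \in L2 -> Eop i (pure v) = pure (fset v i (fun=> \int[lam]_t v i t)).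
Proof.
move=> hv; apply/funext => x; rewrite /Eop pure_fset -RintegralZr//; last exact: L2_integrable.
by apply: eq_Rintegral => t _; rewrite pure_upd.
Qed.

Lemma Mop_pure i v : v i \in L2 -> Mop i (pure v) = pure (fset v i (mfprim (v i))).
Proof.
move=> hv; apply/funext => x; rewrite /Mop pure_fset mulrC -mfprimZ//.
by congr mfprim; apply/funext => t; rewrite pure_upd mulrC.
Qed.

Lemma Eop_sum i N (c : 'I_N -> R) (g : 'I_N -> X -> R) : (forall a, tens2 (g a)) ->
  Eop i (fun x => \sum_(a < N) c a * g a x) = (fun x => \sum_(a < N) c a * Eop i (g a) x).
Proof.
move=> hg; apply/funext => x; have hs a := tens2_slice x i (hg a).
rewrite /Eop Rintegral_sum; last by move=> a; exact: L2Z (hs a).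
by apply: eq_bigr => a _; rewrite RintegralZl//; exact: L2_integrable (hs a).
Qed.

Lemma Mop_sum i N (c : 'I_N -> R) (g : 'I_N -> X -> R) : (forall a, tens2 (g a)) ->
  Mop i (fun x => \sum_(a < N) c a * g a x) = (fun x => \sum_(a < N) c a * Mop i (g a) x).
Proof.
by move=> hg; apply/funext => x; rewrite /Mop mfprim_sum// => a; exact: tens2_slice.
Qed.

Lemma fset_L2 v i u : (forall j, v j \in L2) -> u \in L2 -> forall j, fset v i u j \in L2.
Proof. by move=> hv hu j; rewrite /fset; case: ifP. Qed.

Lemma tens2_Eop i f : tens2 f -> tens2 (Eop i f).
Proof.
move: f; apply: tens2_ind => [v hv|N c g tg hg].
  by rewrite Eop_pure//; apply: tens2_pure; apply: fset_L2 => //; exact: L2_cst.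
by rewrite Eop_sum//; exact: lspan_comb.
Qed.

Lemma tens2_Mop i f : tens2 f -> tens2 (Mop i f).
Proof.
move: f; apply: tens2_ind => [v hv|N c g tg hg].
  by rewrite Mop_pure//; apply: tens2_pure; apply: fset_L2 => //; exact: L2_mfprim.
by rewrite Mop_sum//; exact: lspan_comb.
Qed.

Lemma tens2_Elt m f : tens2 f -> tens2 (Elt m f).
Proof.
by move=> tf; elim: m => //= m IH; case: insub => // i; exact: tens2_Eop.
Qed.

Lemma tens2_Kop i f : tens2 f -> tens2 (Kop i f).
Proof. by move=> tf; apply: tens2_Elt; exact: tens2_Mop. Qed.

Lemma Elt_sum m N (c : 'I_N -> R) (g : 'I_N -> X -> R) : (forall a, tens2 (g a)) ->
  Elt m (fun x => \sum_(a < N) c a * g a x) = (fun x => \sum_(a < N) c a * Elt m (g a) x).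
Proof.
move=> tg; elim: m => //= m ->; case: insub => // i.
by rewrite Eop_sum// => a; exact: tens2_Elt.
Qed.

Lemma Kop_sum i N (c : 'I_N -> R) (g : 'I_N -> X -> R) : (forall a, tens2 (g a)) ->
  Kop i (fun x => \sum_(a < N) c a * g a x) = (fun x => \sum_(a < N) c a * Kop i (g a) x).
Proof. by move=> tg; rewrite /Kop Mop_sum// Elt_sum// => a; exact: tens2_Mop. Qed.

Definition lowmean m v : 'I_d -> RT -> R :=
  fun j => if (j < m)%N then (fun=> \int[lam]_t v j t) else v j.

Lemma lowmean_L2 m v : (forall j, v j \in L2) -> forall j, lowmean m v j \in L2.
Proof. by move=> hv j; rewrite /lowmean; case: ifP => // _; exact: L2_cst. Qed.

Lemma Elt_pure m v : (forall j, v j \in L2) -> Elt m (pure v) = pure (lowmean m v).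
Proof.
move=> hv; elim: m => [|m /= ->]; first by [].
case: insubP => [i _ im|].
  rewrite Eop_pure; last exact: lowmean_L2.
  congr pure; apply/funext => j; rewrite /fset /lowmean.
  case: eqVneq => [->|ji]; first by rewrite im ltnn ltnSn.
  suff -> : (j < m.+1)%N = (j < m)%N by [].
  by rewrite [LHS]ltnS leq_eqVlt -im (inj_eq (@ord_inj d)) (negbTE ji).
rewrite -leqNgt => dm; congr pure; apply/funext => j; rewrite /lowmean.
by rewrite (leq_trans (ltn_ord j) dm) (leq_trans (ltn_ord j) (leqW dm)).
Qed.

Definition Kfac i v : 'I_d -> RT -> R := lowmean i (fset v i (mfprim (v i))).

Lemma Kop_pure i v : (forall j, v j \in L2) -> Kop i (pure v) = pure (Kfac i v).
Proof.
move=> hv; rewrite /Kop Mop_pure// Elt_pure//; apply: fset_L2 => //; exact: L2_mfprim.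
Qed.

Lemma ip_slice i f g : f \in L2c -> g \in L2c ->
  ip cube f g = \int[cube]_x ip lam (fun t => f (upd x i t)) (fun t => g (upd x i t)).
Proof. by move=> hf hg; rewrite /ip (cube_Rfubini i)//; exact: L2M_integrable. Qed.

(** A bound on every coordinate line integrates, which carries the one-dimensional inequalities to
    the cube with the same constant. *)
Lemma norm_slice_le i C f g : f \in L2c -> g \in L2c ->
  (forall x, C * ip lam (fun t => g (upd x i t)) (fun t => g (upd x i t)) <=
         ip lam (fun t => f (upd x i t)) (fun t => f (upd x i t))) ->
  C * ip cube g g <= ip cube f f.
Proof.
move=> hf hg H; have i1 := integrable_slice i (L2M_integrable hf hf).
have i2 := integrable_slice i (L2M_integrable hg hg).
rewrite (ip_slice i hf hf) (ip_slice i hg hg) -RintegralZl//.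
apply: le_Rintegral => //.
by have := integrableZl measurableT C i2; apply: eq_integrable => // x _; rewrite /= EFinM.
Qed.

Lemma Eop_le i f : tens2 f -> ip cube (Eop i f) (Eop i f) <= ip cube f f.
Proof.
move=> tf; rewrite -[leLHS]mul1r; apply: (norm_slice_le (i := i)).
- exact: tens2_L2.
- by apply: tens2_L2; exact: tens2_Eop.
move=> x; have hs := tens2_slice x i tf; rewrite mul1r.
have E : (fun t => Eop i f (upd x i t)) = fun=> Eop i f x.
  by apply/funext => t; rewrite /Eop; apply: eq_Rintegral => s _; rewrite upd_upd.
rewrite E [leLHS](Rintegral_prob_cst lam).
have := cauchy_schwarz hs (L2_cst lam 1).
have -> : ip lam (fun t => f (upd x i t)) (fun=> 1) = Eop i f x.
  by apply: eq_Rintegral => t _; rewrite mulr1.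
have -> : ip lam (fun=> 1) (fun=> 1) = 1.
  by rewrite -[RHS](Rintegral_prob_cst lam); apply: eq_Rintegral => t _; rewrite mulr1.
by rewrite mulr1 expr2.
Qed.

Lemma Elt_le m f : tens2 f -> ip cube (Elt m f) (Elt m f) <= ip cube f f.
Proof.
move=> tf; elim: m => //= m IH; case: insub => // i.
by apply: le_trans IH; apply: Eop_le; exact: tens2_Elt.
Qed.

Lemma Mop_le i f : tens2 f -> pi ^+ 2 * ip cube (Mop i f) (Mop i f) <= ip cube f f.
Proof.
move=> tf; apply: (norm_slice_le (i := i)).
- exact: tens2_L2.
- by apply: tens2_L2; exact: tens2_Mop.
move=> x; have hs := tens2_slice x i tf.
have E : (fun t => Mop i f (upd x i t)) = mfprim (fun t => f (upd x i t)).
  apply/funext => t; rewrite /Mop tnth_upd eqxx; congr mfprim.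
  by apply/funext => s; rewrite upd_upd.
by rewrite E; exact: mfprim_le.
Qed.

Lemma Kop_le i f : tens2 f -> pi ^+ 2 * ip cube (Kop i f) (Kop i f) <= ip cube f f.
Proof.
move=> tf; apply: le_trans (Mop_le i tf); apply: ler_wpM2l; first exact: sqr_ge0.
by apply: Elt_le; exact: tens2_Mop.
Qed.

(** [Kop] acts on slices, so this is not immediate: by linearity and [Kop_le], the image of the null
    difference has norm 0. *)
Lemma Kop_ae i f g : tens2 f -> tens2 g -> f = g %[ae cube] -> Kop i f = Kop i g %[ae cube].
Proof.
move=> tf tg fg; pose h x := 1 * f x + -1 * g x.
have th : tens2 h by exact: lspan_lin.
have Kh : Kop i h = fun x => 1 * Kop i f x + -1 * Kop i g x.
  pose c (a : 'I_2) : R := if a == ord0 then 1 else -1.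
  pose F (a : 'I_2) := if a == ord0 then f else g.
  have -> : h = fun x => \sum_(a < 2) c a * F a x.
    by apply/funext => x; rewrite big_ord_recl big_ord1.
  rewrite Kop_sum; last by move=> a; rewrite /F; case: ifP.
  by apply/funext => x; rewrite big_ord_recl big_ord1.
have h0 : ip cube h h = 0.
  apply: ip_eq0_ae; first exact: tens2_L2.
  by apply: filterS fg => x /(_ I) E _; rewrite /h E mulN1r mul1r subrr.
have K0 : ip cube (Kop i h) (Kop i h) = 0.
  apply/eqP; rewrite eq_le ip_ge0 andbT.
  have := Kop_le i th; rewrite h0 pmulr_rle0// exprn_gt0//; exact: pi_gt0.
have := ip_eq0 (tens2_L2 (tens2_Kop i th)) K0; rewrite Kh.
apply: filterS => x H _; have := H I; rewrite mul1r mulN1r => /eqP; by rewrite subr_eq0 => /eqP.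
Qed.

Lemma Eop_Kop0 i f : tens2 f -> Eop i (Kop i f) = fun=> 0.
Proof.
move: f; apply: tens2_ind => [v hv|N c g tg hg].
  have hK j : Kfac i v j \in L2.
    by apply: lowmean_L2; apply: fset_L2 => //; exact: L2_mfprim.
  rewrite Kop_pure// Eop_pure//; apply/funext => x; rewrite pure_fset.
  by rewrite /Kfac /lowmean ltnn /fset eqxx Rintegral_mfprim ?mul0r.
rewrite Kop_sum// Eop_sum; last by move=> a; exact: tens2_Kop.
by apply/funext => x; rewrite big1// => a _; rewrite hg mulr0.
Qed.

Lemma Elt_upd m i f x t : tens2 f -> (i < m)%N -> Elt m f (upd x i t) = Elt m f x.
Proof.
move=> tf im; move: f tf x t.
apply: (@tens2_ind _ _ [set f | forall x t, Elt m f (upd x i t) = Elt m f x]) => [v hv|N c g tg hg] x t.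
  rewrite Elt_pure//; apply: eq_bigr => j _; rewrite tnth_upd.
  by case: eqVneq => // ->; rewrite /lowmean im.
by rewrite Elt_sum//; apply: eq_bigr => a _; rewrite hg.
Qed.

(** For i < j, [Kop j g] has been averaged in x_i and is constant along it, while [Kop i f] has zero
    mean in x_i. *)
Lemma Kop_orth i j f g : tens2 f -> tens2 g -> i != j -> ip cube (Kop i f) (Kop j g) = 0.
Proof.
wlog ij : i j f g / (i < j)%N => [H tf tg|tf tg _].
  by rewrite neq_ltn => /orP[ij|ij]; [|rewrite ipC]; apply: H; rewrite // neq_ltn ij ?orbT.
have LK := tens2_L2 (tens2_Kop i tf).
rewrite (ip_slice i LK); last by apply: tens2_L2; exact: tens2_Kop.
rewrite -[RHS](Rintegral_prob_cst cube); apply: eq_Rintegral => x _.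
have -> : (fun t => Kop j g (upd x i t)) = fun=> Kop j g x.
  by apply/funext => t; rewrite /Kop Elt_upd//; exact: tens2_Mop.
rewrite /ip RintegralZr//; last by apply: L2_integrable; apply: tens2_slice; exact: tens2_Kop.
by rewrite -/(Eop i (Kop i f) x) Eop_Kop0// mul0r.
Qed.

Definition weak_partial j f g := forall phi, test_function phi ->
  \int[cube]_x (g x * phi (to_rV x)) = - \int[cube]_x (f x * partial j phi (to_rV x)).

(** Fubini in coordinate j reduces this to [by_parts_test] on each line, the other factors being the
    constant [P]. *)
Lemma weak_partial_pure j v c q : (forall i, v i \in L2) -> q \in L2 ->
  v j = (fun t => c + prim q t) -> weak_partial j (pure v) (pure (fset v j q)).
Proof.
move=> hv hq vj phi tphi; have tp := test_partial j tphi.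
have hw : forall i, fset v j q i \in L2 by exact: fset_L2.
have i1 := L2M_integrable (L2_pure hw) (L2_test tphi).
have i2 := L2M_integrable (L2_pure hv) (L2_test tp).
rewrite (cube_Rfubini j i1) (cube_Rfubini j i2) -mulN1r -RintegralZl//; last exact: integrable_slice i2.
apply: eq_Rintegral => x _.
have [M1 b1] := test_bounded tphi; have [M2 b2] := test_bounded tp.
pose g (t : R) := phi (to_rV (upd x j t)); pose g' (t : R) := partial j phi (to_rV (upd x j t)).
have dg (t : R) : is_derive t 1 g (g' t).
  by apply: partial_slice; have [sp _ _] := tphi; exact: smooth_derivable.
have cg' : continuous g'.
  have [sp _ _] := tp => t; apply: (is_derive_continuous (l := partial j (partial j phi) (to_rV (upd x j t)))).
  by apply: partial_slice; exact: smooth_derivable.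
have bnd : (g 0 = 0) /\ (g 1 = 0).
  by split; apply: test_out => // /(_ j); rewrite mxE tnth_upd eqxx ltxx ?andbF.
have mg : measurable_fun setT (g : RT -> R).
  by apply: continuous_measurable_fun => t; exact: is_derive_continuous (dg t).
pose M := Num.max M1 M2.
have bg t : `|g t| <= M by rewrite le_max b1.
have bg' t : `|g' t| <= M by rewrite le_max b2 orbT.
have BP := by_parts_test (fun t _ => dg t) cg' c hq bg bg' bnd.1 bnd.2 mg.
have Lg : (g : RT -> R) \in L2 by exact: L2_bounded mg bg.
have Lg' : (g' : RT -> R) \in L2.
  have mg' : measurable_fun setT (g' : RT -> R) by apply: continuous_measurable_fun.
  exact: L2_bounded mg' bg'.
set P := \prod_(i < d | i != j) v i (tnth x i).
transitivity (P * ip lam q g).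
  rewrite /ip -RintegralZl//; last exact: L2M_integrable.
  apply: eq_Rintegral => t _; rewrite pure_upd /fset eqxx -/(g t).
  rewrite (_ : \prod_(_ < d | _) _ = P) ?mulrA ?(mulrC P)//.
  by apply: eq_bigr => i /negbTE ->.
transitivity (-1 * (P * ip lam (fun t => c + prim q t) g')); first by rewrite BP mulrN mulN1r opprK.
congr (_ * _); rewrite -vj /ip -RintegralZl//; last exact: L2M_integrable.
by apply: eq_Rintegral => t _; rewrite pure_upd -/(g' t) -/P mulrA (mulrC P).
Qed.

Lemma weak_partial_sum j N (c : 'I_N -> R) (f g : 'I_N -> X -> R) :
  (forall a, f a \in L2c) -> (forall a, g a \in L2c) -> (forall a, weak_partial j (f a) (g a)) ->
  weak_partial j (fun x => \sum_(a < N) c a * f a x) (fun x => \sum_(a < N) c a * g a x).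
Proof.
move=> hf hg H phi tphi; have tp := test_partial j tphi.
have h1 := L2_test tphi; have h2 := L2_test tp.
rewrite -[LHS]/(ip cube _ _) -[X in _ = - X]/(ip cube _ _).
rewrite !ip_suml//; try by move=> a _; exact: L2Z.
rewrite -sumrN; apply: eq_bigr => a _.
by rewrite ipZl// ipZl// -mulrN; congr (_ * _); exact: H.
Qed.

End CoordinateOperators.

(** * The homotopy operator on sparse tensors *)

Section Homotopy.
Variables (R : realType) (d : nat) (n : nat).
Local Notation RT := (measurableTypeR R).
Local Notation X := (d.-tuple RT).
Local Notation lam := (@lebesgue01 R).
Local Notation cube := (@lebesgue_cube R d).
Local Notation L2 := (Lfun lam 2%:E).
Variable Z : nat -> set (RT -> R).
Hypothesis ZL : forall m q, Z m q -> q \in L2.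
Hypothesis Yc : forall c, Yprim Z 0 (fun=> c).
Implicit Types (v : 'I_d -> RT -> R) (f g : X -> R) (i j : 'I_d) (I : {set 'I_d}).

Definition admissible I v := exists m : 'I_d -> nat,
  [/\ Mset n m, forall i, i \in I -> Z (m i) (v i) & forall i, i \notin I -> Yprim Z (m i) (v i)].

Definition Wsp I : set (X -> R) := lspan [set pure v | v in admissible I].

Lemma admissible_L2 I v : admissible I v -> forall i, v i \in L2.
Proof.
move=> [m [_ h1 h2]] i; case: (boolP (i \in I)) => iI; first exact: ZL (h1 i iI).
apply: (@Yprim_L2 R Z (m i)); [exact: ZL|exact: h2].
Qed.

Lemma Wsp_tens2 I : Wsp I `<=` @tens2 R d.
Proof.
apply: lspan_sub => _ [v /admissible_L2 hv <-]; by exists v.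
Qed.

Lemma Wsp_pure I v : admissible I v -> Wsp I (pure v).
Proof. by move=> hv; apply: lspan_mem; exists v. Qed.

Lemma Kfac_gt i j v : (i < j)%N -> Kfac i v j = v j.
Proof. by move=> ij; rewrite /Kfac /lowmean /fset ltnNge ltnW//= -val_eqE gtn_eqF. Qed.

Lemma Kfac_fset_gt i j v q : (i < j)%N -> Kfac i (fset v j q) = fset (Kfac i v) j q.
Proof.
move=> ij; apply/funext => b; rewrite /Kfac /lowmean /fset.
have ijN : (i == j) = false by rewrite -val_eqE ltn_eqF.
case: (eqVneq b j) => [->|bj]; first by rewrite ltnNge (ltnW ij) /= eq_sym ijN.
by rewrite ijN.
Qed.

Lemma Wsp_deriv I j f : Wsp I f -> j \notin I -> exists2 g, Wsp (j |: I) g &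
  [/\ weak_partial j f g, forall i, (i < j)%N -> weak_partial j (Kop i f) (Kop i g) &
      Kop j g = (fun x => Elt j f x - Elt j.+1 f x)].
Proof.
move=> [N [c [p [hp ->]]]] jI.
have H a : exists g, [/\ Wsp (j |: I) g, weak_partial j (p a) g,
    forall i, (i < j)%N -> weak_partial j (Kop i (p a)) (Kop i g) &
    Kop j g = (fun x => Elt j (p a) x - Elt j.+1 (p a) x)].
  have [v adm <-] := hp a; have hv := admissible_L2 adm.
  have [m [Mm h1 h2]] := adm; have [q [e [Zq _ vj]]] := h2 j jI; have hq := ZL Zq.
  have hw := fset_L2 j hv hq.
  exists (pure (fset v j q)); split.
  - apply: Wsp_pure; exists m; split => // i; rewrite !inE /fset; case: eqP => [->//|_] /=.
      exact: h1.
    exact: h2.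
  - exact: weak_partial_pure vj.
  - move=> i ij; rewrite !Kop_pure// Kfac_fset_gt//; apply: (weak_partial_pure (c := e)) => //.
      by apply: lowmean_L2; apply: fset_L2 => //; exact: L2_mfprim.
    by rewrite (Kfac_gt _ ij).
  - rewrite Kop_pure// !Elt_pure//.
    have -> : lowmean j.+1 v = fset (lowmean j v) j (fun=> \int[lam]_t v j t).
      apply/funext => b; rewrite /lowmean /fset ltnS.
      case: (eqVneq b j) => [->|bj]; first by rewrite leqnn.
      by rewrite leq_eqVlt (inj_eq (@ord_inj d)) (negbTE bj).
    have -> : Kfac j (fset v j q) = fset (lowmean j v) j (mfprim q).
      apply/funext => b; rewrite /Kfac /lowmean /fset eqxx.
      by case: (eqVneq b j) => [->|bj]; rewrite ?ltnn.
    (* In coordinate j: c + prim q minus its mean is [mfprim q], since c cancels. *)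
    apply/funext => x; rewrite !pure_fset (pureE _ j) -mulrBl; congr (_ * _).
    rewrite /lowmean ltnn vj RintegralD//; last 2 first.
    + by apply: L2_integrable; exact: L2_cst.
    + by apply: L2_integrable; exact: L2_prim.
    by rewrite Rintegral_prob_cst /mfprim opprD addrACA subrr add0r.
have [g hg] := choice H.
have tp a : tens2 (p a) by apply: (@Wsp_tens2 I); apply: lspan_mem.
have tg a : tens2 (g a) by have [h _ _ _] := hg a; exact: Wsp_tens2 h.
exists (fun x => \sum_(a < N) c a * g a x).
  by apply: lspan_comb => a; have [] := hg a.
split.
- by apply: weak_partial_sum => a; [exact: tens2_L2|exact: tens2_L2|have [] := hg a].
- move=> i ij; rewrite !Kop_sum//; apply: weak_partial_sum => a.
  + by apply: tens2_L2; exact: tens2_Kop.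
  + by apply: tens2_L2; exact: tens2_Kop.
  + by have [_ _ h _] := hg a; exact: h.
- rewrite Kop_sum// !Elt_sum//; apply/funext => x; rewrite -sumrB; apply: eq_bigr => a _.
  by have [_ _ _ ->] := hg a; rewrite mulrBr.
Qed.

Definition below i I := [forall (b | b \in I), (i < b)%N].

(** The averaged coordinates lie below I, hence carry Y factors, and become constants of level 0.
    Since Y_m has no constants for m > 0, the mean-free primitive in x_i is split into a primitive
    of level m_i and a constant of level 0. *)
Lemma Wsp_Kop I i f : below i I -> Wsp (i |: I) f -> Wsp I (Kop i f).
Proof.
move=> /forall_inP bI [N [c [p [hp ->]]]].
have iI : i \notin I by apply/negP => /bI; rewrite ltnn.
have tp a : tens2 (p a) by apply: (@Wsp_tens2 (i |: I)); apply: lspan_mem.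
rewrite Kop_sum//; apply: lspan_comb => a; have [v adm <-] := hp a.
have hv := admissible_L2 adm; rewrite Kop_pure//.
have [m [Mm h1 h2]] := adm; set q := v i; have Zq : Z (m i) q by apply: h1; rewrite !inE eqxx.
pose w := Kfac i v; pose e := - \int[lam]_t prim q t.
have -> : pure w = fun x => 1 * pure (fset w i (fun t => 0 + prim q t)) x + 1 * pure (fset w i (fun=> e)) x.
  apply/funext => x; rewrite !mul1r !pure_fset (pureE _ i) -mulrDl; congr (_ * _).
  by rewrite /w /Kfac /lowmean ltnn /fset eqxx /mfprim add0r.
have Mle (m' : 'I_d -> nat) : (forall j, (m' j <= m j)%N) -> Mset n m'.
  by move=> le; rewrite /Mset /= (leq_trans _ Mm)//; apply: leq_sum => j _.
have wE j : w j = if (j < i)%N then (fun=> \int[lam]_t v j t) else if j == i then mfprim q else v j.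
  rewrite /w /Kfac /lowmean /fset; case: ifP => // ji.
  by have -> : (j == i) = false by rewrite -val_eqE ltn_eqF.
apply: lspan_lin; apply: Wsp_pure.
(* Levels for the term with [prim q]: coordinate i keeps its level. In the other term i drops to
   level 0 as well. *)
- exists (fun j => if (j < i)%N then 0%N else m j); split.
  + by apply: Mle => j; case: ifP.
  + move=> j jI; have ij := bI j jI; rewrite /fset -val_eqE (gtn_eqF ij) wE ltnNge (ltnW ij) /=.
    by rewrite -val_eqE (gtn_eqF ij); apply: h1; rewrite !inE jI orbT.
  + move=> j jI; rewrite /fset; case: (eqVneq j i) => [->|ji].
      by rewrite ltnn; exists q, 0.
    rewrite wE; case: ifP => // _; rewrite (negbTE ji).
    by apply: h2; rewrite !inE negb_or ji.
- exists (fun j => if (j <= i)%N then 0%N else m j); split.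
  + by apply: Mle => j; case: ifP.
  + move=> j jI; have ij := bI j jI; rewrite /fset -val_eqE (gtn_eqF ij) wE leqNgt ij ltnNge (ltnW ij) /=.
    by rewrite -val_eqE (gtn_eqF ij); apply: h1; rewrite !inE jI orbT.
  + move=> j jI; rewrite /fset; case: (eqVneq j i) => [->|ji].
      by rewrite leqnn; exact: Yc.
    rewrite wE leq_eqVlt (inj_eq (@ord_inj d)) (negbTE ji) /=; case: ifP => // _.
    by apply: h2; rewrite !inE negb_or ji.
Qed.

Lemma weak_partial_Kop_self i f : tens2 f -> weak_partial i (Kop i f) (Elt i f).
Proof.
move=> [N [c [p [hp ->]]]].
have tp a : tens2 (p a) by apply: lspan_mem.
rewrite Kop_sum// Elt_sum//; apply: weak_partial_sum => a.
- by apply: tens2_L2; exact: tens2_Kop.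
- by apply: tens2_L2; exact: tens2_Elt.
have [v hv <-] := hp a; rewrite Kop_pure// Elt_pure//.
have -> : lowmean i v = fset (Kfac i v) i (v i).
  apply/funext => b; rewrite /Kfac /lowmean /fset.
  by case: (eqVneq b i) => [->|bi]; rewrite ?ltnn.
apply: (weak_partial_pure (c := - \int[lam]_t prim (v i) t)) => //.
  by apply: lowmean_L2; apply: fset_L2 => //; exact: L2_mfprim.
by rewrite /Kfac /lowmean ltnn /fset eqxx; apply/funext => t; rewrite addrC.
Qed.

(** [Kop i f] has been averaged in x_j; its factor there is a constant plus the primitive of 0. *)
Lemma weak_partial_Kop_low i j f : tens2 f -> (j < i)%N -> weak_partial j (Kop i f) (fun=> 0).
Proof.
move=> [N [c [p [hp ->]]]] ji.
have tp a : tens2 (p a) by apply: lspan_mem.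
have L0 : (fun _ : RT => 0) \in L2 by exact: L2_cst.
rewrite Kop_sum// (_ : (fun=> 0) = fun x => \sum_(a < N) c a * 0); last first.
  by apply/funext => x; rewrite big1// => a _; rewrite mulr0.
apply: weak_partial_sum => a.
- by apply: tens2_L2; exact: tens2_Kop.
- exact: L2_cst.
have [v hv <-] := hp a; rewrite Kop_pure//.
have -> : (fun=> 0) = pure (fset (Kfac i v) j (fun=> 0)) :> (X -> R).
  by apply/funext => x; rewrite pure_fset mul0r.
apply: (weak_partial_pure (c := \int[lam]_t v j t)) => //.
  by apply: lowmean_L2; apply: fset_L2 => //; exact: L2_mfprim.
have jiN : (j == i) = false by rewrite -val_eqE ltn_eqF.
by rewrite /Kfac /lowmean ji /fset jiN; apply/funext => t; rewrite /prim ip0l addr0.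
Qed.

(** No sign appears, since i precedes I. For empty I the condition is vacuous and all i
    contribute. *)
Definition Kform (h : dform R d) : dform R d :=
  fun I x => \sum_(i | below i I) Kop i (h (i |: I)) x.

End Homotopy.

(** * The homotopy formula and the norm of the homotopy operator *)

Section HomotopyFormula.
Variables (R : realType) (d : nat) (n : nat).
Local Notation RT := (measurableTypeR R).
Local Notation X := (d.-tuple RT).
Local Notation lam := (@lebesgue01 R).
Local Notation cube := (@lebesgue_cube R d).
Local Notation L2 := (Lfun lam 2%:E).
Local Notation L2c := (Lfun cube 2%:E).
Variable Z : nat -> set (RT -> R).
Hypothesis ZL : forall m q, Z m q -> q \in L2.
Hypothesis Yc : forall c, Yprim Z 0 (fun=> c).
Implicit Types (v : 'I_d -> RT -> R) (f g : X -> R) (i j a : 'I_d) (I J : {set 'I_d}).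
Local Notation W := (@Wsp R d n Z).

Lemma dsign_below i I : (forall b, b \in I -> (i <= b)%N) -> dsign R i I = 1.
Proof.
move=> H; rewrite /dsign eq_card0// => b.
by rewrite !inE; apply/negP => /andP[/H]; rewrite leqNgt => /negP.
Qed.

Lemma dsign_setU1 i j I : (i < j)%N -> i \notin I -> dsign R j (i |: I) = - dsign R j I.
Proof.
move=> ij iI; rewrite /dsign.
have -> : [set b in i |: I | (b < j)%N] = i |: [set b in I | (b < j)%N].
  by apply/setP => b; rewrite !inE; case: (eqVneq b i) => [->|_] //=; rewrite ij.
by rewrite cardsU1 !inE (negbTE iI) /= exprS mulN1r.
Qed.

Lemma dsign_min a I : (forall b, b \in I -> (a <= b)%N) -> dsign R a (I :\ a) = 1.
Proof. by move=> H; apply: dsign_below => b; rewrite !inE => /andP[_ /H]. Qed.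

Lemma W_tens2 I f : W I f -> tens2 f.
Proof. exact: (@Wsp_tens2 R d n Z ZL). Qed.

Section Closed.
Variables (l : nat) (h : dform R d).
Hypothesis hW : forall J, #|J| = l.+1 -> W J (h J).
Hypothesis hclosed : weak_ext_deriv l.+1 h 0.

Let derivs : exists G : 'I_d -> {set 'I_d} -> X -> R, (forall j I, tens2 (G j I)) /\
  forall j I, #|I| = l.+1 -> j \notin I ->
  [/\ weak_partial j (h I) (G j I),
      forall i, (i < j)%N -> weak_partial j (Kop i (h I)) (Kop i (G j I)) &
      Kop j (G j I) = (fun x => Elt j (h I) x - Elt j.+1 (h I) x)].
Proof.
have t0 : tens2 (fun _ : X => 0).
  by exists 0%N, (fun=> 0), (fun=> fun=> 0); split; [case|apply/funext => x; rewrite big_ord0].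
have H (p : 'I_d * {set 'I_d}) : exists g, tens2 g /\ (#|p.2| = l.+1 -> p.1 \notin p.2 ->
  [/\ weak_partial p.1 (h p.2) g,
      forall i, (i < p.1)%N -> weak_partial p.1 (Kop i (h p.2)) (Kop i g) &
      Kop p.1 g = (fun x => Elt p.1 (h p.2) x - Elt p.1.+1 (h p.2) x)]).
  have [cI|cI] := pselect (#|p.2| = l.+1); last by exists (fun=> 0); split.
  have [jI|jI] := boolP (p.1 \in p.2); first by exists (fun=> 0); split.
  have [g Wg Hg] := Wsp_deriv ZL (hW cI) jI.
  by exists g; split => //; exact: W_tens2 Wg.
have [G HG] := choice H; exists (fun j I => G (j, I)); split; first by move=> j I; have [] := HG (j, I).
by move=> j I; have [_] := HG (j, I).
Qed.

(** Fix I with minimum a. In (d K h)_I the terms with i < a combine, by closedness of h on i |: I,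
    into K_i of the i-th derivative of h_I, that is [Elt i] minus [Elt i.+1] of h_I; their sum over
    i < a is h_I minus [Elt a] of it. The terms with i >= a occur only for j = a: i = a gives back
    [Elt a] of h_I and i > a gives 0. *)
Lemma homotopy_formula : weak_ext_deriv l (Kform h) h.
Proof.
have [G [tG HG]] := derivs.
(* Weak closedness becomes an almost-everywhere identity between the tensors [G], to which [Kop] can
   be applied. *)
have closed J : #|J| = l.+2 ->
    (fun x => \sum_(j in J) dsign R j (J :\ j) * G j (J :\ j) x) = (fun=> 0) %[ae cube].
  move=> cJ; apply: test_vanish_ae.
    by apply: L2_sum => j _; apply: L2Z; exact: tens2_L2.
  move=> phi tphi; rewrite -[LHS]/(ip cube _ _) ip_suml; last 2 first.
  - by move=> j _; apply: L2Z; exact: tens2_L2.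
  - exact: L2_test.
  have := hclosed cJ tphi; rewrite -[X in X = _ -> _]/(ip cube (fun=> 0) _) ip0l => /esym/eqP.
  rewrite oppr_eq0 => /eqP E; apply/eqP; rewrite -oppr_eq0 -[X in _ == X]E; apply/eqP.
  rewrite -sumrN; apply: eq_bigr => j jJ.
  have cJj : #|J :\ j| = l.+1 by move: cJ; rewrite (cardsD1 j) jJ add1n => -[].
  have [w _ _] := HG j (J :\ j) cJj (negbT (setD11 _ _)).
  rewrite ipZl; [|exact: tens2_L2|exact: L2_test].
  by rewrite -mulrN /ip w// opprK.
move=> I cI phi tphi.
have tI : tens2 (h I) by exact: W_tens2 (hW cI).
have [a aI amin] : exists2 a, a \in I & forall b, b \in I -> (a <= b)%N.
  have [i0 i0I] : exists i0, i0 \in I by apply/set0Pn; rewrite -card_gt0 cI.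
  by case: (arg_minnP (fun b : 'I_d => nat_of_ord b) i0I) => a aI am; exists a.
have belowa i : (i < a)%N -> below i I.
  by move=> ia; apply/forall_inP => b bI; rewrite (leq_trans ia)// amin.
have belowD i j : (i < a)%N -> below i (I :\ j).
  by move=> ia; apply/forall_inP => b; rewrite !inE => /andP[_ bI]; rewrite (leq_trans ia)// amin.
have niI i : (i < a)%N -> i \notin I.
  by move=> ia; apply/negP => iI; have := amin i iI; rewrite leqNgt ia.
have cD j : j \in I -> #|I :\ j| = l by move=> jI; move: cI; rewrite (cardsD1 j) jI add1n => -[].
have cU i j : j \in I -> below i (I :\ j) -> #|i |: I :\ j| = l.+1.
  move=> jI /forall_inP bl; rewrite cardsU1 (cD j jI) (_ : i \notin _) ?add1n//.
  by apply/negP => /bl; rewrite ltnn.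
(* The weak j-th derivative of K_i h_(i |: I :\ j), in the three cases i < a, i = a and i > a. *)
pose D i j : X -> R := if (i < a)%N then Kop i (G j (i |: I :\ j))
  else if i == a then Elt a (h I) else (fun=> 0).
have tD i j : tens2 (D i j).
  rewrite /D; case: ifP => _; first exact: tens2_Kop.
  case: ifP => _; first exact: tens2_Elt.
  by exists 0%N, (fun=> 0), (fun=> fun=> 0); split; [case|apply/funext => x; rewrite big_ord0].
have wD i j : j \in I -> below i (I :\ j) -> weak_partial j (Kop i (h (i |: I :\ j))) (D i j).
  move=> jI bl; rewrite /D; case: (ltnP i a) => [ia|ai].
    have ij : (i < j)%N by rewrite (leq_trans ia)// amin.
    have jN : j \notin i |: I :\ j by rewrite !inE eqxx /= orbF -val_eqE gtn_eqF.
    by have [_ H _] := HG j _ (cU i j jI bl) jN; exact: H.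
  (* An i >= a can lie below I :\ j only if a itself was removed. *)
  have ja : j = a.
    apply/eqP; apply: contraT => ja; have /forall_inP/(_ a) := bl.
    by rewrite !inE aI eq_sym ja /= ltnNge ai => /(_ isT).
  rewrite ja in bl *; case: eqVneq => [->|ia]; first by rewrite finset.setD1K//; exact: weak_partial_Kop_self.
  apply: weak_partial_Kop_low; first by apply: W_tens2; apply: hW; apply: cU.
  by rewrite ltn_neqAle ai andbT eq_sym.
have E1 j : j \in I -> \int[cube]_x (Kform h (I :\ j) x * partial j phi (to_rV x)) =
    - \sum_(i | below i (I :\ j)) \int[cube]_x (D i j x * phi (to_rV x)).
  move=> jI; rewrite -[LHS]/(ip cube _ _) /Kform ip_suml; last 2 first.
  - by move=> i bl; apply: tens2_L2; apply: tens2_Kop; apply: W_tens2; apply: hW; apply: cU.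
  - exact: L2_test (test_partial j tphi).
  rewrite -sumrN; apply: eq_bigr => i bl.
  by rewrite (wD i j jI bl phi tphi) opprK.
pose S (x : X) := \sum_(j in I) dsign R j (I :\ j) * \sum_(i | below i (I :\ j)) D i j x.
have LD i j : D i j \in L2c by exact: tens2_L2.
have LS j : (fun x => \sum_(i | below i (I :\ j)) D i j x) \in L2c by apply: L2_sum.
have -> : - (\sum_(j in I) dsign R j (I :\ j) *
    \int[cube]_x (Kform h (I :\ j) x * partial j phi (to_rV x))) =
    \int[cube]_x (S x * phi (to_rV x)).
  rewrite -[RHS]/(ip cube _ _) /S ip_suml; last 2 first.
  - by move=> j _; exact: L2Z.
  - exact: L2_test.
  rewrite -sumrN; apply: eq_bigr => j jI; rewrite E1// mulrN opprK ipZl//; last exact: L2_test.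
  by congr (_ * _); rewrite ip_suml//; exact: L2_test.
have Lh : h I \in L2c by exact: tens2_L2.
apply: ip_ae => //; [by apply: L2_sum => j _; exact: L2Z|exact: L2_test|exact: L2_test| |exact: aeW].
pose c j : R := if j \in I then dsign R j (I :\ j) else 0.
pose Q i (x : X) := \sum_(j < d) c j * Kop i (G j (i |: I :\ j)) x.
have SE x : S x = Elt a (h I) x + \sum_(i < d | (i < a)%N) Q i x.
  have Sj j : j \in I -> \sum_(i | below i (I :\ j)) D i j x =
      (if j == a then Elt a (h I) x else 0) + \sum_(i < d | (i < a)%N) Kop i (G j (i |: I :\ j)) x.
    move=> jI; rewrite (bigID (fun i : 'I_d => (i < a)%N)) /= addrC; congr (_ + _); last first.
      apply: eq_big => [i|i /andP[_ ia]]; last by rewrite /D ia.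
      by case: (ltnP i a) => [/(belowD i j) ->//|_]; rewrite andbF.
    case: eqVneq => [->|ja].
      rewrite (bigD1 a)/=; last first.
        rewrite ltnn andbT; apply/forall_inP => b; rewrite !inE => /andP[ba bI].
        by rewrite ltn_neqAle eq_sym ba amin.
      rewrite /D ltnn eqxx big1 ?addr0// => i /andP[/andP[_ /negbTE ->] /negbTE ->].
      by [].
    rewrite big1// => i /andP[/forall_inP bl /negP ia]; exfalso; apply: ia; apply: bl.
    by rewrite !inE aI eq_sym ja.
  rewrite /S (eq_bigr (fun j => (if j == a then Elt a (h I) x else 0) +
     dsign R j (I :\ j) * \sum_(i < d | (i < a)%N) Kop i (G j (i |: I :\ j)) x)); last first.
    move=> j jI; rewrite Sj// mulrDr; congr (_ + _); case: eqVneq => [->|_]; last by rewrite mulr0.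
    by rewrite dsign_min ?mul1r.
  rewrite big_split /=; congr (_ + _).
    by rewrite (bigD1 a)//= eqxx big1 ?addr0// => j /andP[_ /negbTE ->].
  under eq_bigr do rewrite mulr_sumr.
  rewrite exchange_big /=; apply: eq_bigr => i _.
  rewrite /Q [RHS](bigID (mem I)) /= [X in _ + X]big1 ?addr0; last first.
    by move=> j /negbTE jI; rewrite /c jI mul0r.
  by apply: eq_bigr => j jI; rewrite /c jI.
(* Closedness on i |: I, where i has sign 1 and each other sign flips because i now precedes j,
   equates the sum over j with [G i I]. *)
have QE i : (i < a)%N -> Q i = (fun x => Elt i (h I) x - Elt i.+1 (h I) x) %[ae cube].
  move=> ia; have [_ _ KE] := HG i I cI (niI i ia).
  suff K : Q i = Kop i (G i I) %[ae cube] by apply: filterS K => x K _; rewrite K// KE.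
  have -> : Q i = Kop i (fun x => \sum_(j < d) c j * G j (i |: I :\ j) x) by rewrite Kop_sum.
  apply: Kop_ae; [by apply: lspan_comb => j; exact: tG|exact: tG|].
  have := closed (i |: I); rewrite cardsU1 (niI i ia) cI add1n => /(_ erefl).
  apply: filterS => x H _; have := H Logic.I.
  rewrite big_setU1 ?niI//= finset.setU1K ?niI// dsign_below; last first.
    by move=> b bI; rewrite ltnW// (leq_trans ia)// amin.
  rewrite mul1r => /eqP; rewrite addr_eq0 => /eqP ->; rewrite -sumrN.
  rewrite [LHS](bigID (mem I)) /= [X in _ + X]big1 ?addr0; last first.
    by move=> j /negbTE jI; rewrite /c jI mul0r.
  apply: eq_bigr => j jI; have ij : (i < j)%N by rewrite (leq_trans ia)// amin.
  have ijN : i != j by rewrite -val_eqE ltn_eqF.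
  have E : (i |: I) :\ j = i |: I :\ j.
    by apply/setP => b; rewrite !inE; case: (eqVneq b i) => [->|_] /=; rewrite ?ijN.
  rewrite /c jI E dsign_setU1// ?mulNr ?opprK//.
  by rewrite !inE negb_and (niI i ia) orbT.
have QA : {ae cube, forall x, forall i, (i < a)%N -> Q i x = Elt i (h I) x - Elt i.+1 (h I) x}.
  apply: filter_forall => i; case: (ltnP i a) => ia; last by apply: aeW.
  by apply: filterS (QE i ia) => x /(_ Logic.I).
apply: filterS QA => x H _; rewrite SE (eq_bigr _ H).
rewrite -(big_mkord (fun k : nat => (k < a)%N) (fun k : nat => Elt k (h I) x - Elt k.+1 (h I) x)).
have ad : (a <= d)%N by exact: ltnW.
rewrite -(@big_nat_widen _ _ _ 0%N _ _ xpredT _ ad).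
rewrite (eq_bigr (fun k : nat => - Elt k.+1 (h I) x - - Elt k (h I) x)); last by move=> k _; rewrite opprK addrC.
rewrite (telescope_sumr (fun k : nat => - Elt k (h I) x))//=.
by rewrite opprK addrA subrr add0r.
Qed.

Lemma Kform_W I : #|I| = l -> W I (Kform h I).
Proof.
move=> cI; rewrite /Kform.
pose c i : R := (below i I)%:R.
pose F i : X -> R := if below i I then Kop i (h (i |: I)) else fun=> 0.
rewrite (_ : (fun x => _) = fun x => \sum_(i < d) c i * F i x); last first.
  apply/funext => x; rewrite big_mkcond; apply: eq_bigr => i _.
  by rewrite /c /F; case: ifP => _; rewrite ?mul1r ?mul0r.
apply: lspan_comb => i; rewrite /F; case: ifP => bl; last first.
  by exists 0%N, (fun=> 0), (fun=> fun=> 0); split; [case|apply/funext => x; rewrite big_ord0].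
apply: (Wsp_Kop ZL Yc bl); apply: hW; rewrite cardsU1 cI.
by have -> : i \notin I; [apply/negP => /(forall_inP bl); rewrite ltnn|].
Qed.

(** The summands of each coefficient are orthogonal, so squares add without a factor d. Each h_J is
    then used at most once: J = i |: I with i below I forces i = min J. *)
Lemma Kform_le : pi ^+ 2 * inner l (Kform h) (Kform h) <= inner l.+1 h h.
Proof.
pose H J := ip cube (h J) (h J).
have H0 J : 0 <= H J by exact: ip_ge0.
have cU I i : #|I| = l -> below i I -> #|i |: I| = l.+1.
  move=> cI bl; rewrite cardsU1 cI.
  by have -> : i \notin I; [apply/negP => /(forall_inP bl); rewrite ltnn|].
apply: (@le_trans _ _ (\sum_(I : {set 'I_d} | #|I| == l) \sum_(i | below i I) H (i |: I))).
  rewrite /inner mulr_sumr; apply: ler_sum => I /eqP cI.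
  have tK i : below i I -> tens2 (h (i |: I)) by move=> bl; apply: W_tens2; apply: hW; apply: cU.
  have LK i : below i I -> Kop i (h (i |: I)) \in L2c.
    by move=> bl; apply: tens2_L2; apply: tens2_Kop; exact: tK.
  have -> : \int[cube]_x (Kform h I x * Kform h I x) =
      \sum_(i | below i I) ip cube (Kop i (h (i |: I))) (Kop i (h (i |: I))).
    rewrite -[LHS]/(ip cube _ _) {1}/Kform ip_suml; [|exact: LK|exact: L2_sum].
    apply: eq_bigr => i bi; rewrite ipC /Kform ip_suml; [|exact: LK|exact: LK].
    rewrite (bigD1 i)//= big1 ?addr0// => j /andP[bj ji].
    by apply: Kop_orth => //; exact: tK.
  by rewrite mulr_sumr; apply: ler_sum => i bi; apply: Kop_le; exact: tK.
rewrite [leLHS](exchange_big_dep xpredT)//=.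
have E i : \sum_(I : {set 'I_d} | (#|I| == l) && below i I) H (i |: I) =
    \sum_(J : {set 'I_d} | [&& #|J| == l.+1, i \in J & below i (J :\ i)]) H J.
  rewrite [RHS](reindex_onto (fun I => i |: I) (fun J => J :\ i)) /=; last first.
    by move=> J /and3P[_ iJ _]; rewrite finset.setD1K.
  apply: eq_bigl => I; rewrite !inE eqxx /=.
  case: (boolP (i \in I)) => iI.
    have -> : below i I = false by apply/negP => /forall_inP/(_ i iI); rewrite ltnn.
    rewrite andbF; apply/esym/negP => /andP[_ /eqP E].
    by move: iI; rewrite -E !inE eqxx.
  by rewrite finset.setU1K// eqxx andbT cardsU1 iI add1n eqSS.
rewrite (eq_bigr _ (fun i _ => E i)) (exchange_big_dep (fun J : {set 'I_d} => #|J| == l.+1))/=; last first.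
  by move=> i J _ /and3P[].
rewrite /inner; apply: ler_sum => J /eqP cJ; rewrite -/(ip cube (h J) (h J)) -/(H J).
rewrite (eq_bigl (fun i => (i \in J) && below i (J :\ i))); last by move=> i; rewrite cJ eqxx.
case: (pickP (fun i => (i \in J) && below i (J :\ i))) => [i /andP[iJ bi]|none]; last first.
  by rewrite big1// => i; rewrite none.
rewrite (bigD1 i)/=; last by rewrite iJ.
rewrite big1 ?addr0// => j /andP[/andP[jJ bj] ji].
have /forall_inP/(_ j) := bi; have /forall_inP/(_ i) := bj.
rewrite !inE iJ jJ ji eq_sym ji /= => /(_ isT) h1 /(_ isT) h2.
by have := ltn_trans h1 h2; rewrite ltnn.
Qed.

End Closed.
End HomotopyFormula.

(** * Orthogonal projection onto finite-dimensional spaces *)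

Section FiniteProjection.
Variables (R : rcfType) (U : lmodType R) (L : U -> Prop) (B : U -> U -> R).
Hypothesis L_lin : forall a u v, L u -> L v -> L (a *: u + v).
Hypothesis BC : forall u v, B u v = B v u.
Hypothesis B_lin : forall a u v w, L u -> L v -> L w -> B (a *: u + v) w = a * B u w + B v w.
Hypothesis B_ge0 : forall u, 0 <= B u u.

Lemma B_linr a u v w : L u -> L v -> L w -> B w (a *: u + v) = a * B w u + B w v.
Proof. by move=> Lu Lv Lw; rewrite BC B_lin// (BC u) (BC v). Qed.

Lemma B_sub u v w : L u -> L v -> L w -> B (u - v) w = B u w - B v w.
Proof. by move=> Lu Lv Lw; rewrite addrC -scaleN1r B_lin// mulN1r addrC. Qed.

Lemma L_sub u v : L u -> L v -> L (u - v).
Proof. by move=> Lu Lv; rewrite addrC -scaleN1r; exact: L_lin. Qed.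

(** [B] is only semidefinite, vectors being functions rather than classes. Otherwise t would make
    the squared norm of t z + u equal to -1. *)
Lemma B_null z u : L z -> L u -> B z z = 0 -> B z u = 0.
Proof.
move=> Lz Lu z0; apply/eqP; apply: contraT => bN.
pose t := - (B u u + 1) / (2 * B z u).
have := B_ge0 (t *: z + u); have Lt := L_lin t Lz Lu.
rewrite B_lin// !B_linr// z0 (BC u z).
rewrite (_ : _ + _ = -1); first by rewrite lerNr oppr0 ler10.
by rewrite /t; field.
Qed.

Variable E : U -> Prop.
Hypothesis EL : forall u, E u -> L u.
Hypothesis E0 : E 0.
Hypothesis E_lin : forall a u v, E u -> E v -> E (a *: u + v).

Lemma E_sum n (c : 'I_n -> R) (e : 'I_n -> U) : (forall i, E (e i)) -> E (\sum_(i < n) c i *: e i).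
Proof.
move=> he; apply: (big_ind E) => // [u v Eu Ev|i _].
  by rewrite -[u]scale1r; exact: E_lin.
by rewrite -[_ *: _]addr0; exact: E_lin.
Qed.

Lemma L_sum (F : finType) (c : F -> R) (e : F -> U) : (forall i, L (e i)) -> L (\sum_i c i *: e i).
Proof.
move=> he; apply: (big_ind L) => [|u v Eu Ev|i _]; first exact: EL.
  by rewrite -[u]scale1r; exact: L_lin.
by rewrite -[_ *: _]addr0; apply: L_lin => //; exact: EL.
Qed.

Lemma B_suml (F : finType) (c : F -> R) (e : F -> U) w : (forall i, L (e i)) -> L w ->
  B (\sum_i c i *: e i) w = \sum_i c i * B (e i) w.
Proof.
move=> he Lw; have L0 : L 0 by exact: EL.
have B0 : B 0 w = 0.
  by have := B_sub L0 L0 Lw; rewrite !subrr.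
suff [_] : L (\sum_i c i *: e i) /\ B (\sum_i c i *: e i) w = \sum_i c i * B (e i) w by [].
apply: (big_rec2 (fun u r => L u /\ B u w = r)) => // i r u _ [Lu <-].
by split; [exact: L_lin|rewrite B_lin].
Qed.

Definition orthonormal n (e : 'I_n -> U) := (forall i, E (e i)) /\ forall i j, B (e i) (e j) = (i == j)%:R.

(** Gram-Schmidt: either the remainder [z] is null, or normalising it lengthens the family. *)
Lemma orthonormal_extend n (e : 'I_n -> U) v : orthonormal e -> E v ->
  let z := v - \sum_(i < n) B v (e i) *: e i in
  [/\ E z, forall i, B z (e i) = 0 & B z z = 0 \/ exists e' : 'I_n.+1 -> U, orthonormal e'].
Proof.
move=> [Ee eo] Ev z; have Le i := EL (Ee i).
have Ez : E z.
  by rewrite /z addrC -scaleN1r; apply: E_lin => //; exact: E_sum.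
have Lz := EL Ez.
have ze i : B z (e i) = 0.
  rewrite /z B_sub ?B_suml//; try exact: EL; last exact: L_sum.
  rewrite (bigD1 i)//= eo eqxx mulr1 big1 ?addr0 ?subrr// => j ji.
  by rewrite eo (negbTE ji) mulr0.
split => //; have [->|zN] := eqVneq (B z z) 0; [by left|right].
have z0 : 0 < B z z by rewrite lt_def zN B_ge0.
pose s := (Num.sqrt (B z z))^-1; pose u := s *: z.
have s2 : s * s * B z z = 1.
  by rewrite -invfM -expr2 sqr_sqrtr ?B_ge0// mulVf.
have L0 : L 0 by exact: EL.
have B0 w : L w -> B 0 w = 0 by move=> Lw; have := B_sub L0 L0 Lw; rewrite !subrr.
have Bs w : L w -> B u w = s * B z w.
  by move=> Lw; rewrite /u -[s *: z]addr0 B_lin// B0// addr0.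
have Eu : E u by rewrite /u -[s *: z]addr0; exact: E_lin.
have uu : B u u = 1 by rewrite Bs ?(BC z) ?Bs//; [rewrite mulrA|exact: EL].
have ue i : B u (e i) = 0 by rewrite Bs// ze mulr0.
exists (fun i => if unlift ord_max i is Some j then e j else u); split.
  by move=> i; case: unliftP.
move=> i j; case: unliftP => [i' ->|->]; case: unliftP => [j' ->|->].
- by rewrite (inj_eq lift_inj).
- by rewrite BC ue eq_sym (negbTE (neq_lift _ _)).
- by rewrite ue (negbTE (neq_lift _ _)).
- by rewrite uu eqxx.
Qed.

Variables (F : finType) (g : F -> U).
Hypothesis Lg : forall i, L (g i).
Hypothesis Eg : forall v, E v -> exists c : F -> R,
  let z := v - \sum_i c i *: g i in B z z = 0.

(** Up to null vectors the e_i are combinations of the g_a, so the Gram matrix, the identity of size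
    n, factors through dimension [#|F|]. *)
Lemma orthonormal_card n (e : 'I_n -> U) : orthonormal e -> (n <= #|F|)%N.
Proof.
move=> [Ee eo]; have Le i := EL (Ee i).
have [c hc] := choice (fun i => Eg (Ee i)).
have LS i : L (\sum_a c i a *: g a) by exact: L_sum.
have Be i w : L w -> B (e i) w = \sum_a c i a * B (g a) w.
  move=> Lw; rewrite -B_suml//; apply/eqP; rewrite -subr_eq0 -B_sub//.
  by rewrite B_null//; exact: L_sub.
pose C : 'M[R]_(n, #|F|) := \matrix_(i, a) c i (enum_val a).
pose D : 'M[R]_(#|F|, n) := \matrix_(a, j) B (g (enum_val a)) (e j).
have CD : C *m D = 1%:M.
  apply/matrixP => i j; rewrite !mxE -eo Be// (reindex (@enum_val F F)); last exact: onW_bij (@enum_val_bij F).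
  by apply: eq_bigr => a _; rewrite !mxE.
by rewrite -(mxrank1 R n) -CD (leq_trans (mxrankM_maxl _ _))// rank_leq_col.
Qed.

(** Project on a longest orthonormal family: by maximality every v in E is in its span up to a null
    vector, which is orthogonal to everything. *)
Lemma projection_exists w : L w -> exists p, E p /\ forall v, E v -> B (w - p) v = 0.
Proof.
move=> Lw; pose P n := `[< exists e : 'I_n -> U, orthonormal e >].
have P0 : exists n, P n.
  exists 0%N; apply/asboolP; exists (fun=> 0); split; first by case.
  by case.
have Pb n : P n -> (n <= #|F|)%N by move=> /asboolP[e]; exact: orthonormal_card.
case: (ex_maxnP P0 Pb) => n /asboolP[e oe] nmax.
have [Ee eo] := oe; have Le i := EL (Ee i).
pose p := \sum_(i < n) B w (e i) *: e i.
have Ep : E p by exact: E_sum.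
exists p; split => // v Ev.
have Lp := EL Ep; have Lwp : L (w - p) by exact: L_sub.
have pe i : B (w - p) (e i) = 0.
  rewrite B_sub// /p B_suml// (bigD1 i)//= eo eqxx mulr1 big1 ?addr0 ?subrr// => j ji.
  by rewrite eo (negbTE ji) mulr0.
have [Ez _ [z0|[e' oe']]] := orthonormal_extend oe Ev; last first.
  have : (n.+1 <= n)%N by apply: nmax; apply/asboolP; exists e'.
  by rewrite ltnn.
set z := v - _ in Ez z0; have Lz := EL Ez; have Ls : L (\sum_(i < n) B v (e i) *: e i) by exact: L_sum.
have -> : v = z + \sum_(i < n) B v (e i) *: e i by rewrite subrK.
rewrite BC -[z]scale1r B_lin// mul1r B_null// add0r B_suml// big1// => i _.
by rewrite (BC (e i)) pe mulr0.
Qed.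

End FiniteProjection.

(** * The weak exterior derivative *)

Section WeakExteriorDerivative.
Variables (R : realType) (d : nat).
Local Notation RT := (measurableTypeR R).
Local Notation X := (d.-tuple RT).
Local Notation cube := (@lebesgue_cube R d).
Implicit Types (l : nat) (u v w h : dform R d) (i j : 'I_d) (I J : {set 'I_d}).

Lemma L2form_lin l a u v : L2form l u -> L2form l v -> L2form l (a *: u + v : dform R d).
Proof. by move=> hu hv I cI; apply: L2D; [apply: L2Z; exact: hu|exact: hv]. Qed.

Lemma L2form0 l : L2form l (0 : dform R d).
Proof. by move=> I _; exact: L2_cst. Qed.

Lemma innerC l u v : inner l u v = inner l v u.
Proof. by apply: eq_bigr => I _; exact: ipC. Qed.

Lemma inner_lin l a u v w : L2form l u -> L2form l v -> L2form l w ->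
  inner l (a *: u + v : dform R d) w = a * inner l u w + inner l v w.
Proof.
move=> hu hv hw; rewrite /inner mulr_sumr -big_split /=; apply: eq_bigr => I /eqP cI.
rewrite -[LHS]/(ip cube (fun x => a * u I x + v I x) (w I)).
by rewrite ipDl ?ipZl//; [exact: hu|exact: hw|apply: L2Z; exact: hu|exact: hv|exact: hw].
Qed.

Lemma inner_ge0 l u : 0 <= inner l u u.
Proof. by apply: sumr_ge0 => I _; exact: ip_ge0. Qed.

Lemma form_ae_eq_sym l u v : form_ae_eq l u v -> form_ae_eq l v u.
Proof. by move=> h I cI; apply: filterS (h I cI) => x E /E ->. Qed.

Lemma form_ae_eq_trans l u v w : form_ae_eq l u v -> form_ae_eq l v w -> form_ae_eq l u w.
Proof. by move=> h1 h2 I cI; apply: filterS2 (h1 I cI) (h2 I cI) => x E1 E2 _; rewrite E1// E2. Qed.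

Lemma form_ae_eq_refl l u : form_ae_eq l u u.
Proof. by move=> I _; exact: aeW. Qed.

Lemma inner_ae l u u' v v' : L2form l u -> L2form l u' -> L2form l v -> L2form l v' ->
  form_ae_eq l u u' -> form_ae_eq l v v' -> inner l u v = inner l u' v'.
Proof.
move=> hu hu' hv hv' uu vv; apply: eq_bigr => I /eqP cI.
by apply: (@ip_ae _ _ _ cube); [exact: hu|exact: hu'|exact: hv|exact: hv'|exact: uu|exact: vv].
Qed.

Lemma inner_eq0 l u : L2form l u -> inner l u u = 0 -> form_ae_eq l u 0.
Proof.
move=> hu /eqP; rewrite psumr_eq0; last by move=> I _; exact: ip_ge0.
move=> /allP H I cI; have := H I (mem_index_enum _); rewrite cI eqxx /= => /eqP.
exact: ip_eq0 (hu I cI).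
Qed.

Lemma weak_ext_deriv_ae l w w' h h' : L2form l w -> L2form l w' -> L2form l.+1 h -> L2form l.+1 h' ->
  form_ae_eq l w w' -> form_ae_eq l.+1 h h' -> weak_ext_deriv l w h -> weak_ext_deriv l w' h'.
Proof.
move=> hw hw' hh hh' ww hhE W J cJ phi tphi.
have Lp := L2_test tphi; have Lq j := L2_test (test_partial j tphi).
rewrite -[LHS]/(ip cube _ _) (ip_ae (hh' J cJ) (hh J cJ) Lp Lp (form_ae_eq_sym hhE cJ) (aeW _ _))//.
rewrite {1}/ip (W J cJ phi tphi); congr (- _); apply: eq_bigr => j jJ; congr (_ * _).
have cD : #|J :\ j| = l by move: cJ; rewrite (cardsD1 j) jJ add1n => -[].
by apply: (ip_ae (hw _ cD) (hw' _ cD) (Lq j) (Lq j) (ww _ cD)); exact: aeW.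
Qed.

Lemma weak_ext_deriv_lin l a w w' h h' : L2form l w -> L2form l w' -> L2form l.+1 h -> L2form l.+1 h' ->
  weak_ext_deriv l w h -> weak_ext_deriv l w' h' ->
  weak_ext_deriv l (a *: w + w' : dform R d) (a *: h + h' : dform R d).
Proof.
move=> hw hw' hh hh' W W' J cJ phi tphi.
have Lp := L2_test tphi; have Lq j := L2_test (test_partial j tphi).
rewrite -[LHS]/(ip cube (fun x => a * h J x + h' J x) _).
rewrite (ipDl (L2Z a (hh J cJ)) (hh' J cJ) Lp) (ipZl _ (hh J cJ) Lp) {1 2}/ip W// W'//.
rewrite mulrN -opprD; congr (- _); rewrite mulr_sumr -big_split /=; apply: eq_bigr => j jJ.
have cD : #|J :\ j| = l by move: cJ; rewrite (cardsD1 j) jJ add1n => -[].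
rewrite -[X in _ = _ * X]/(ip cube (fun x => a * w (J :\ j) x + w' (J :\ j) x) _).
rewrite (ipDl (L2Z a (hw _ cD)) (hw' _ cD) (Lq j)) (ipZl _ (hw _ cD) (Lq j)) mulrDr.
by rewrite mulrCA.
Qed.

(** Makes [ext_d], a mere choice, agree almost everywhere with any weak derivative at hand. *)
Lemma weak_ext_deriv_unique l w h h' : L2form l.+1 h -> L2form l.+1 h' ->
  weak_ext_deriv l w h -> weak_ext_deriv l w h' -> form_ae_eq l.+1 h h'.
Proof.
move=> hh hh' W W' J cJ.
have LB := L2B (hh J cJ) (hh' J cJ).
have : (fun x => h J x - h' J x) = (fun=> 0) %[ae cube].
  apply: test_vanish_ae => // phi tphi; have Lp := L2_test tphi.
  rewrite -[LHS]/(ip cube _ _) (ipBl (hh J cJ) (hh' J cJ) Lp).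
  by rewrite /ip W// W'// subrr.
by apply: filterS => x E _; apply/eqP; rewrite -subr_eq0; apply/eqP; exact: E.
Qed.

Lemma ext_d_spec l w : Hform l w -> L2form l.+1 (ext_d l w) /\ weak_ext_deriv l w (ext_d l w).
Proof.
move=> [_ [h Lh Wh]]; rewrite /ext_d.
have Hx : [set h | L2form l.+1 h /\ weak_ext_deriv l w h] !=set0 by exists h.
exact: (getPex Hx).
Qed.

Lemma ext_d_ae l w h : L2form l w -> L2form l.+1 h -> weak_ext_deriv l w h ->
  form_ae_eq l.+1 (ext_d l w) h.
Proof.
move=> Lw Lh Wh; have [|L1 W1] := @ext_d_spec l w; first by split => //; exists h.
exact: weak_ext_deriv_unique W1 Wh.
Qed.

(** Anticommutation of dx_i and dx_j: for i < j, removing i flips the sign of j and removing j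
    leaves that of i. *)
Lemma dsign_swap i j J : i \in J -> j \in J -> i != j ->
  dsign R j (J :\ j) * dsign R i (J :\ j :\ i) = - (dsign R i (J :\ i) * dsign R j (J :\ i :\ j)).
Proof.
wlog ij : i j / (i < j)%N => [H iJ jJ ij|iJ jJ _].
  have := ij; rewrite neq_ltn => /orP[lt|lt]; first exact: H.
  by rewrite (H j i lt jJ iJ) ?opprK// eq_sym.
have iN : i \notin J :\ i :\ j by rewrite !inE eqxx /= andbF.
have E : J :\ j = i |: J :\ i :\ j.
  apply/setP => b; rewrite !inE; case: (eqVneq b i) => [->|_] //=.
  by rewrite iJ andbT -val_eqE ltn_eqF.
have -> : dsign R j (J :\ j) = - dsign R j (J :\ i :\ j) by rewrite E dsign_setU1.
have -> : dsign R i (J :\ j :\ i) = dsign R i (J :\ i).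
  rewrite /dsign; congr (_ ^+ _); apply: eq_card => b; rewrite !inE.
  by case: (eqVneq b j) => [->|_]; rewrite ?andbT// (ltnNge j) (ltnW ij) !andbF.
by rewrite mulNr mulrC.
Qed.

(* By the symmetry of the second derivatives of test functions. *)
Lemma weak_ext_deriv_closed l w h : weak_ext_deriv l w h -> weak_ext_deriv l.+1 h 0.
Proof.
move=> W J cJ phi tphi.
rewrite -[LHS]/(ip cube (fun=> 0) _) ip0l; apply/esym/eqP; rewrite oppr_eq0; apply/eqP.
pose T j i : R := dsign R j (J :\ j) * dsign R i (J :\ j :\ i) *
  \int[cube]_x (w (J :\ j :\ i) x * partial i (partial j phi) (to_rV x)).
have T_swap i j : i \in J -> j \in J -> i != j -> T j i = - T i j.
  move=> iJ jJ ij; have [sphi _ _] := tphi.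
  have JE : J :\ j :\ i = J :\ i :\ j by apply/setP => b; rewrite !inE andbCA.
  by rewrite /T (dsign_swap iJ jJ ij) JE (partialC i j sphi) mulNr.
have E : \sum_(j in J) dsign R j (J :\ j) * \int[cube]_x (h (J :\ j) x * partial j phi (to_rV x)) =
    - \sum_(j in J) \sum_(i in J | i != j) T j i.
  rewrite -sumrN; apply: eq_bigr => j jJ.
  have cD : #|J :\ j| = l.+1 by move: cJ; rewrite (cardsD1 j) jJ add1n => -[].
  rewrite (W _ cD _ (test_partial j tphi)) mulrN; congr (- _).
  rewrite mulr_sumr; apply: eq_big => [i|i _]; last by rewrite mulrA.
  by rewrite !inE andbC.
(* The summand is antisymmetric, so the double sum equals its own opposite. *)
have E2 : \sum_(j in J) \sum_(i in J | i != j) T j i = - \sum_(j in J) \sum_(i in J | i != j) T j i.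
  rewrite {1}(exchange_big_dep (mem J))/=; last by move=> j i _ /andP[].
  rewrite -sumrN; apply: eq_bigr => i iJ; rewrite -sumrN; apply: eq_big => [j|j /andP[jJ /andP[_ ij]]].
    by rewrite iJ /= eq_sym.
  exact: T_swap.
by rewrite E; move: E2; move: (\sum_(j in J) _) => s; lra.
Qed.

End WeakExteriorDerivative.

(** * The sparse complex *)

Section SparseSpaces.
Variables (R : realType) (d k n : nat).
Local Notation RT := (measurableTypeR R).
Local Notation X := (d.-tuple RT).
Local Notation lam := (@lebesgue01 R).
Local Notation cube := (@lebesgue_cube R d).
Local Notation L2 := (Lfun lam 2%:E).
Variable psi : nat -> nat -> nat -> RT -> R.
Hypothesis hpsi : is_orthonormal_wavelets k psi.
Local Notation Z := (@Zspace R k).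
Local Notation W := (@Wsp R d n Z).
Local Notation V := (@Vspace R d k n psi).
Implicit Types (l : nat) (u v w : dform R d) (f g : X -> R) (i : 'I_d) (I : {set 'I_d}).

Let ZL m q : Z m q -> q \in L2.
Proof. exact: Zspace_L2. Qed.

Let Yc c : Yprim Z 0 (fun=> c).
Proof. exact: Yprim_const. Qed.

Lemma lspan_ae (S1 S2 : set (X -> R)) f :
  (forall g, S1 g -> exists2 g', lspan S2 g' & g = g' %[ae cube]) ->
  lspan S1 f -> exists2 f', lspan S2 f' & f = f' %[ae cube].
Proof.
move=> H [N [c [g [hg ->]]]].
have /choice[g' hg'] : forall a, exists g', lspan S2 g' /\ g a = g' %[ae cube].
  by move=> a; have [g' h1 h2] := H _ (hg a); exists g'.
exists (fun x => \sum_(a < N) c a * g' a x); first by apply: lspan_comb => a; have [] := hg' a.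
have : {ae cube, forall x, forall a, g a x = g' a x}.
  by apply: filter_forall => a; have [_] := hg' a; apply: filterS => x /(_ Logic.I).
by apply: filterS => x E _; apply: eq_bigr => a _; rewrite E.
Qed.

Lemma Wspace_Wsp I f : lspan (\bigcup_(m in Mset n) Wspace k psi m I) f ->
  exists2 g, W I g & f = g %[ae cube].
Proof.
apply: lspan_ae => g [m Mm]; apply: lspan_ae => _ [v [hZ hY ->]].
have /choice[v' hv'] : forall i, exists v' : RT -> R, (i \in I -> v' = v i) /\
    (i \notin I -> Yprim Z (m i) v') /\ v i = v' %[ae lam].
  move=> i; case: (boolP (i \in I)) => iI.
    by exists (v i); split => //; split => //; exact: aeW.
  by have [v' h1 h2] := Yspace_Yprim hpsi (hY i iI); exists v'.
exists (pure v'); last by apply: pure_ae => i; have [_ []] := hv' i.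
apply: lspan_mem; exists v' => //; exists m; split => // i iI; have [h1 [h2 _]] := hv' i; last exact: h2.
by rewrite h1//; exact: hZ.
Qed.

Lemma Wsp_Wspace I f : W I f ->
  exists2 g, lspan (\bigcup_(m in Mset n) Wspace k psi m I) g & f = g %[ae cube].
Proof.
apply: lspan_ae => _ [v [m [Mm hZ hY]] <-].
have /choice[v' hv'] : forall i, exists v' : RT -> R, (i \in I -> v' = v i) /\
    (i \notin I -> Yspace psi k (m i) v') /\ v i = v' %[ae lam].
  move=> i; case: (boolP (i \in I)) => iI.
    by exists (v i); split => //; split => //; exact: aeW.
  by have [v' h1 h2] := Yprim_Yspace hpsi (hY i iI); exists v'.
exists (pure v'); last by apply: pure_ae => i; have [_ []] := hv' i.
apply: lspan_mem; exists m => //; apply: lspan_mem; exists v'.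
split => [i iI|i iI|//]; have [h1 [h2 _]] := hv' i; last exact: h2.
by rewrite h1//; exact: hZ.
Qed.

(** Replaces Y factors by their primitive normal form; from here on only [Wsp] is handled. *)
Lemma Vspace_Wsp l w : V l w <->
  L2form l w /\ forall I, #|I| = l -> exists2 f, W I f & w I = f %[ae cube].
Proof.
split=> -[Lw H]; split => // I cI; have [f Wf wf] := H I cI.
  have [g Wg fg] := Wspace_Wsp Wf; exists g => //.
  by apply: filterS2 wf fg => x E1 E2 _; rewrite E1// E2.
have [g Wg fg] := Wsp_Wspace Wf; exists g => //.
by apply: filterS2 wf fg => x E1 E2 _; rewrite E1// E2.
Qed.

Lemma Vspace_L2 l w : V l w -> L2form l w.
Proof. by case. Qed.

Lemma lspan0 (S : set (X -> R)) : lspan S (fun=> 0).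
Proof.
by exists 0%N, (fun=> 0), (fun=> fun=> 0); split; [case|apply/funext => x; rewrite big_ord0].
Qed.

Lemma Vspace0 l : V l 0.
Proof. by split; [exact: L2form0|move=> I _; exists (fun=> 0); [exact: lspan0|exact: aeW]]. Qed.

Lemma Vspace_lin l a u v : V l u -> V l v -> V l (a *: u + v : dform R d).
Proof.
move=> [Lu Hu] [Lv Hv]; split; first exact: L2form_lin.
move=> I cI; have [f hf uf] := Hu I cI; have [g hg vg] := Hv I cI.
exists (fun x => a * f x + 1 * g x); first exact: lspan_lin.
apply: filterS2 uf vg => x E1 E2 _.
by rewrite -[LHS]/(a * u I x + v I x) E1// E2// mul1r.
Qed.

Lemma Vspace_ae l u v : L2form l v -> form_ae_eq l u v -> V l u -> V l v.
Proof.
move=> Lv uv [_ H]; split => // I cI; have [f Sf uf] := H I cI; exists f => //.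
by apply: filterS2 (uv I cI) uf => x E1 E2 _; rewrite -E1// E2.
Qed.

(** All levels are at most n + d - 1, so one finite family [G] generates every one-dimensional
    factor; expanding the product over i gives the d-fold products of [G]. *)
Lemma Wsp_finite : exists (F : finType) (G : F -> RT -> R), (forall a, G a \in L2) /\
  forall I f, W I f -> exists c : {ffun 'I_d -> F} -> R,
    f = (fun x => \sum_(s : {ffun 'I_d -> F}) c s * pure (fun i => G (s i)) x) %[ae cube].
Proof.
have fd m : fdim (Z m `|` Yprim Z m).
  by apply: fdimU; [exact: (fdim_Zspace hpsi)|apply: fdim_Yprim; [exact: ZL|exact: (fdim_Zspace hpsi)]].
have [F [G [LG HG]]] := fdim_bigcup (n + d - 1) fd.
exists F, G; split => // I f [N [c [p [hp ->]]]].
have /choice[C hC] : forall a, exists C : {ffun 'I_d -> F} -> R,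
    p a = (fun x => \sum_(s : {ffun 'I_d -> F}) C s * pure (fun i => G (s i)) x) %[ae cube].
  move=> a; have [v [m [Mm hZ hY]] <-] := hp a.
  have mi i : (m i <= n + d - 1)%N.
    by apply: leq_trans Mm; rewrite (bigD1 i)//= leq_addr.
  have /choice[C hC] : forall i, exists C : F -> R, v i = (fun x => \sum_b C b * G b x) %[ae lam].
    move=> i; apply: HG; exists (m i); first exact: mi.
    by case: (boolP (i \in I)) => iI; [left; exact: hZ|right; exact: hY].
  exists (fun s => \prod_i C i (s i)); apply: filterS (pure_ae hC) => x H _.
  rewrite H// /pure bigA_distr_bigA /=; apply: eq_bigr => s _.
  by rewrite big_split.
exists (fun s => \sum_(a < N) c a * C a s).
have : {ae cube, forall x, forall a,
    p a x = \sum_(s : {ffun 'I_d -> F}) C a s * pure (fun i => G (s i)) x}.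
  by apply: filter_forall => a; apply: filterS (hC a) => x /(_ Logic.I).
apply: filterS => x E _.
under eq_bigr do rewrite E mulr_sumr.
rewrite exchange_big /=; apply: eq_bigr => s _; rewrite mulr_suml.
by apply: eq_bigr => a _; rewrite mulrA.
Qed.

End SparseSpaces.

(** * Stability under d, exactness and finite dimension *)

Section SparseComplex.
Variables (R : realType) (d k n : nat).
Local Notation RT := (measurableTypeR R).
Local Notation X := (d.-tuple RT).
Local Notation lam := (@lebesgue01 R).
Local Notation cube := (@lebesgue_cube R d).
Local Notation L2c := (Lfun cube 2%:E).
Variable psi : nat -> nat -> nat -> RT -> R.
Hypothesis hpsi : is_orthonormal_wavelets k psi.
Local Notation Z := (@Zspace R k).
Local Notation W := (@Wsp R d n Z).
Local Notation V := (@Vspace R d k n psi).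
Local Notation ker := (@Zker R d k n psi).
Local Notation img := (@Bimg R d k n psi).
Implicit Types (l : nat) (u v w h z p b : dform R d) (i j : 'I_d) (I J : {set 'I_d}).

Lemma form_subE u v : u - v = (-1 *: v + u : dform R d).
Proof.
apply/funext => I; apply/funext => x.
by rewrite -[LHS]/(u I x - v I x) -[RHS]/(-1 * v I x + u I x) mulN1r addrC.
Qed.

Lemma form_addE u v : u + v = (1 *: u + v : dform R d).
Proof.
apply/funext => I; apply/funext => x.
by rewrite -[LHS]/(u I x + v I x) -[RHS]/(1 * u I x + v I x) mul1r.
Qed.

Lemma L2formB l u v : L2form l u -> L2form l v -> L2form l (u - v).
Proof. by move=> hu hv; rewrite form_subE; exact: L2form_lin. Qed.

Lemma innerB l u v w : L2form l u -> L2form l v -> L2form l w ->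
  inner l (u - v) w = inner l u w - inner l v w.
Proof. by move=> hu hv hw; rewrite form_subE inner_lin// mulN1r addrC. Qed.

Lemma innerD l u v w : L2form l u -> L2form l v -> L2form l w ->
  inner l (u + v) w = inner l u w + inner l v w.
Proof. by move=> hu hv hw; rewrite form_addE inner_lin// mul1r. Qed.

Lemma form_sumE (F : finType) (c : F -> R) (g : F -> dform R d) I x :
  (\sum_a c a *: g a : dform R d) I x = \sum_a c a * g a I x.
Proof.
by apply: (big_morph (fun u : dform R d => u I x)).
Qed.

(** Pythagoras for w = p + (w - p). *)
Lemma inner_min l p w : L2form l p -> L2form l w -> inner l (w - p) p = 0 ->
  inner l p p <= inner l w w.
Proof.
move=> Lp Lw; have Lwp := L2formB Lw Lp; have := inner_ge0 l (w - p).
rewrite (innerB Lw Lp Lwp) (innerC l p) => + E; rewrite E.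
move: E; rewrite (innerB Lw Lp Lp) (innerC l w (w - p)) (innerB Lw Lp Lw) (innerC l p w).
by move: (inner l w w) (inner l w p) (inner l p p) => A B C E; rewrite subr0; lra.
Qed.

Lemma Vspace_deriv l w : V l w -> exists2 h, V l.+1 h & weak_ext_deriv l w h.
Proof.
move=> /(Vspace_Wsp n hpsi)[Lw Hw].
have /choice[G HG] : forall p : 'I_d * {set 'I_d}, exists g : X -> R,
    #|p.2| = l -> p.1 \notin p.2 -> W (p.1 |: p.2) g /\ weak_partial p.1 (w p.2) g.
  move=> [j I] /=; have [cI|cI] := pselect (#|I| = l); last by exists (fun=> 0).
  have [jI|jI] := boolP (j \in I); first by exists (fun=> 0).
  have [f Wf wf] := Hw I cI.
  have [g Wg [fg _ _]] := Wsp_deriv (@Zspace_L2 R k) Wf jI.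
  exists g => _ _; split => // phi tphi; rewrite fg//; congr (- _).
  have Lq := L2_test (test_partial j tphi).
  have Lf := tens2_L2 (Wsp_tens2 (@Zspace_L2 R k) Wf).
  by apply: (ip_ae Lf (Lw I cI) Lq Lq); [apply: filterS wf => x E /E ->|exact: aeW].
pose h : dform R d := fun J x => \sum_(j in J) dsign R j (J :\ j) * G (j, J :\ j) x.
have cD J j : #|J| = l.+1 -> j \in J -> #|J :\ j| = l.
  by move=> cJ jJ; move: cJ; rewrite (cardsD1 j) jJ add1n => -[].
have GW J j : #|J| = l.+1 -> j \in J -> W J (G (j, J :\ j)).
  move=> cJ jJ; have [] := HG (j, J :\ j) (cD J j cJ jJ) (negbT (setD11 _ _)).
  by rewrite /= finset.setD1K.
have hW J : #|J| = l.+1 -> W J (h J).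
  move=> cJ; pose c j : R := if j \in J then dsign R j (J :\ j) else 0.
  pose F j : X -> R := if j \in J then G (j, J :\ j) else fun=> 0.
  rewrite (_ : h J = fun x => \sum_(j < d) c j * F j x); last first.
    apply/funext => x; rewrite /h big_mkcond; apply: eq_bigr => j _.
    by rewrite /c /F; case: ifP => //; rewrite mul0r.
  apply: lspan_comb => j; rewrite /F; case: ifP => jJ; first exact: GW.
  exact: lspan0.
have L2W J f : W J f -> f \in L2c by move=> Wf; exact: (tens2_L2 (Wsp_tens2 (@Zspace_L2 R k) Wf)).
exists h.
  apply/(Vspace_Wsp n hpsi); split; first by move=> J cJ; exact: L2W (hW J cJ).
  by move=> J cJ; exists (h J); [exact: hW|exact: aeW].
move=> J cJ phi tphi; rewrite -[LHS]/(ip cube _ _) /h ip_suml; last 2 first.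
- by move=> j jJ; apply: L2Z; exact: L2W (GW J j cJ jJ).
- exact: L2_test.
rewrite -sumrN; apply: eq_bigr => j jJ.
have [_ /= wp] := HG (j, J :\ j) (cD J j cJ jJ) (negbT (setD11 _ _)).
rewrite (ipZl _ (L2W _ _ (GW J j cJ jJ)) (L2_test tphi)) -mulrN; congr (_ * _).
exact: wp.
Qed.

Lemma Vspace_Hform l : V l `<=` Hform l.
Proof.
move=> v Vv; have [h Vh vh] := Vspace_deriv Vv.
by split; [exact: Vspace_L2 Vv|exists h => //; exact: Vspace_L2 Vh].
Qed.

Lemma ZkerP l v : ker l v <-> V l v /\ weak_ext_deriv l v 0.
Proof.
split=> -[Vv H]; split => //.
  have [Ld wd] := ext_d_spec (Vspace_Hform Vv); have Lv := Vspace_L2 Vv.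
  exact: (weak_ext_deriv_ae Lv Lv Ld (@L2form0 R d _) (form_ae_eq_refl _) H wd).
exact: (ext_d_ae (Vspace_L2 Vv) (@L2form0 R d _) H).
Qed.

Lemma Zker_lin l a u v : ker l u -> ker l v -> ker l (a *: u + v : dform R d).
Proof.
move=> /ZkerP[Vu Hu] /ZkerP[Vv Hv]; apply/ZkerP; split; first exact: Vspace_lin.
have -> : 0 = (a *: 0 + 0 : dform R d).
  by apply/funext => I; apply/funext => x; rewrite -[RHS]/(a * 0 + 0) mulr0 addr0.
by apply: weak_ext_deriv_lin => //; [exact: Vspace_L2 Vu|exact: Vspace_L2 Vv|exact: L2form0|exact: L2form0].
Qed.

Lemma Zker0 l : ker l 0.
Proof.
apply/ZkerP; split; first exact: Vspace0.
move=> J cJ phi tphi; rewrite -[LHS]/(ip cube (fun=> 0) _) ip0l big1 ?oppr0// => j _.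
by rewrite -[X in _ * X]/(ip cube (fun=> 0) _) ip0l mulr0.
Qed.

(** The homotopy operator is applied to a representative [h'] whose coefficients are genuine sparse
    tensors; [h] itself is only almost everywhere such. *)
Lemma Zker_potential l h : ker l.+1 h -> exists v,
  [/\ V l v, weak_ext_deriv l v h & pi ^+ 2 * inner l v v <= inner l.+1 h h].
Proof.
move=> /ZkerP[Vh h0]; have Lh := Vspace_L2 Vh.
have [_ Hh] := (Vspace_Wsp n hpsi l.+1 h).1 Vh.
have /choice[h' Hh'] : forall J, exists f : X -> R, #|J| = l.+1 -> W J f /\ h J = f %[ae cube].
  move=> J; have [cJ|cJ] := pselect (#|J| = l.+1); last by exists (fun=> 0).
  by have [f Wf hf] := Hh J cJ; exists f.
have hW J : #|J| = l.+1 -> W J (h' J) by move=> /(Hh' J)[].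
have hh' : form_ae_eq l.+1 h h' by move=> J /(Hh' J)[].
have L2W J f : W J f -> f \in L2c by move=> Wf; exact: (tens2_L2 (Wsp_tens2 (@Zspace_L2 R k) Wf)).
have Lh' : L2form l.+1 h' by move=> J cJ; exact: L2W (hW J cJ).
have closed : weak_ext_deriv l.+1 h' 0.
  exact: (weak_ext_deriv_ae Lh Lh' (@L2form0 R d _) (@L2form0 R d _) hh' (form_ae_eq_refl _) h0).
have KW I : #|I| = l -> W I (Kform h' I).
  exact: (Kform_W (@Zspace_L2 R k) (@Yprim_const R k) hW).
have LK : L2form l (Kform h') by move=> I cI; exact: L2W (KW I cI).
exists (Kform h'); split.
- apply/(Vspace_Wsp n hpsi); split => // I cI; exists (Kform h' I); [exact: KW|exact: aeW].
- have KD := homotopy_formula (@Zspace_L2 R k) hW closed.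
  exact: (weak_ext_deriv_ae LK LK Lh' Lh (form_ae_eq_refl _) (form_ae_eq_sym hh') KD).
- rewrite (inner_ae Lh Lh' Lh Lh' hh' hh').
  exact: (Kform_le (@Zspace_L2 R k) hW).
Qed.

(** One inclusion is d d = 0, the other the homotopy potential. Equality as sets matters: [L2proj]
    is a choice depending on the set, and can now be rewritten literally. *)
Lemma Bimg_Zker l : img l.+1 = ker l.+1.
Proof.
apply/seteqP; split => [h [Lh [v Vv hv]]|h kh].
  have [h' Vh' vh'] := Vspace_deriv Vv; have Lh' := Vspace_L2 Vh'; have Lv := Vspace_L2 Vv.
  have h'h : form_ae_eq l.+1 h' h.
    by apply: form_ae_eq_trans (form_ae_eq_sym hv); apply: form_ae_eq_sym; exact: ext_d_ae.
  apply/ZkerP; split; first exact: Vspace_ae h'h Vh'.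
  apply: (@weak_ext_deriv_closed _ _ l v).
  exact: (weak_ext_deriv_ae Lv Lv Lh' Lh (form_ae_eq_refl _) h'h vh').
have [v [Vv vh _]] := Zker_potential kh; have [Vh _] := kh; have Lh := Vspace_L2 Vh.
split => //; exists v => //; apply: form_ae_eq_sym.
exact: (ext_d_ae (Vspace_L2 Vv) Lh vh).
Qed.

Lemma Vspace_finite l : exists (F : finType) (g : F -> dform R d), (forall a, L2form l (g a)) /\
  forall v, V l v -> exists c : F -> R,
    let z : dform R d := v - \sum_a c a *: g a in inner l z z = 0.
Proof.
have [F [G [LG HG]]] := Wsp_finite d n hpsi.
pose F' := ({set 'I_d} * {ffun 'I_d -> F})%type.
(* Generators carried by a single coefficient, one for each index set and each product of
   one-dimensional generators. *)
pose g (a : F') : dform R d := fun J x => if J == a.1 then pure (fun i => G (a.2 i)) x else 0.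
have Lg a I : g a I \in L2c.
  by rewrite /g; case: eqP => _; [apply: L2_pure => i; exact: LG|exact: L2_cst].
exists F', g; split; first by move=> a I _; exact: Lg.
move=> v /(Vspace_Wsp n hpsi)[Lv Hv].
have /choice[c hc] : forall I, exists c : {ffun 'I_d -> F} -> R, #|I| = l ->
    v I = (fun x => \sum_s c s * pure (fun i => G (s i)) x) %[ae cube].
  move=> I; have [cI|cI] := pselect (#|I| = l); last by exists (fun=> 0).
  have [f Wf vf] := Hv I cI; have [c fc] := HG I f Wf.
  by exists c => _; apply: filterS2 vf fc => x E1 E2 _; rewrite E1// E2.
exists (fun a => c a.1 a.2) => z; rewrite /inner big1// => I /eqP cI.
have zI x : z I x = v I x - \sum_(a : F') c a.1 a.2 * g a I x.
  by rewrite -[LHS]/(v I x - (\sum_(a : F') c a.1 a.2 *: g a : dform R d) I x) form_sumE.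
have Lz : z I \in L2c.
  rewrite (_ : z I = fun x => v I x - \sum_(a : F') c a.1 a.2 * g a I x); last exact/funext.
  by apply: L2B; [exact: Lv|apply: L2_sum => a _; apply: L2Z; exact: Lg].
have L0 : (fun _ : X => 0) \in L2c by exact: L2_cst.
have z0 : z I = (fun=> 0) %[ae cube].
  apply: filterS (hc I cI) => x E _; rewrite zI E//.
  apply/eqP; rewrite subr_eq0; apply/eqP; rewrite /g.
  rewrite -(pair_bigA _ (fun J s => c J s * (if I == J then pure (fun i => G (s i)) x else 0))) /=.
  rewrite (bigD1 I)//= eqxx [X in _ = _ + X]big1 ?addr0// => J JI.
  by apply: big1 => s _; rewrite eq_sym (negbTE JI) mulr0.
by rewrite -[LHS]/(ip cube (z I) (z I)) (ip_ae Lz L0 Lz L0 z0 z0) ip0l.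
Qed.

End SparseComplex.

(** * The bounded cochain projections *)

Section BoundedProjection.
Variables (R : realType) (d k n : nat).
Local Notation RT := (measurableTypeR R).
Variable psi : nat -> nat -> nat -> RT -> R.
Hypothesis hpsi : is_orthonormal_wavelets k psi.
Local Notation V := (@Vspace R d k n psi).
Local Notation ker := (@Zker R d k n psi).
Local Notation perp := (@Zperp R d k n psi).
Local Notation rop := (@Rop R d k n psi).
Implicit Types (l : nat) (u v w h z p b : dform R d).

Lemma L2proj_spec l (E : set (dform R d)) w : E `<=` V l -> E 0 ->
  (forall a u v, E u -> E v -> E (a *: u + v : dform R d)) -> L2form l w ->
  E (L2proj l E w) /\ forall v, E v -> inner l (w - L2proj l E w) v = 0.
Proof.
move=> EV E0 Elin Lw; have [F [g [Lg Hg]]] := Vspace_finite d n hpsi l.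
have [p [Ep Hp]] := projection_exists (B := @inner R d l) (L := @L2form R d l)
  (@L2form_lin R d l) (@innerC R d l) (@inner_lin R d l) (@inner_ge0 R d l)
  (fun u Eu => Vspace_L2 (EV u Eu)) E0 Elin Lg (fun v Ev => Hg v (EV v Ev)) Lw.
have Hx : [set p | E p /\ forall v, E v -> inner l (w - p) v = 0] !=set0 by exists p.
exact: (getPex Hx).
Qed.

Lemma Zker_proj l w : L2form l w -> let p := L2proj l (ker l) w in
  ker l p /\ forall v, ker l v -> inner l (w - p) v = 0.
Proof.
apply: L2proj_spec; [by move=> v []|exact: Zker0|].
by move=> a u v; exact: Zker_lin.
Qed.

Lemma Zker_L2 l v : ker l v -> L2form l v.
Proof. by move=> [/Vspace_L2]. Qed.

Lemma VspaceB l u v : V l u -> V l v -> V l (u - v).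
Proof. by move=> Vu Vv; rewrite form_subE; exact: Vspace_lin. Qed.

Lemma weak_ext_derivB l w w' h h' : L2form l w -> L2form l w' -> L2form l.+1 h -> L2form l.+1 h' ->
  weak_ext_deriv l w h -> weak_ext_deriv l w' h' -> weak_ext_deriv l (w - w') (h - h').
Proof. by move=> *; rewrite !form_subE; exact: weak_ext_deriv_lin. Qed.

Lemma Zperp_Zker_eq0 l v : perp l v -> ker l v -> form_ae_eq l v 0.
Proof. by move=> [Vv Pv] Kv; apply: inner_eq0; [exact: Vspace_L2 Vv|exact: Pv]. Qed.

(** Subtracting from the homotopy potential v its projection on the kernel gives a candidate, so the
    choice is well founded. Then v - R b is closed and R b is orthogonal to it, so R b is no longer
    than v. *)
Lemma Rop_spec l b : ker l.+1 b ->
  [/\ perp l (rop l b), weak_ext_deriv l (rop l b) b &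
      pi ^+ 2 * inner l (rop l b) (rop l b) <= inner l.+1 b b].
Proof.
move=> Kb; have Lb := Zker_L2 Kb; have [v [Vv vb le]] := Zker_potential hpsi Kb.
have Lv := Vspace_L2 Vv; have [Kp Hp] := Zker_proj Lv.
have Lp := Zker_L2 Kp; have [Vp p0] := (ZkerP n hpsi _ _).1 Kp.
have Hx : [set z | perp l z /\ form_ae_eq l.+1 (ext_d l z) b] !=set0.
  exists (v - L2proj l (ker l) v); split.
    by split; [exact: VspaceB|exact: Hp].
  apply: (ext_d_ae (L2formB Lv Lp) Lb).
  have -> : b = b - 0 by rewrite subr0.
  exact: (weak_ext_derivB Lv Lp Lb (@L2form0 R d _)).
have [] : perp l (rop l b) /\ form_ae_eq l.+1 (ext_d l (rop l b)) b := getPex Hx.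
set z := rop l b => Pz zb; have [Vz Oz] := Pz; have Lz := Vspace_L2 Vz.
have [Ld zd] := ext_d_spec (Vspace_Hform hpsi Vz).
have zb' : weak_ext_deriv l z b.
  exact: (weak_ext_deriv_ae Lz Lz Ld Lb (form_ae_eq_refl _) zb zd).
split => //; apply: le_trans le; apply: ler_wpM2l; first exact: sqr_ge0.
apply: inner_min => //; rewrite innerC; apply: Oz; apply/(ZkerP n hpsi).
split; first exact: VspaceB.
have -> : 0 = b - b by rewrite subrr.
exact: weak_ext_derivB.
Qed.

Lemma Rop0 l b : ker l.+1 b -> form_ae_eq l.+1 b 0 -> form_ae_eq l (rop l b) 0.
Proof.
move=> Kb b0; have [Pz zb _] := Rop_spec Kb; have [Vz _] := Pz.
apply: Zperp_Zker_eq0 => //; apply/(ZkerP n hpsi); split => //.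
have Lz := Vspace_L2 Vz; have Lb := Zker_L2 Kb.
exact: (weak_ext_deriv_ae Lz Lz Lb (@L2form0 R d _) (form_ae_eq_refl _) b0 zb).
Qed.

(** No case distinction for l = d: no index set has d + 1 elements, so the conditions in that degree
    are vacuous. *)
Lemma pi_proj_spec l w : Hform l w ->
  let a := L2proj l (ker l) w in let b := L2proj l.+1 (ker l.+1) (ext_d l w) in
  [/\ pi_proj k n psi l w = a + rop l b, ker l a, ker l.+1 b, V l (pi_proj k n psi l w) &
      weak_ext_deriv l (pi_proj k n psi l w) b].
Proof.
move=> Hw a b; have [Lw _] := Hw; have [Ld wd] := ext_d_spec Hw.
have [Ka _] := Zker_proj Lw; have [Kb _] := Zker_proj Ld.
have [[Vz _] zb _] := Rop_spec Kb; have Lz := Vspace_L2 Vz; have Lb := Zker_L2 Kb.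
have [Va a0] := (ZkerP n hpsi _ _).1 Ka; have La := Vspace_L2 Va.
have E : pi_proj k n psi l w = a + rop l b by rewrite /pi_proj (Bimg_Zker d n hpsi).
split => //; rewrite E form_addE; first exact: Vspace_lin.
rewrite [X in weak_ext_deriv l _ X](_ : b = (1 *: 0 + b : dform R d)); last by rewrite -form_addE add0r.
exact: (weak_ext_deriv_lin _ La Lz (@L2form0 R d _) Lb).
Qed.

(** The difference v - pi v is closed, both sides having derivative b, and orthogonal to the kernel,
    since v - a and R b are; hence it vanishes. *)
Lemma pi_proj_id l v : V l v -> form_ae_eq l (pi_proj k n psi l v) v.
Proof.
move=> Vv; have Hv := Vspace_Hform hpsi Vv; have Lv := Vspace_L2 Vv.
have [Ld vd] := ext_d_spec Hv; have [E Ka Kb Vp pb] := pi_proj_spec Hv.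
set a := L2proj _ _ v in E Ka; set b := L2proj _ _ _ in E Kb pb.
have Lp := Vspace_L2 Vp; have Lb := Zker_L2 Kb; have La := Zker_L2 Ka.
have Kd : ker l.+1 (ext_d l v).
  rewrite -(Bimg_Zker d n hpsi); split => //; exists v => //; exact: form_ae_eq_refl.
have db : form_ae_eq l.+1 (ext_d l v) b.
  have [_ Hb] := Zker_proj Ld; have Kdb : ker l.+1 (ext_d l v - b).
    by rewrite form_subE; exact: Zker_lin.
  have := inner_eq0 (Zker_L2 Kdb) (Hb _ Kdb).
  move=> e I cI; apply: filterS (e I cI) => x e0 _; apply/eqP; rewrite -subr_eq0; apply/eqP.
  exact: e0.
have [[Vz Oz] zb _] := Rop_spec Kb; have Lz := Vspace_L2 Vz.
have Kp : ker l (v - pi_proj k n psi l v).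
  apply/(ZkerP n hpsi); split; first exact: VspaceB.
  have vb : weak_ext_deriv l v b.
    exact: (weak_ext_deriv_ae Lv Lv Ld Lb (form_ae_eq_refl _) db vd).
  have -> : 0 = b - b by rewrite subrr.
  exact: weak_ext_derivB.
have Lvp := Zker_L2 Kp.
have Pp : perp l (v - pi_proj k n psi l v).
  split => [|z Kz]; first exact: VspaceB.
  have Lz' := Zker_L2 Kz; have [_ Ha] := Zker_proj Lv.
  have := Ha z Kz; rewrite (innerB Lv La Lz') (innerB Lv Lp Lz') E (innerD La Lz Lz') (Oz z Kz) addr0.
  exact.
have := Zperp_Zker_eq0 Pp Kp.
move=> e I cI; apply: filterS (e I cI) => x e0 _; apply/eqP; rewrite eq_sym -subr_eq0; apply/eqP.
exact: e0.
Qed.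

(** Both sides contain the same chosen projection of dw on the kernel; what remains on the right is
    R of the projection of d d w, which is 0. *)
Lemma pi_proj_ext_d l w : Hform l w ->
  form_ae_eq l.+1 (ext_d l (pi_proj k n psi l w)) (pi_proj k n psi l.+1 (ext_d l w)).
Proof.
move=> Hw; have [E Ka Kb Vp pb] := pi_proj_spec Hw; have [Ld wd] := ext_d_spec Hw.
have dd := weak_ext_deriv_closed wd.
have L0 : L2form l.+2 (0 : dform R d) by exact: L2form0.
have Hd : Hform l.+1 (ext_d l w) by split => //; exists 0.
have [E' Ka' Kb' _ _] := pi_proj_spec Hd.
apply: form_ae_eq_trans (ext_d_ae (Vspace_L2 Vp) (Zker_L2 Kb) pb) _.
rewrite E'; set b' := L2proj l.+2 _ _ in Kb' *.
have dd0 : form_ae_eq l.+2 (ext_d l.+1 (ext_d l w)) 0 by exact: ext_d_ae.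
have Lb' := Zker_L2 Kb'.
have b'0 : form_ae_eq l.+2 b' 0.
  have [Ldd _] := ext_d_spec Hd; have [_ Hb'] := Zker_proj Ldd.
  apply: inner_eq0 => //; have := Hb' _ Kb'; rewrite (innerB Ldd Lb' Lb').
  rewrite (inner_ae Ldd L0 Lb' Lb' dd0 (form_ae_eq_refl _)).
  rewrite /inner [X in X - _]big1 ?sub0r; first by move/eqP; rewrite oppr_eq0 => /eqP.
  by move=> I _; exact: (ip0l (@lebesgue_cube R d) (b' I)).
move=> I cI; apply: filterS (Rop0 Kb' b'0 cI) => x r0 _.
set a' := L2proj l.+1 _ _.
by rewrite -[RHS]/(a' I x + rop l.+1 b' I x) r0// addr0.
Qed.

Lemma HnormE l w :
  Hnorm l w = Num.sqrt (inner l w w + inner l.+1 (ext_d l w) (ext_d l w)).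
Proof. by rewrite /Hnorm /L2norm !sqr_sqrtr ?inner_ge0. Qed.

Lemma pi_proj_le l w : Hform l w ->
  Hnorm l (pi_proj k n psi l w) <= Num.sqrt (1 + (pi : R) ^- 2) * Hnorm l w.
Proof.
move=> Hw; have [Lw _] := Hw; have [Ld wd] := ext_d_spec Hw.
have [E Ka Kb Vp pb] := pi_proj_spec Hw.
have Hp := Vspace_Hform hpsi Vp; have Lp := Vspace_L2 Vp.
set a := L2proj _ _ w in E Ka; set b := L2proj _ _ _ in E Kb pb.
have La := Zker_L2 Ka; have Lb := Zker_L2 Kb.
have [[Vz Oz] zb le] := Rop_spec Kb; have Lz := Vspace_L2 Vz.
have [_ Ha] := Zker_proj Lw; have [_ Hb] := Zker_proj Ld.
have aw : inner l a a <= inner l w w by apply: inner_min => //; exact: Ha.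
have bd : inner l.+1 b b <= inner l.+1 (ext_d l w) (ext_d l w) by apply: inner_min => //; exact: Hb.
(* a is closed and R b is orthogonal to the kernel, so the cross terms vanish. *)
have pE : inner l (pi_proj k n psi l w) (pi_proj k n psi l w) = inner l a a + inner l (rop l b) (rop l b).
  have za : inner l (rop l b) a = 0 by exact: Oz.
  rewrite {1}E (innerD La Lz Lp) (innerC l a) (innerC l (rop l b) (pi_proj _ _ _ _ _)) E.
  by rewrite (innerD La Lz La) (innerD La Lz Lz) (innerC l a (rop l b)) za addr0 add0r.
have dpb : form_ae_eq l.+1 (ext_d l (pi_proj k n psi l w)) b by exact: (ext_d_ae Lp Lb pb).
have [Ldp _] := ext_d_spec Hp.
have HE : Hnorm l (pi_proj k n psi l w) =
    Num.sqrt (inner l a a + inner l (rop l b) (rop l b) + inner l.+1 b b).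
  rewrite HnormE; congr (Num.sqrt (_ + _)); first exact: pE.
  exact: (inner_ae Ldp Lb Ldp Lb dpb dpb).
rewrite HE (HnormE l w).
have w0 := inner_ge0 l w; move: aw bd le w0.
move: (inner l a a) (inner l w w) (inner l.+1 b b) (inner l (rop l b) (rop l b))
  (inner l.+1 (ext_d l w) (ext_d l w)).
move=> A B C D F AB CF DC B0.
have p2 : 0 < (pi : R) ^- 2 by rewrite invr_gt0 exprn_gt0// pi_gt0.
have c0 : 0 <= 1 + (pi : R) ^- 2 by rewrite addr_ge0// ltW.
rewrite -sqrtrM//; apply: ler_wsqrtr.
have DF : D <= pi ^- 2 * C by rewrite ler_pdivlMl// exprn_gt0// pi_gt0.
have CF2 : pi ^- 2 * C <= pi ^- 2 * F by rewrite ler_pM2l.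
have B2 : 0 <= pi ^- 2 * B by rewrite mulr_ge0// ltW.
rewrite mulrDl mul1r mulrDr.
by move: (pi ^- 2 * B) (pi ^- 2 * F) (pi ^- 2 * C) DF CF2 B2 => X Y Q DF CF2 B2; lra.
Qed.

End BoundedProjection.

Theorem theorem5p6 (R : realType) (d : nat) (hd : (1 <= d)%N) (k n : nat)
    (psi : nat -> nat -> nat -> measurableTypeR R -> R)
    (hpsi : is_orthonormal_wavelets k psi) (l : nat) (hl : (l <= d)%N) :
  [/\ Vspace (d := d) k n psi l `<=` Hform l,
      forall w : dform R d, Hform l w -> Vspace k n psi l (pi_proj k n psi l w),
      forall v : dform R d, Vspace k n psi l v ->
        form_ae_eq l (pi_proj k n psi l v) v,
      (l < d)%N -> forall w : dform R d, Hform l w ->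
        form_ae_eq l.+1 (ext_d l (pi_proj k n psi l w))
                        (pi_proj k n psi l.+1 (ext_d l w)) &
      forall w : dform R d, Hform l w ->
        Hnorm l (pi_proj k n psi l w) <=
        Num.sqrt (1 + (pi : R) ^- 2) * Hnorm l w].
Proof.
split.
- exact: Vspace_Hform.
- by move=> w Hw; have [_ _ _ Vp _] := pi_proj_spec n hpsi Hw.
- by move=> v; exact: pi_proj_id.
- by move=> _ w; exact: pi_proj_ext_d.
- by move=> w; exact: pi_proj_le.
Qed.
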